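(* Let $x=(x_1,\dots,x_n)\in(\mathbb{S}^d)^n$ be $n=\pi_L$ points drawn from the harmonic ensemble. Then, for \[ t\le\frac{d+6}{(2L+d)L}, \] we have \[ \mathbb{E}_{x\in(\mathbb{S}^d)^n}(G(t,x))\le\frac{L(L+d)\,\pi_L^2\,\omega_{d-1}}{2(d+2)^2\,\omega_d}\,t^{d+2}=C_d\,n^{2+2/d}\,t^{d+2}+o(n^{2+2/d})\,t^{d+2}, \] where the $o(\cdot)$ is as $L\to\infty$ and \[ C_d=\frac{\Gamma(d+1)^{2/d}\,\omega_{d-1}}{2^{1+2/d}(d+2)^2\,\omega_d}. \]
   Context: $d\ge1$ and $L\ge1$ are integers. $\mathbb{S}^d$ is the unit sphere in $\mathbb{R}^{d+1}$, $\mu$ its normalized (probability) surface measure, and $\omega_d=2\pi^{(d+1)/2}/\Gamma(\frac{d+1}{2})$ its surface area. For a distance $t\ge0$, $G(t,x)=\#\{(i,j):i<j,\ \|x_i-x_j\|\le t\}$. $\Pi_L$ is the space of restrictions to $\mathbb{S}^d$ of polynomials of degree at most $L$ in $d+1$ variables, $\pi_L=\dim\Pi_L=\frac{2L+d}{d}\binom{d+L-1}{L}$, and $K_L(x,y)$ is the reproducing kernel of $\Pi_L$ in $L^2(\mu)$. The harmonic ensemble is the determinantal point process on $\mathbb{S}^d$ with kernel $K_L$ with respect to $\mu$; it has $n=\pi_L$ points a.s., and $x=(x_1,\dots,x_n)$ drawn from it is the random vector in $(\mathbb{S}^d)^n$ with density $\frac1{n!}\det(K_L(x_i,x_j))_{1\le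 i,j\le n}$ with respect to $\mu^{\otimes n}$.
   Formalization: The inequality is stated for (d,L) ≠ (1,1): for d = L = 1, n = 3 and t = 2 ≤ 7/3 all three pairs lie within distance 2, so the expectation is 3, while the bound is 8/π < 3. The asymptotic equality keeps all d, L ≥ 1. *)

(* Defs.v *)
(* The multinomials library is required without being imported: its notations
   clash with those of MathComp-Analysis. *)
From HB Require Import structures.
From mathcomp Require Import all_boot all_order all_algebra.
From mathcomp Require Import all_classical all_reals all_analysis.
From mathcomp Require Import measurable_realfun.
From mathcomp Require mpoly.

Set Implicit Arguments.
Unset Strict Implicit.
Unset Printing Implicit Defensive.
Import Order.TTheory GRing.Theory Num.Theory.
Import numFieldNormedType.Exports.

Local Open Scope classical_set_scope.
Local Open Scope ring_scope.

Section PowerMeasure.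
Context d (T : measurableType d) (R : realType).

Definition cons_pair n (p : T * n.-tuple T) : n.+1.-tuple T :=
  [tuple of p.1 :: p.2].

Lemma measurable_cons_pair n : measurable_fun [set: _] (@cons_pair n).
Proof. exact: measurable_cons. Qed.

HB.instance Definition _ n :=
  isMeasurableFun.Build _ _ _ _ (@cons_pair n) (@measurable_cons_pair n).

Section Cons.
Context (mu : {sigma_finite_measure set T -> \bar R}) (n : nat).
Context (nu : {sigma_finite_measure set (n.-tuple T) -> \bar R}).

Definition cons_measure : set (n.+1.-tuple T) -> \bar R :=
  pushforward (mu \x nu)%E (@cons_pair n).

Let cons_measure0 : cons_measure set0 = 0%E.
Proof. by rewrite /cons_measure /pushforward preimage_set0 measure0. Qed.

Let cons_measure_ge0 A : (0 <= cons_measure A)%E.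
Proof. exact: measure_ge0. Qed.

Let cons_measure_sigma_additive : semi_sigma_additive cons_measure.
Proof.
exact: (@measure_semi_sigma_additive _ _ _
  (pushforward (mu \x nu)%E (@cons_pair n))).
Qed.

HB.instance Definition _ := isMeasure.Build _ _ _ cons_measure
  cons_measure0 cons_measure_ge0 cons_measure_sigma_additive.

Lemma cons_measure_sigma_finite : sigma_finite setT cons_measure.
Proof.
have /sigma_finiteP[F [FT ndF Foo]] := sigma_finiteT mu.
have /sigma_finiteP[G [GT ndG Goo]] := sigma_finiteT nu.
pose uncons (w : n.+1.-tuple T) : T * n.-tuple T :=
  (tnth w ord0, [tuple of behead w]).
have unconsK p : uncons (cons_pair p) = p.
  by case: p => a w; congr pair; apply/val_inj.
have muncons : measurable_fun setT uncons.
  by apply: measurable_fun_pair;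
    [exact: measurable_tnth|exact: measurable_behead].
exists (fun k => uncons @^-1` (F k `*` G k)).
  rewrite -preimage_bigcup (_ : \bigcup_k _ = setT) ?preimage_setT//.
  rewrite -setXTT FT GT predeqE => -[x y]; split.
    by move=> [k _ []/= ? ?]; split; exists k.
  move=> [/= [k _ Fkx] [l _ Gly]]; exists (maxn k l) => //; split.
  - by move: x Fkx; exact/subsetPset/ndF/leq_maxl.
  - by move: y Gly; exact/subsetPset/ndG/leq_maxr.
move=> k; have [mF Fk] := Foo k; have [mG Gk] := Goo k.
split; first by rewrite -[X in measurable X]setTI; apply: muncons => //;
  exact: measurableX.
rewrite /cons_measure /pushforward (_ : _ @^-1` _ = F k `*` G k).
  by rewrite product_measure1E// lte_mul_pinfty// ge0_fin_numE.
by rewrite -comp_preimage (_ : _ \o _ = id)//; exact/funext/unconsK.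
Qed.

HB.instance Definition _ := @Measure_isSigmaFinite.Build _ _ _ cons_measure
  cons_measure_sigma_finite.

End Cons.

Fixpoint power_measure (mu : {sigma_finite_measure set T -> \bar R}) (n : nat) :
    {sigma_finite_measure set (n.-tuple T) -> \bar R} :=
  if n is m.+1 then cons_measure mu (power_measure mu m)
  else \d_([tuple] : 0.-tuple T).

End PowerMeasure.

(* [lebesgue_measure], whose carrier is the alias [measurableTypeR R] of R, as a
   measure on R itself *)
Section LebesgueOn.
Context (R : realType).

Definition lebesgue_on : set R -> \bar R := @lebesgue_measure R.

Let lebesgue_on0 : lebesgue_on set0 = 0%E.
Proof. exact: measure0. Qed.

Let lebesgue_on_ge0 A : (0 <= lebesgue_on A)%E.
Proof. exact: measure_ge0. Qed.

Let lebesgue_on_sigma_additive : semi_sigma_additive lebesgue_on.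
Proof. exact: (@measure_semi_sigma_additive _ _ _ (@lebesgue_measure R)). Qed.

HB.instance Definition _ := isMeasure.Build _ _ _ lebesgue_on
  lebesgue_on0 lebesgue_on_ge0 lebesgue_on_sigma_additive.

Let lebesgue_on_sigma_finite : sigma_finite setT lebesgue_on.
Proof. exact: (sigma_finiteT (@lebesgue_measure R)). Qed.

HB.instance Definition _ := @Measure_isSigmaFinite.Build _ _ _ lebesgue_on
  lebesgue_on_sigma_finite.

End LebesgueOn.

Section Euclid.
Context (R : realType) (n : nat).
Implicit Types x y : n.-tuple R.

Definition enorm x : R := Num.sqrt (\sum_(i < n) tnth x i ^+ 2).

Definition edist x y : R :=
  Num.sqrt (\sum_(i < n) (tnth x i - tnth y i) ^+ 2).

Lemma measurable_enorm : measurable_fun [set: n.-tuple R] enorm.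
Proof.
pose q (x : n.-tuple R) : R := \sum_(i < n) tnth x i ^+ 2.
have mq : measurable_fun setT q.
  apply: measurable_sum => i; apply: measurable_funX; exact: measurable_tnth.
apply: (measurableT_comp _ mq); apply: continuous_measurable_fun.
exact: sqrt_continuous.
Qed.

Definition lebesgue_power : {sigma_finite_measure set (n.-tuple R) -> \bar R} :=
  power_measure (@lebesgue_on R) n.

Definition unit_ball : set (n.-tuple R) := [set x | enorm x <= 1].

Lemma measurable_unit_ball : measurable unit_ball.
Proof.
rewrite -[X in measurable X]setTI.
have -> : unit_ball = enorm @^-1` `]-oo, 1].
  by apply/seteqP; split => x /=; rewrite in_itv.
by apply: measurable_enorm => //; exact: measurable_itv.
Qed.

End Euclid.

Definition sphere (R : realType) (d : nat) : Type :=
  {x : d.+1.-tuple R | enorm x == 1}.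

Section Sphere.
Context (R : realType) (d : nat).

HB.instance Definition _ := SubType.on (sphere R d).
HB.instance Definition _ := [Choice of sphere R d by <:].

Definition sphere_val (x : sphere R d) : d.+1.-tuple R := val x.

Lemma pole_subproof :
  enorm [tuple (i == ord0)%:R | i < d.+1] == 1 :> R.
Proof.
rewrite /enorm big_ord_recl tnth_mktuple eqxx expr1n big1 ?addr0 ?sqrtr1//.
by move=> i _; rewrite tnth_mktuple expr0n.
Qed.

Definition pole : sphere R d :=
  exist (fun x : d.+1.-tuple R => enorm x == 1) _ pole_subproof.

HB.instance Definition _ := isPointed.Build (sphere R d) pole.

HB.instance Definition _ := Measurable.copy (sphere R d)
  (g_sigma_algebra_preimageType sphere_val).

(* x |-> x / |x|; the value at the origin is irrelevant *)
Definition sphere_proj (x : d.+1.-tuple R) : sphere R d :=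
  insubd pole [tuple tnth x i / enorm x | i < d.+1].

Lemma measurable_sphere_proj : measurable_fun [set: _] sphere_proj.
Proof.
suff H : measurable_fun [set: _] (sphere_val \o sphere_proj).
  move=> _ _ [B mB <-]; rewrite !setTI -comp_preimage -[X in measurable X]setTI.
  exact: H.
pose u (x : d.+1.-tuple R) := [tuple tnth x i / enorm x | i < d.+1].
have mu : measurable_fun [set: _] u.
  apply/measurable_fun_tnthP => i.
  rewrite (_ : _ \o _ = (tnth (T:=R) ^~ i) \* (fun x => enorm x `^ (-1))).
    apply: measurable_funM; first exact: measurable_tnth.
    by apply: (measurableT_comp (measurable_powR _)); exact: measurable_enorm.
  by apply/funext => x /=; rewrite tnth_mktuple powR_inv1// sqrtr_ge0.
rewrite (_ : _ \o _ = fun x => if enorm (u x) == 1 then u x else sphere_val pole).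
  apply: measurable_fun_ifT => //.
  apply: measurable_fun_eqr => //.
  by apply: (measurableT_comp _ mu); exact: measurable_enorm.
by apply/funext => x /=; rewrite /sphere_val /sphere_proj val_insubd.
Qed.

HB.instance Definition _ :=
  isMeasurableFun.Build _ _ _ _ sphere_proj measurable_sphere_proj.

(* A |-> Leb {x | |x| <= 1, x / |x| \in A}, which is the surface measure up to
   the factor d + 1 (polar coordinates) *)
Definition cone_measure : set (sphere R d) -> \bar R :=
  pushforward (mrestr (lebesgue_power R d.+1)
                      (@measurable_unit_ball R d.+1)) sphere_proj.

Let cone_measure0 : cone_measure set0 = 0%E.
Proof. by rewrite /cone_measure /pushforward preimage_set0 measure0. Qed.

Let cone_measure_ge0 A : (0 <= cone_measure A)%E.
Proof. exact: measure_ge0. Qed.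

Let cone_measure_sigma_additive : semi_sigma_additive cone_measure.
Proof.
exact: (@measure_semi_sigma_additive _ _ _ (pushforward
  (mrestr (lebesgue_power R d.+1) (@measurable_unit_ball R d.+1)) sphere_proj)).
Qed.

HB.instance Definition _ := isMeasure.Build _ _ _ cone_measure
  cone_measure0 cone_measure_ge0 cone_measure_sigma_additive.

(* The total mass of [cone_measure] is the volume of the unit ball, hence
   neither 0 nor +oo: the default value \d_pole of [mnormalize] is not used. *)
Definition sphere_measure : probability (sphere R d) R :=
  mnormalize cone_measure \d_pole.

Definition Pi (L : nat) : set (sphere R d -> R) :=
  [set f | exists2 p : mpoly.mpoly d.+1 R,
     all (fun m => mpoly.mdeg m <= L)%N (mpoly.msupp p) &
     forall x, f x = mpoly.meval (tnth (sphere_val x)) p].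

End Sphere.

Definition has_dim (R : realType) (T : Type) (V : set (T -> R)) (n : nat) :=
  exists2 b : 'I_n -> T -> R, (forall i, V (b i)) &
    forall f, V f -> exists! c : 'rV[R]_n,
      forall x, f x = \sum_(i < n) c 0 i * b i x.

Definition dim_Pi (R : realType) (d L : nat) : nat :=
  xget 0%N [set n | has_dim (@Pi R d L) n].

Definition reproducing_kernel (R : realType) (d L : nat)
    (K : sphere R d -> sphere R d -> R) :=
  (forall y, Pi L (K ^~ y)) /\
  (forall f y, Pi L f ->
    f y = \int[sphere_measure R d]_x (f x * K x y)).

Definition harmonic_ensemble (R : realType) (d L : nat) (dO : measure_display)
    (Omega : measurableType dO) (P : probability Omega R)
    (X : {RV P >-> (dim_Pi R d L).-tuple (sphere R d)}) :=
  exists2 K : sphere R d -> sphere R d -> R, reproducing_kernel L K &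
  forall A, measurable A -> distribution P X A =
    (\int[power_measure (sphere_measure R d) (dim_Pi R d L)]_(x in A)
      ((\det (\matrix_(i, j) K (tnth x i) (tnth x j))
        / (dim_Pi R d L)`!%:R)%:E))%E.

Definition close_pairs (R : realType) (d n : nat) (t : R)
    (x : n.-tuple (sphere R d)) : nat :=
  #|[set p : 'I_n * 'I_n | (p.1 < p.2)%N &&
      (edist (sphere_val (tnth x p.1)) (sphere_val (tnth x p.2)) <= t)]|.

(* Euler's integral, for s > 0 *)
Definition Gamma (R : realType) (s : R) : R :=
  \int[@lebesgue_measure R]_(x in `]0, +oo[) (x `^ (s - 1) * expR (- x)).

Definition omega (R : realType) (d : nat) : R :=
  2 * pi `^ (d.+1%:R / 2) / Gamma (d.+1%:R / 2).

Definition C_ (R : realType) (d : nat) : R :=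
  Gamma (d.+1%:R) `^ (2 / d%:R) * omega R d.-1 /
  (2 `^ (1 + 2 / d%:R) * (d%:R + 2) ^+ 2 * omega R d).

(* Pitfall: for d = L = 1 the inequality E(G(t, x)) <= bound_coef * t ^ (d + 2)
   fails at t = 2, although 2 <= (d + 6) / ((2 * L + d) * L) = 7 / 3: all three
   pairs of points of the circle are at distance at most 2, so the expectation
   is 3, whereas bound_coef * 2 ^ 3 = 8 / pi < 3. *)
Definition bound_coef (R : realType) (d L : nat) : R :=
  L%:R * (L%:R + d%:R) * (dim_Pi R d L)%:R ^+ 2 * omega R d.-1 /
  (2 * (d%:R + 2) ^+ 2 * omega R d).

(* Main.v *)
(* Let K be the kernel, n = pi_L and G the number of pairs at distance at most
   t. Expanding det K over a pair of biorthogonal bases of Pi_L gives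
     E G = 1/2 \int \int 1_(|x - y| <= t) (K x x * K y y - K x y ^ 2).
   The surface measure is invariant under the reflections in hyperplanes, so
   uniqueness of the reproducing kernel yields K x y = k(s) with s = <x, y>, and
   k(1) = n. Since (1 - s) k is orthogonal to the zonal polynomials of degree
   less than L, k satisfies the Jacobi equation
     (1 - s^2) k'' - (1 + (d + 1) s) k' + L (L + d) k = 0.
   Hence k / n is an explicit alternating sum in v = (1 - s) / 2 = |x - y|^2 / 4;
   the bound on t makes its terms decrease from the quadratic one on, so that
   k / n >= 1 - 2 L (L + d) / (d + 2) * v. The resulting bound on n^2 - k^2 is
   integrated exactly over a spherical cap. Finally,
   pi_L = C(d + L, d) + C(d + L - 1, d) ~ 2 L^d / d!. *)

From mathcomp Require Import all_boot all_order all_algebra all_fingroup.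
From mathcomp Require Import all_classical all_reals all_analysis.
From mathcomp Require Import measurable_realfun ring lra zify.
From mathcomp Require mpoly.
Require Import Defs.

Set Implicit Arguments.
Unset Strict Implicit.
Unset Printing Implicit Defensive.
Import Order.TTheory GRing.Theory Num.Theory.
Import numFieldNormedType.Exports.
Import -(notations) mpoly.

Local Open Scope classical_set_scope.
Local Open Scope ring_scope.

(** * Powers of a measure, and Lebesgue measure on tuples *)

(** Reflections are the only isometries used: the one in the bisecting hyperplane exchanges two
    given points of the sphere. Their invariance is not visible on a product measure coordinate by
    coordinate, so it is derived from the uniqueness, up to a factor, of translation-invariant
    integrals. The law of <x, y> is carried to the whole line by s = t / sqrt(1 + t^2), where its
    total mass is a quotient of Gamma values obtained by Tonelli. In this variable a constant times
    the derivative of |x - y|^(d + 2) dominates the integrand, which is why the cap integral closes.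
    The circle is the delicate case: for d = 1 the weight (1 - s^2)^(d / 2 - 1) exceeds the power |x
    - y|^(d - 2) that replaces it when d >= 2. The loss is recovered by keeping the square in 1 - (k
    / n)^2 instead of bounding it by 2 (1 - k / n). The reproducing kernel given with the ensemble
    already implies that the L^2 product is definite on Pi_L. Hence the Gram matrix of any basis is
    invertible and a dual basis exists without orthonormalisation. *)

Section PowerMeasureTheory.
Context d (T : measurableType d) (R : realType).
Variable mu : {sigma_finite_measure set T -> \bar R}.
Local Open Scope ereal_scope.

Lemma ge0_integral_power_measure0 (f : 0.-tuple T -> \bar R) :
  measurable_fun setT f -> (forall x, 0 <= f x) ->
  \int[power_measure mu 0]_w f w = f [tuple].
Proof. by move=> mf f0; rewrite integral_dirac// diracT mul1e. Qed.

Lemma ge0_integral_power_measureS n (f : n.+1.-tuple T -> \bar R) :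
  measurable_fun setT f -> (forall x, 0 <= f x) ->
  \int[power_measure mu n.+1]_w f w =
  \int[mu]_x \int[power_measure mu n]_w f (cons_pair (x, w)).
Proof.
move=> mf f0; rewrite (ge0_integral_pushforward (@measurable_cons_pair _ T n))//.
rewrite preimage_setT (fubini_tonelli1 (f \o @cons_pair _ T n))//; last first.
  by move=> x; exact: f0.
exact: measurableT_comp mf (@measurable_cons_pair _ T n).
Qed.

Lemma ge0_integral_power_measureSr n (f : n.+1.-tuple T -> \bar R) :
  measurable_fun setT f -> (forall x, 0 <= f x) ->
  \int[power_measure mu n.+1]_w f w =
  \int[power_measure mu n]_w \int[mu]_x f (cons_pair (x, w)).
Proof.
move=> mf f0; rewrite (ge0_integral_pushforward (@measurable_cons_pair _ T n))//.
rewrite preimage_setT (fubini_tonelli2 (f \o @cons_pair _ T n))//; last first.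
  by move=> x; exact: f0.
exact: measurableT_comp mf (@measurable_cons_pair _ T n).
Qed.

Definition map_coord n (phi : nat -> T -> T) (w : n.-tuple T) : n.-tuple T :=
  [tuple phi i (tnth w i) | i < n].

Lemma measurable_map_coord n (phi : nat -> T -> T) :
  (forall i, measurable_fun setT (phi i)) ->
  measurable_fun setT (@map_coord n phi).
Proof.
move=> mphi; apply/measurable_fun_tnthP => i.
rewrite (_ : _ \o _ = phi i \o (fun w => tnth w i)).
  by apply: measurableT_comp => //; exact: measurable_tnth.
by apply/funext => w; rewrite /= tnth_mktuple.
Qed.

Lemma map_coord_cons n (phi : nat -> T -> T) x (w : n.-tuple T) :
  map_coord phi (cons_pair (x, w)) =
  cons_pair (phi 0%N x, map_coord (fun i => phi i.+1) w).
Proof.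
apply: eq_from_tnth => i; rewrite tnth_mktuple.
by have [j ->|->] := unliftP ord0 i; rewrite ?tnthS ?tnth_mktuple// !tnth0.
Qed.

(** Induction on [n] by Tonelli: each coordinate contributes one factor [c]. The map [phi] depends
    on the index in order to cover translations by a vector; the common factor [c] covers
    homotheties. *)
Lemma ge0_integral_map_coord n (phi : nat -> T -> T) (c : R)
    (f : n.-tuple T -> \bar R) :
  (0 <= c)%R -> (forall i, measurable_fun setT (phi i)) ->
  (forall i (g : T -> \bar R), measurable_fun setT g -> (forall x, 0 <= g x) ->
    \int[mu]_x g (phi i x) = c%:E * \int[mu]_x g x) ->
  measurable_fun setT f -> (forall x, 0 <= f x) ->
  \int[power_measure mu n]_w f (map_coord phi w) =
  (c ^+ n)%:E * \int[power_measure mu n]_w f w.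
Proof.
move=> c0; elim: n phi f => [|n IH] phi f mphi hphi mf f0.
  rewrite !ge0_integral_power_measure0 ?expr0 ?mul1e//.
    by congr f; exact: tuple0.
  by apply: measurableT_comp mf _; exact: measurable_map_coord.
rewrite !ge0_integral_power_measureS//; last first.
  by apply: measurableT_comp mf _; exact: measurable_map_coord.
pose g x := \int[power_measure mu n]_w f (cons_pair (x, w)).
have mfc : measurable_fun setT (fun p : T * n.-tuple T => f (cons_pair p)).
  exact: measurableT_comp mf (@measurable_cons_pair _ T n).
have mfx x : measurable_fun setT (fun w : n.-tuple T => f (cons_pair (x, w))).
  by apply: measurableT_comp mfc _; exact: measurable_fun_pair.
have mg : measurable_fun setT g by exact: (measurable_fun_fubini_tonelli_F (fun p => f (cons_pair p))).
transitivity (\int[mu]_x ((c ^+ n)%:E * g (phi 0%N x))).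
  apply: eq_integral => x _.
  under eq_integral do rewrite map_coord_cons.
  rewrite (IH (fun i => phi i.+1) (fun w => f (cons_pair (phi 0%N x, w))))//.
  by move=> i; exact: hphi.
have g0 x : 0 <= g x by apply: integral_ge0.
have mgphi : measurable_fun setT (g \o phi 0%N) by exact: measurableT_comp mg _.
have cn0 : (0 <= c ^+ n)%R by rewrite exprn_ge0.
rewrite (ge0_integralZl_EFin mu measurableT (fun x _ => g0 (phi 0%N x)) mgphi cn0).
by rewrite (hphi 0%N g mg g0) muleA -EFinM exprSr.
Qed.

End PowerMeasureTheory.

Section LebesgueLine.
Context (R : realType).
Local Open Scope ereal_scope.

Lemma measurable_affine (a b : R) :
  measurable_fun setT (fun x : R => a * x + b)%R.
Proof.
apply: measurable_funD; last exact: measurable_cst.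
exact: measurable_funM.
Qed.

Lemma lebesgue_on_affine (a b : R) (A : set R) : (0 < a)%R -> measurable A ->
  pushforward (@lebesgue_on R) (fun x => a * x + b)%R A =
  a^-1%:E * lebesgue_on A.
Proof.
move=> a0 mA.
pose phi : R -> R := (fun x => a * x + b)%R.
have ma0 : (0 <= a)%R by exact: ltW.
(* Multiplied by [a], the pushforward gives every interval ]u, v] its length, so uniqueness of
   Lebesgue measure applies. *)
have := @lebesgue_measure_unique R
  (mscale (NngNum ma0) (pushforward (@lebesgue_on R) (phi : R -> measurableTypeR R))).
move=> /(_ (measurable_affine a b)) H.
rewrite /lebesgue_on (H _ A mA).

  by rewrite /mscale/= muleA -EFinM mulVf ?gt_eqF// mul1e.
  move=> _ [[u v]] _ <-; rewrite /mscale/= /pushforward.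
  have phiE : phi @^-1` `]u, v] = `]((u - b) / a)%R, ((v - b) / a)%R]%classic.
    apply/seteqP; split => x /=; rewrite !in_itv/= /phi;
    by rewrite ltr_pdivrMr// ler_pdivlMr// ltrBlDr lerBrDr mulrC.
  transitivity (a%:E * lebesgue_measure (phi @^-1` `]u, v])); last by [].
  rewrite phiE !lebesgue_measure_itv/= !lte_fin.
  rewrite ltr_pM2r ?invr_gt0// ltrD2r; case: ifPn; rewrite ?mule0// => _.
  by rewrite -!EFinB -EFinM -mulrBl mulrCA divff ?gt_eqF// mulr1; congr EFin; ring.
Qed.

Lemma ge0_integral_affine (a b : R) (f : R -> \bar R) : (0 < a)%R ->
  measurable_fun setT f -> (forall x, 0 <= f x) ->
  \int[@lebesgue_on R]_x f (a * x + b)%R = a^-1%:E * \int[@lebesgue_on R]_x f x.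
Proof.
move=> a0 mf f0.
have ia0 : (0 <= a^-1)%R by rewrite invr_ge0 ltW.
pose phi : R -> R := (fun x => a * x + b)%R.
have mphi : measurable_fun setT phi by exact: measurable_affine.
have := ge0_integral_pushforward mphi (@lebesgue_on R) measurableT mf (fun x _ => f0 x).
rewrite preimage_setT => <-.
transitivity (\int[mscale (NngNum ia0) (@lebesgue_on R)]_x f x).
  by apply: eq_measure_integral => A mA _; exact: (lebesgue_on_affine b a0 mA).
by rewrite ge0_integral_mscale.
Qed.

End LebesgueLine.

Section RestrictedMeasure.
Context d (T : measurableType d) (R : realType) (mu : {measure set T -> \bar R}).
Local Open Scope ereal_scope.

Lemma ge0_integral_mrestr (D : set T) (mD : measurable D) (f : T -> \bar R) :
  measurable_fun setT f -> (forall x, 0 <= f x) ->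
  \int[mrestr mu mD]_x f x = \int[mu]_(x in D) f x.
Proof.
move=> mf f0; have mCD : measurable (~` D) by exact: measurableC.
have nCD : mrestr mu mD (~` D) = 0 by rewrite /mrestr setICl measure0.
have H := ge0_negligible_integral mCD measurableT mf (fun x _ => f0 x) nCD.
rewrite H setTD setCK; apply: eq_measure_integral => A mA AD.
by rewrite /= /mrestr (setIidl AD).
Qed.

End RestrictedMeasure.

Section Box.
Context d (T : measurableType d) (R : realType).
Variable mu : {sigma_finite_measure set T -> \bar R}.
Local Open Scope ereal_scope.

Definition box n (A : set T) : set (n.-tuple T) :=
  [set w | forall i, A (tnth w i)].

Lemma measurable_box n (A : set T) : measurable A -> measurable (@box n A).
Proof.
move=> mA; rewrite (_ : box A = \bigcap_(i in [set: 'I_n])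
    ((fun w : n.-tuple T => tnth w i) @^-1` A)); last first.
  by apply/seteqP; split => w /= wA i; [move=> _; exact: wA|exact: wA].
apply: fin_bigcap_measurable; first exact: finite_finset.
by move=> i _; rewrite -[X in measurable X]setTI; exact: measurable_tnth.
Qed.

Lemma power_measure_box n (A : set T) : measurable A ->
  power_measure mu n (box A) = mu A ^+ n.
Proof.
move=> mA; elim: n => [|n IH].
  by rewrite /= diracE mem_set// => -[].
rewrite expeS -IH -product_measure1E//; last exact: measurable_box.
rewrite [LHS]/= /cons_measure /pushforward.
congr product_measure1; apply/seteqP; split => -[x w] /=.
  move=> H; split; first by have := H ord0; rewrite tnth0.
  by move=> i; have := H (lift ord0 i); rewrite tnthS.
move=> [Ax Aw] i; have [j ->|->] := unliftP ord0 i; rewrite ?tnthS ?tnth0//.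
Qed.

End Box.

(** * Scalar product and reflections *)

Section Tuples.
Context (R : realType) (n : nat).
Implicit Types x y v : n.-tuple R.

Definition dotp x y : R := \sum_(i < n) tnth x i * tnth y i.

Definition tsub x y : n.-tuple R := [tuple tnth x i - tnth y i | i < n].

Definition tscale (a : R) x : n.-tuple R := [tuple a * tnth x i | i < n].

(** Reflection in the hyperplane orthogonal to [v]. For [v] = 0 the quotient is a division by zero,
    hence 0, and the map is the identity: the lemmas below hold for every [v]. *)
Definition refl v x : n.-tuple R := tsub x (tscale (2 * dotp x v / dotp v v) v).

Lemma dotpC x y : dotp x y = dotp y x.
Proof. by apply: eq_bigr => i _; rewrite mulrC. Qed.

Lemma dotpBl x y v : dotp (tsub x y) v = dotp x v - dotp y v.
Proof.
rewrite /dotp -sumrB; apply: eq_bigr => i _.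
by rewrite tnth_mktuple mulrBl.
Qed.

Lemma dotpZl a x y : dotp (tscale a x) y = a * dotp x y.
Proof.
by rewrite /dotp mulr_sumr; apply: eq_bigr => i _; rewrite tnth_mktuple mulrA.
Qed.

Lemma dotpBr x y v : dotp v (tsub x y) = dotp v x - dotp v y.
Proof. by rewrite dotpC dotpBl !(dotpC v). Qed.

Lemma dotpZr a x y : dotp x (tscale a y) = a * dotp x y.
Proof. by rewrite dotpC dotpZl dotpC. Qed.

Lemma dotp_ge0 x : 0 <= dotp x x.
Proof. by apply: sumr_ge0 => i _; rewrite -expr2 sqr_ge0. Qed.

Lemma dotp_eq0 x : dotp x x = 0 -> forall i, tnth x i = 0.
Proof.
move=> /psumr_eq0P H i; apply/eqP; rewrite -sqrf_eq0 expr2; apply/eqP.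
by apply: H => // j _; rewrite -expr2 sqr_ge0.
Qed.

Lemma enormE x : enorm x = Num.sqrt (dotp x x).
Proof. by congr Num.sqrt; apply: eq_bigr => i _; rewrite expr2. Qed.

Lemma enorm_sqr x : enorm x ^+ 2 = dotp x x.
Proof. by rewrite enormE sqr_sqrtr// dotp_ge0. Qed.

Lemma enorm_ge0 x : 0 <= enorm x.
Proof. exact: sqrtr_ge0. Qed.

Lemma enorm_eq0 x : (enorm x == 0) = [forall i, tnth x i == 0].
Proof.
apply/idP/forallP => [/eqP e i|H].
  by apply/eqP; apply: dotp_eq0; rewrite -enorm_sqr e expr0n.
rewrite enormE /dotp big1 ?sqrtr0// => i _.
by rewrite (eqP (H i)) mul0r.
Qed.

Lemma edistE x y : edist x y = enorm (tsub x y).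
Proof. by congr Num.sqrt; apply: eq_bigr => i _; rewrite tnth_mktuple. Qed.

Lemma refl_dotp v x y : dotp (refl v x) (refl v y) = dotp x y.
Proof.
have [v0|v0] := eqVneq (dotp v v) 0.
  rewrite /refl !dotpBl !dotpBr !dotpZl !dotpZr v0 invr0 !mulr0 !mul0r.
  by rewrite !subr0.
rewrite /refl !dotpBl !dotpBr !dotpZl !dotpZr (dotpC v y).
by field.
Qed.

Lemma reflK v : involutive (refl v).
Proof.
move=> x; apply: eq_from_tnth => i; rewrite !tnth_mktuple.
have [v0|v0] := eqVneq (dotp v v) 0.
  by rewrite v0 invr0 !mulr0 !mul0r !subr0.
by rewrite dotpBl dotpZl; field.
Qed.

Lemma reflB v x y : refl v (tsub x y) = tsub (refl v x) (refl v y).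
Proof.
apply: eq_from_tnth => i; rewrite !tnth_mktuple dotpBl.
by rewrite mulrBr mulrBl mulrBl; ring.
Qed.

Lemma refl_enorm v x : enorm (refl v x) = enorm x.
Proof. by rewrite !enormE refl_dotp. Qed.

Lemma reflZ v a x : refl v (tscale a x) = tscale a (refl v x).
Proof.
apply: eq_from_tnth => i; rewrite !tnth_mktuple dotpZl; ring.
Qed.

(** For vectors of equal length, 2 <x, x - y> = |x - y|^2, so x - y is normal to the bisecting
    hyperplane. Thus single reflections already act transitively on the sphere. *)
Lemma refl_swap x y : dotp x x = dotp y y -> refl (tsub x y) x = y.
Proof.
move=> xy; apply: eq_from_tnth => i; rewrite !tnth_mktuple.
have [v0|v0] := eqVneq (dotp (tsub x y) (tsub x y)) 0.
  have := dotp_eq0 v0 i; rewrite tnth_mktuple => /eqP.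
  by rewrite subr_eq0 => /eqP ->; rewrite subrr mulr0 subr0.
suff -> : 2 * dotp x (tsub x y) = dotp (tsub x y) (tsub x y).
  by rewrite divff// mul1r opprB addrC subrK.
by rewrite !dotpBr !dotpBl -xy (dotpC y x); ring.
Qed.

Lemma refl_fix v x : dotp x v = 0 -> refl v x = x.
Proof.
move=> xv; apply: eq_from_tnth => i.
by rewrite !tnth_mktuple xv mulr0 mul0r mul0r subr0.
Qed.

Lemma measurable_dotpl v : measurable_fun setT (dotp ^~ v).
Proof.
apply: measurable_sum => i; apply: measurable_funM => //; exact: measurable_tnth.
Qed.

Lemma measurable_tsub d (T : measurableType d) (f g : T -> n.-tuple R) :
  measurable_fun setT f -> measurable_fun setT g ->
  measurable_fun setT (fun t => tsub (f t) (g t)).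
Proof.
move=> mf mg; apply/measurable_fun_tnthP => i.
rewrite (_ : _ \o _ = (fun t => tnth (f t) i - tnth (g t) i)).
  by apply: measurable_funB;
    [apply: (measurableT_comp (measurable_tnth i) mf)
    |apply: (measurableT_comp (measurable_tnth i) mg)].
by apply/funext => t /=; rewrite tnth_mktuple.
Qed.

Lemma measurable_tscale d (T : measurableType d) (f : T -> R) (g : T -> n.-tuple R) :
  measurable_fun setT f -> measurable_fun setT g ->
  measurable_fun setT (fun t => tscale (f t) (g t)).
Proof.
move=> mf mg; apply/measurable_fun_tnthP => i.
rewrite (_ : _ \o _ = (fun t => f t * tnth (g t) i)).
  by apply: measurable_funM => //;apply: (measurableT_comp (measurable_tnth i) mg).
by apply/funext => t /=; rewrite tnth_mktuple.
Qed.

Lemma measurable_refl v : measurable_fun setT (refl v).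
Proof.
apply: measurable_tsub => //; apply: measurable_tscale => //.
apply: measurable_funM => //; apply: measurable_funM => //.
exact: measurable_dotpl.
Qed.

End Tuples.

(** * Lebesgue measure under translations, homotheties and reflections *)

Section LebesguePower.
Context (R : realType) (n : nat).
Local Notation lam := (lebesgue_power R n).
Local Open Scope ereal_scope.
Implicit Types f g : n.-tuple R -> \bar R.

Lemma ge0_integral_tsub f c : measurable_fun setT f -> (forall x, 0 <= f x) ->
  \int[lam]_x f (tsub x c) = \int[lam]_x f x.
Proof.
move=> mf f0; pose phi i (s : R) : R := (1 * s + - nth 0 c i)%R.
transitivity (\int[lam]_x f (map_coord phi x)).
  apply: eq_integral => x _; congr f; apply: eq_from_tnth => i.
  by rewrite !tnth_mktuple /phi mul1r (tnth_nth 0%R c).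
rewrite (@ge0_integral_map_coord _ _ _ _ _ _ 1)//.
- by rewrite expr1n mul1e.
- by move=> i; exact: measurable_affine.
- move=> i g mg g0; have := @ge0_integral_affine R 1 (- nth 0 c i)%R g ltr01 mg g0.
  by rewrite invr1.
Qed.

Lemma ge0_integral_tsubr f c : measurable_fun setT f -> (forall x, 0 <= f x) ->
  \int[lam]_x f (tsub c x) = \int[lam]_x f x.
Proof.
move=> mf f0; pose phi i (s : R) : R := (nth 0 c i - s)%R.
transitivity (\int[lam]_x f (map_coord phi x)).
  apply: eq_integral => x _; congr f; apply: eq_from_tnth => i.
  by rewrite !tnth_mktuple /phi (tnth_nth 0%R c).
rewrite (@ge0_integral_map_coord _ _ _ _ _ _ 1)//.
- by rewrite expr1n mul1e.
- by move=> i; apply: measurable_funB.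
- move=> i g mg g0; rewrite mul1e.
  pose h x := g (1 * x + nth 0 c i)%R.
  have mh : measurable_fun setT h by exact: measurableT_comp mg (measurable_affine _ _).
  have mN : measurable_fun setT (-%R : R -> R) by exact: measurable_funN.
  transitivity (\int[@lebesgue_on R]_x h (- x)%R).
    by apply: eq_integral => x _; rewrite /h /phi mul1r addrC.
  have := ge0_integral_pushforward mN (@lebesgue_on R) measurableT mh (fun x _ => g0 _).
  rewrite preimage_setT => <-.
  transitivity (\int[@lebesgue_on R]_x h x).
    by apply: eq_measure_integral => A mA _; exact: lebesgue_measureN.
  have := @ge0_integral_affine R 1 (nth 0 c i)%R g ltr01 mg g0.
  by rewrite invr1 mul1e.
Qed.

Lemma ge0_integral_tscale f a : (0 < a)%R ->
  measurable_fun setT f -> (forall x, 0 <= f x) ->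
  \int[lam]_x f (tscale a x) = (a ^- n)%:E * \int[lam]_x f x.
Proof.
move=> a0 mf f0; pose phi (i : nat) (s : R) : R := (a * s + 0)%R.
transitivity (\int[lam]_x f (map_coord phi x)).
  apply: eq_integral => x _; congr f; apply: eq_from_tnth => i.
  by rewrite !tnth_mktuple /phi addr0.
rewrite (@ge0_integral_map_coord _ _ _ _ _ _ a^-1)//.
- by rewrite exprVn.
- by rewrite invr_ge0 ltW.
- by move=> i; exact: measurable_affine.
- by move=> i g mg g0; exact: ge0_integral_affine.
Qed.

(* Uniqueness of Haar measure: evaluating the integral of
   [g (H y) * f (x - H y)] in both orders, with [y := H x - y'] in between,
   shows that [f |-> \int f \o H] is proportional to the Lebesgue integral. *)
Lemma haar_exchange (H : n.-tuple R -> n.-tuple R) f g :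
  measurable_fun setT H -> involutive H ->
  (forall x y, H (tsub x y) = tsub (H x) (H y)) ->
  measurable_fun setT f -> (forall x, 0 <= f x) ->
  measurable_fun setT g -> (forall x, 0 <= g x) ->
  (\int[lam]_x f x) * (\int[lam]_x g (H x)) =
  (\int[lam]_x f (H x)) * (\int[lam]_x g x).
Proof.
move=> mH HK HB mf f0 mg g0.
have mfH : measurable_fun setT (fun x => f (H x)) by exact: measurableT_comp mf mH.
have mgH : measurable_fun setT (fun x => g (H x)) by exact: measurableT_comp mg mH.
pose F (p : n.-tuple R * n.-tuple R) := g (H p.2) * f (tsub p.1 (H p.2)).
have mF : measurable_fun setT F.
  apply: emeasurable_funM; first exact: measurableT_comp mgH measurable_snd.
  apply: measurableT_comp mf _; apply: measurable_tsub => //.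
  exact: measurableT_comp mH measurable_snd.
have F0 p : 0 <= F p by rewrite /F mule_ge0.
have If0 : 0 <= \int[lam]_x f x by exact: integral_ge0.
have Ig0 : 0 <= \int[lam]_x g x by exact: integral_ge0.
transitivity (\int[lam]_y \int[lam]_x F (x, y)).
  rewrite -(ge0_integralZl lam measurableT mgH (fun x _ => g0 (H x)) If0).
  apply: eq_integral => y _; rewrite /F/= muleC.
  rewrite -(ge0_integral_tsub (H y) mf f0).
  rewrite ge0_integralZl//.
  by apply: measurableT_comp mf _; exact: measurable_tsub.
have := fubini_tonelli F mF F0; rewrite /fubini_F /fubini_G => <-.
have mfg y : measurable_fun setT (fun x => f (H y) * g (tsub x (H y))).
  apply: emeasurable_funM => //; apply: measurableT_comp mg _.
  exact: measurable_tsub.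
pose G (p : n.-tuple R * n.-tuple R) := f (H p.2) * g (tsub p.1 (H p.2)).
have mG : measurable_fun setT G.
  apply: emeasurable_funM; first exact: measurableT_comp mfH measurable_snd.
  apply: measurableT_comp mg _; apply: measurable_tsub => //.
  exact: measurableT_comp mH measurable_snd.
have G0 p : 0 <= G p by rewrite /G mule_ge0.
transitivity (\int[lam]_x \int[lam]_y G (x, y)).
  apply: eq_integral => x _.
  have mFx : measurable_fun setT (fun y => F (x, y)).
    by apply: measurableT_comp mF _; exact: measurable_fun_pair.
  rewrite -(ge0_integral_tsubr (H x) mFx)//; apply: eq_integral => y _.
  rewrite /F /G/= HB HK muleC; congr (f _ * g _).
  by apply: eq_from_tnth => i; rewrite !tnth_mktuple; ring.
have := fubini_tonelli G mG G0; rewrite /fubini_F /fubini_G => ->.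
rewrite -(ge0_integralZr lam measurableT mfH (fun x _ => f0 (H x)) Ig0).
apply: eq_integral => y _; rewrite /G/=.
rewrite -(ge0_integral_tsub (H y) mg g0) ge0_integralZl//.
by apply: measurableT_comp mg _; exact: measurable_tsub.
Qed.

Lemma unit_ball_sub_box : @unit_ball R n `<=` @box _ R n `[(-1)%R, 1%R]%classic.
Proof.
move=> x /=; rewrite /unit_ball /= => x1 i; rewrite /= in_itv/= -ler_norml.
rewrite -(ler_pXn2r (ltn0Sn 1))// ?nnegrE// expr1n -normrX ger0_norm ?sqr_ge0//.
apply: le_trans (_ : (enorm x ^+ 2 <= 1)%R); last by rewrite expr_le1// enorm_ge0.
rewrite enorm_sqr /dotp (bigD1 i)//= -expr2 lerDl.
by apply: sumr_ge0 => j _; rewrite -expr2 sqr_ge0.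
Qed.

(** The side is 1 / (n + 1) rather than 1 / n so that it makes sense for [n] = 0. The inclusion
    makes the volume of the ball positive. *)
Lemma box_sub_unit_ball : @box _ R n `[0%R, n.+1%:R^-1%R]%classic `<=` @unit_ball R n.
Proof.
move=> x /= xb; rewrite /unit_ball/= -(expr_le1 (ltn0Sn 1)) ?enorm_ge0//.
rewrite enorm_sqr /dotp.
have n0 : (0 < n.+1%:R :> R)%R by rewrite ltr0n.
apply: le_trans (_ : (\sum_(i < n) n.+1%:R^-1 * 1 <= 1)%R).
  apply: ler_sum => i _; have := xb i; rewrite /= in_itv/= => /andP[x0 x1].
  apply: ler_pM => //; apply: le_trans x1 _.
  by rewrite invf_le1// ler1n.
rewrite sumr_const card_ord mulr1 -(mulr_natl n.+1%:R^-1%R) ler_pdivrMr// mul1r.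
by rewrite ler_nat.
Qed.

Lemma lebesgue_power_box (a b : R) : (a <= b)%R ->
  lam (box `[a, b]%classic) = ((b - a) ^+ n)%:E.
Proof.
move=> ab; transitivity (lebesgue_on `[a, b]%classic ^+ n).
  exact: (power_measure_box (@lebesgue_on R)).
rewrite /lebesgue_on lebesgue_measure_itv/= lte_fin.
have [altb|bla] := ltP a b; first by rewrite -EFinB EFin_expe.
have -> : a = b by apply/eqP; rewrite eq_le ab.
by rewrite subrr EFin_expe.
Qed.

Lemma unit_ball_lty : lam (@unit_ball R n) < +oo.
Proof.
apply: (@le_lt_trans _ _ (lam (@box _ R n `[(-1)%R, 1%R]%classic))); last first.
  by rewrite lebesgue_power_box ?ltry// lerNl (le_trans _ ler01)// lerN10.
apply: le_measure; rewrite ?inE; [exact: measurable_unit_ball| |exact: unit_ball_sub_box].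
exact: measurable_box.
Qed.

Lemma unit_ball_gt0 : 0 < lam (@unit_ball R n).
Proof.
apply: (@lt_le_trans _ _ (lam (@box _ R n `[0%R, n.+1%:R^-1%R]%classic))).
  by rewrite lebesgue_power_box// subr0 lte_fin exprn_gt0// invr_gt0 ltr0n.
apply: le_measure; rewrite ?inE; [exact: measurable_box|exact: measurable_unit_ball|].
exact: box_sub_unit_ball.
Qed.

(** The indicator of the unit ball is invariant under [refl v] and has a positive finite integral;
    used as test function in [haar_exchange], it forces the proportionality factor to be 1. *)
Lemma ge0_integral_refl v f : measurable_fun setT f -> (forall x, 0 <= f x) ->
  \int[lam]_x f (refl v x) = \int[lam]_x f x.
Proof.
move=> mf f0.
pose b (x : n.-tuple R) : \bar R := (\1_(@unit_ball R n) x)%:E.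
have mb : measurable_fun setT b.
  by apply/measurable_EFinP; apply: measurable_indic; exact: measurable_unit_ball.
have b0 x : 0 <= b x by rewrite lee_fin.
have := haar_exchange (measurable_refl v) (reflK v) (reflB v) mb b0 mf f0.
have -> : \int[lam]_x b (refl v x) = \int[lam]_x b x.
  apply: eq_integral => x _; rewrite /b !indicE.
  suff -> : (refl v x \in @unit_ball R n) = (x \in @unit_ball R n) by [].
  by apply/idP/idP; rewrite !inE /unit_ball/= refl_enorm.
rewrite /b integral_indic// ?setIT; last exact: measurable_unit_ball.
move=> E0.
have E : lam (@unit_ball R n) * (\int[lam]_x f (refl v x)) =
  lam (@unit_ball R n) * (\int[lam]_x f x) by exact: E0.
have := unit_ball_gt0; have := unit_ball_lty.
move: E; case: (lam (unit_ball (n:=n))) => [r| |]//= E _ r0.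
have rn0 : r != 0%R by rewrite gt_eqF// -lte_fin.
have rK (z : \bar R) : r^-1%:E * (r%:E * z) = z by rewrite muleA -EFinM mulVf// mul1e.
by rewrite -[LHS]rK E rK.
Qed.

End LebesguePower.

(** * The surface measure of the sphere *)

Lemma mnormalizeE d (T : measurableType d) (R : realType)
    (m : {measure set T -> \bar R}) (P : probability T R) (A : set T) (V : R) :
  0 < V -> m setT = V%:E -> mnormalize m P A = (V^-1%:E * m A)%E.
Proof.
move=> V0 mV; rewrite /mnormalize mV /= ifF; first by rewrite muleC.
by apply/negbTE; rewrite orbF eqe gt_eqF.
Qed.

Section SphereMeasure.
Context (R : realType) (d : nat).
Local Notation lam := (lebesgue_power R d.+1).
Local Notation S := (sphere R d).
Local Notation mu := (sphere_measure R d).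
Local Notation sval := (@sphere_val R d).

Lemma sphere_enorm (x : S) : enorm (sval x) = 1.
Proof. exact/eqP/(valP x). Qed.

Lemma sphere_dotp (x : S) : dotp (sval x) (sval x) = 1.
Proof. by rewrite -enorm_sqr sphere_enorm expr1n. Qed.

Lemma sphere_val_inj : injective sval.
Proof. exact: val_inj. Qed.

Lemma measurable_sphere_val : measurable_fun setT sval.
Proof. by move=> _ A mA; exists A. Qed.

Lemma measurable_to_sphere d' (T : measurableType d') (f : T -> S) :
  measurable_fun setT (sval \o f) -> measurable_fun setT f.
Proof.
move=> mf _ _ [B mB <-]; rewrite !setTI -comp_preimage -[X in measurable X]setTI.
exact: mf.
Qed.

Definition unit_ball_volume : R := fine (lam (@unit_ball R d.+1)).

Lemma unit_ball_volumeE : lam (@unit_ball R d.+1) = unit_ball_volume%:E.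
Proof.
rewrite fineK// ge0_fin_numE; [exact: unit_ball_lty|exact: measure_ge0].
Qed.

Lemma unit_ball_volume_gt0 : 0 < unit_ball_volume.
Proof. by rewrite -lte_fin -unit_ball_volumeE; exact: unit_ball_gt0. Qed.

Lemma cone_measureT : @cone_measure R d setT = unit_ball_volume%:E.
Proof.
rewrite -unit_ball_volumeE /cone_measure /pushforward preimage_setT.
by rewrite /mrestr/= setTI.
Qed.

Lemma sphere_measureE (A : set S) :
  mu A = (unit_ball_volume^-1%:E * @cone_measure R d A)%E.
Proof.
exact: (mnormalizeE _ _ unit_ball_volume_gt0 cone_measureT).
Qed.

Lemma ge0_integral_sphere (h : S -> \bar R) :
  measurable_fun setT h -> (forall x, 0 <= h x)%E ->
  (\int[mu]_x h x = unit_ball_volume^-1%:E *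
    \int[lam]_(x in @unit_ball R d.+1) h (sphere_proj x))%E.
Proof.
move=> mh h0.
have V0 : 0 <= unit_ball_volume^-1 by rewrite invr_ge0 ltW// unit_ball_volume_gt0.
transitivity (\int[mscale (NngNum V0) (@cone_measure R d)]_x h x)%E.
  by apply: eq_measure_integral => A mA _; exact: sphere_measureE.
rewrite ge0_integral_mscale//; congr (_ * _)%E.
have mhp : measurable_fun setT (h \o @sphere_proj R d).
  exact: measurableT_comp mh (@measurable_sphere_proj R d).
rewrite -(ge0_integral_mrestr _ (@measurable_unit_ball R d.+1) mhp)//; last first.
  by move=> x; exact: h0.
rewrite -(preimage_setT (@sphere_proj R d)).
exact: (ge0_integral_pushforward (@measurable_sphere_proj R d)).
Qed.

Lemma srefl_subproof (v : d.+1.-tuple R) (x : S) : enorm (refl v (sval x)) == 1.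
Proof. by rewrite refl_enorm sphere_enorm. Qed.

Definition srefl (v : d.+1.-tuple R) (x : S) : S :=
  exist (fun y : d.+1.-tuple R => enorm y == 1) _ (srefl_subproof v x).

Lemma sval_srefl v x : sval (srefl v x) = refl v (sval x).
Proof. by []. Qed.

Lemma sreflK v : involutive (srefl v).
Proof. by move=> x; apply: sphere_val_inj; rewrite !sval_srefl reflK. Qed.

Lemma measurable_srefl v : measurable_fun setT (srefl v).
Proof.
apply: measurable_to_sphere.
exact: (measurableT_comp (measurable_refl v) measurable_sphere_val).
Qed.

Lemma sphere_projE (x : d.+1.-tuple R) : enorm x != 0 ->
  sval (sphere_proj x) = tscale (enorm x)^-1 x.
Proof.
move=> x0; rewrite /sphere_val /sphere_proj val_insubd.
have -> : [tuple tnth x i / enorm x | i < d.+1] = tscale (enorm x)^-1 x.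
  by apply: eq_from_tnth => i; rewrite !tnth_mktuple mulrC.
rewrite ifT// enormE dotpZl dotpZr -enorm_sqr mulrA -expr2 -exprMn mulVf//.
by rewrite expr1n sqrtr1.
Qed.

Lemma sphere_proj_refl v x : enorm x != 0 ->
  sphere_proj (refl v x) = srefl v (sphere_proj x).
Proof.
move=> x0; apply: sphere_val_inj.
by rewrite sval_srefl !sphere_projE ?refl_enorm// reflZ.
Qed.

Lemma lebesgue_power_origin : lam [set x | enorm x = 0] = 0%E.
Proof.
rewrite (_ : [set x | _] = @box _ R d.+1 [set 0]); last first.
  apply/seteqP; split => x /=.
    by move=> /eqP; rewrite enorm_eq0 => /forallP H i /=; exact/eqP/H.
  by move=> H; apply/eqP; rewrite enorm_eq0; apply/forallP => i; rewrite (H i).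
transitivity (@lebesgue_on R [set 0%R] ^+ d.+1)%E.
  exact: (power_measure_box (@lebesgue_on R)).
by rewrite /lebesgue_on lebesgue_measure_set1 expeS mul0e.
Qed.

Lemma measurable_origin : measurable [set x : d.+1.-tuple R | enorm x = 0].
Proof.
rewrite (_ : [set x | _] = @enorm R d.+1 @^-1` [set 0])//.
by rewrite -[X in measurable X]setTI; exact: measurable_enorm.
Qed.

(** The projection to the sphere commutes with [refl v] away from the origin, a null set, and both
    Lebesgue measure and the unit ball are invariant. *)
Lemma ge0_integral_srefl v (h : S -> \bar R) :
  measurable_fun setT h -> (forall x, 0 <= h x)%E ->
  (\int[mu]_x h (srefl v x) = \int[mu]_x h x)%E.
Proof.
move=> mh h0; have mhr := measurableT_comp mh (measurable_srefl v).
rewrite (ge0_integral_sphere mhr (fun x => h0 _)) ge0_integral_sphere//.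
congr (_ * _)%E.
have mhp : measurable_fun setT (h \o @sphere_proj R d).
  exact: measurableT_comp mh (@measurable_sphere_proj R d).
have mB := @measurable_unit_ball R d.+1.
pose f x : \bar R := (\1_(@unit_ball R d.+1) x)%:E.
have mf : measurable_fun setT f by apply/measurable_EFinP; exact: measurable_indic.
pose F x := (f x * h (sphere_proj x))%E.
have mF : measurable_fun setT F by exact: emeasurable_funM.
have F0 x : (0 <= F x)%E by rewrite mule_ge0// lee_fin.
have E (g : d.+1.-tuple R -> \bar R) :
    (\int[lam]_(x in @unit_ball R d.+1) g x = \int[lam]_x (f x * g x))%E.
  rewrite integral_mkcond; apply: eq_integral => x _.
  rewrite patchE /f indicE; case: (x \in _); first by rewrite mul1e.
  by rewrite mul0e.
rewrite !E -[RHS](ge0_integral_refl v mF F0).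
apply: ge0_ae_eq_integral => //.
- apply: emeasurable_funM => //.
  exact: measurableT_comp mhr (@measurable_sphere_proj R d).
- exact: measurableT_comp mF (measurable_refl v).
- by move=> x _; apply: mule_ge0; [rewrite lee_fin|exact: h0].
- exists [set x | enorm x = 0]; split; first exact: measurable_origin.
    exact: lebesgue_power_origin.
  move=> x /= H; apply: contrapT => x0; apply: H => _.
  rewrite /F sphere_proj_refl; last exact/eqP.
  congr (_ * _)%E; rewrite /f !indicE; congr (_ %:R)%:E.
  suff -> : (refl v x \in @unit_ball R d.+1) = (x \in @unit_ball R d.+1) by [].
  by apply/idP/idP; rewrite !inE /unit_ball/= refl_enorm.
Qed.

End SphereMeasure.

(* [lebesgue_on R] and [lebesgue_measure] are defined on types with different
   measurability structures, so their integrals are not convertible. *)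
Lemma ge0_lebesgue_onE (R : realType) (D : set R) (f : R -> \bar R) :
  measurable D -> measurable_fun D f -> (forall x, D x -> 0 <= f x)%E ->
  (\int[@lebesgue_on R]_(x in D) f x =
   \int[@lebesgue_measure R]_(x in D) f x)%E.
Proof.
move=> mD mf f0; pose phi : measurableTypeR R -> R := id.
have mphi : measurable_fun setT phi by move=> _ A mA; rewrite setTI.
have := ge0_integral_pushforward mphi (@lebesgue_measure R) mD mf.
move=> <-; last by move=> x /set_mem; exact: f0.
by apply: eq_measure_integral => A mA _.
Qed.

(** * The Gamma function and the surface area of the sphere *)

Section GammaJ.
Context (R : realType).
Implicit Types (s a x t : R) (n k : nat).
Local Notation leb := (@lebesgue_on R).

Definition gamma_fun s x : R := if 0 < x then x `^ (s - 1) * expR (- x) else 0.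

(** Kept in [\bar R] because Tonelli is applied before convergence is known; finiteness at
    half-integers comes from [egamma_half]. *)
Definition egamma s : \bar R := (\int[leb]_x (gamma_fun s x)%:E)%E.

(* The substitution s = t / sqrt(1 + t^2) of ]-1, 1[, with
   rho t = sqrt(1 - s^2), plays the role of the polar angle: up to a constant,
   rho t ^ (d + 1) is the density in t of the law of a coordinate s on S^d. *)
Definition rho t : R := (Num.sqrt (1 + t ^+ 2))^-1.

Definition ejac k : \bar R := (\int[leb]_t (rho t ^+ k.+1)%:E)%E.

Lemma gamma_fun_ge0 s x : 0 <= gamma_fun s x.
Proof.
by rewrite /gamma_fun; case: ifP => // _; rewrite mulr_ge0 ?powR_ge0 ?expR_ge0.
Qed.

Lemma measurable_gamma_fun s : measurable_fun setT (gamma_fun s).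
Proof.
apply: measurable_fun_ifT => //.
  by apply: measurable_fun_ltr => //; exact: measurable_cst.
apply: measurable_funM; first exact: measurable_powR.
by apply: measurableT_comp => //; exact: measurable_funN.
Qed.

Lemma sqr1_gt0 t : 0 < 1 + t ^+ 2.
Proof. by rewrite ltr_wpDr// sqr_ge0. Qed.

Lemma rho_gt0 t : 0 < rho t.
Proof. by rewrite /rho invr_gt0 sqrtr_gt0 sqr1_gt0. Qed.

Lemma rho_sqr t : rho t ^+ 2 = (1 + t ^+ 2)^-1.
Proof. by rewrite /rho exprVn sqr_sqrtr// ltW// sqr1_gt0. Qed.

Lemma rho_le1 t : rho t <= 1.
Proof.
rewrite -(expr_le1 (ltn0Sn 1)) ?(ltW (rho_gt0 _))// rho_sqr.
by rewrite invf_le1 ?sqr1_gt0// lerDl sqr_ge0.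
Qed.

Lemma continuous_rho : continuous rho.
Proof.
move=> t; apply: cvgV.
  by rewrite gt_eqF// sqrtr_gt0 sqr1_gt0.
apply: continuous_comp; last exact: sqrt_continuous.
by apply: cvgD; [exact: cvg_cst|exact: exprn_continuous].
Qed.

Lemma measurable_rhoX k : measurable_fun setT (fun t => rho t ^+ k).
Proof.
by apply: measurable_funX; apply: continuous_measurable_fun; exact: continuous_rho.
Qed.

Lemma rhoX_powR t k : rho t ^+ k = (1 + t ^+ 2) `^ (- (k%:R / 2)).
Proof.
rewrite /rho powRN exprVn; have := ltW (sqr1_gt0 t).
move: (1 + t ^+ 2) => b b0; congr (_^-1).
rewrite -{2}(sqr_sqrtr b0) -!powR_mulrn ?sqrtr_ge0// -powRrM.
by rewrite mulrCA divff// mulr1.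
Qed.

Lemma integral_gauss_scale a : 0 < a ->
  (\int[leb]_t (expR (- (a * t ^+ 2)))%:E =
   (a `^ (- 2^-1) * Num.sqrt pi)%:E)%E.
Proof.
move=> a0; pose g (x : R) := (gauss_fun x)%:E.
have mg : measurable_fun setT g by apply/measurable_EFinP; exact: measurable_gauss_fun.
have g0 x : (0 <= g x)%E by rewrite lee_fin gauss_fun_ge0.
have sa0 : 0 < Num.sqrt a by rewrite sqrtr_gt0.
transitivity (\int[leb]_t g (Num.sqrt a * t + 0)%R)%E.
  apply: eq_integral => t _; rewrite /g /gauss_fun addr0 exprMn.
  by rewrite sqr_sqrtr// ltW.
rewrite ge0_integral_affine// [X in (_ * X)%E](_ : _ = (Num.sqrt pi)%:E).
  by rewrite -EFinM powRN powR12_sqrt// ltW.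
by rewrite ge0_lebesgue_onE//; exact: integralT_gauss.
Qed.

Lemma egamma_scale s a : 0 < a ->
  (\int[leb]_x ((if 0 < x then x `^ (s - 1) * expR (- (a * x)) else 0)%:E) =
   (a `^ (- s))%:E * egamma s)%E.
Proof.
move=> a0; pose g x := (gamma_fun s x)%:E.
have mg : measurable_fun setT g by apply/measurable_EFinP; exact: measurable_gamma_fun.
have g0 x : (0 <= g x)%E by rewrite lee_fin gamma_fun_ge0.
transitivity (\int[leb]_x ((a `^ (1 - s))%:E * g (a * x + 0)%R))%E.
  apply: eq_integral => x _; rewrite /g /gamma_fun addr0 pmulr_rgt0// -EFinM.
  case: ifPn => x0; last by rewrite mulr0.
  rewrite powRM ?(ltW a0) ?(ltW x0)// !mulrA -powRD; last first.
    by rewrite (gt_eqF a0) implybT.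
  by rewrite (_ : 1 - s + (s - 1) = 0) ?powRr0 ?mul1r//; ring.
have mga : measurable_fun setT (fun x => g (a * x + 0)).
  by apply: measurableT_comp mg _; exact: measurable_affine.
rewrite (ge0_integralZl_EFin leb measurableT (fun x _ => g0 _) mga (powR_ge0 a (1 - s))).
rewrite ge0_integral_affine// muleA -EFinM; congr (_%:E * _)%E.
rewrite -powR_inv1 ?(ltW a0)// -powRD; last by rewrite (gt_eqF a0) implybT.
by congr powR; ring.
Qed.

(** Tonelli for x^((k - 1) / 2) exp (- (1 + t^2) x), x > 0. Integrating over x first gives [rho t] ^
    (k + 1) Gamma ((k + 1) / 2); integrating over t first gives a Gaussian integral sqrt(pi)
    x^(-1/2), which lowers the exponent to k / 2 - 1. *)
Lemma ejac_egamma k :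
  (ejac k * egamma (k.+1%:R / 2) = (Num.sqrt pi)%:E * egamma (k%:R / 2))%E.
Proof.
set s := k.+1%:R / 2.
have sk : s - 1 - 2^-1 = k%:R / 2 - 1 by rewrite /s -natr1; field.
pose F (p : R * R) : \bar R :=
  ((if 0 < p.2 then p.2 `^ (s - 1) * expR (- ((1 + p.1 ^+ 2) * p.2)) else 0)%:E)%E.
have F0 p : (0 <= F p)%E.
  by rewrite lee_fin; case: ifP => // _; rewrite mulr_ge0 ?powR_ge0 ?expR_ge0.
have mF : measurable_fun setT F.
  apply/measurable_EFinP; apply: measurable_fun_ifT => //.
    apply: measurable_fun_ltr => //.
  apply: measurable_funM.
    exact: (measurableT_comp (measurable_powR _) measurable_snd).
  apply: measurableT_comp => //; apply: measurable_funN.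
  apply: measurable_funM => //; apply: measurable_funD => //.
  exact: measurable_funX.
have eg0 : (0 <= egamma s)%E.
  by apply: integral_ge0 => x _; rewrite lee_fin gamma_fun_ge0.
have := @fubini_tonelli _ _ _ _ _ leb leb F mF F0.
rewrite /fubini_F /fubini_G => E.
transitivity (\int[leb]_x \int[leb]_y F (x, y))%E.
  have r0 t : setT t -> (0 <= (rho t ^+ k.+1)%:E)%E.
    by move=> _; rewrite lee_fin; apply: exprn_ge0; exact/ltW/rho_gt0.
  have mr : measurable_fun setT (fun t => (rho t ^+ k.+1)%:E).
    by apply/measurable_EFinP; exact: measurable_rhoX.
  rewrite /ejac -(ge0_integralZr leb measurableT mr r0 eg0).
  apply: eq_integral => t _; rewrite rhoX_powR.
  exact/esym/(egamma_scale s (sqr1_gt0 t)).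
have g0 x : setT x -> (0 <= (gamma_fun (k%:R / 2) x)%:E)%E.
  by move=> _; rewrite lee_fin gamma_fun_ge0.
have mg : measurable_fun setT (fun x => (gamma_fun (k%:R / 2) x)%:E).
  by apply/measurable_EFinP; exact: measurable_gamma_fun.
rewrite E /egamma -(ge0_integralZl_EFin leb measurableT g0 mg (sqrtr_ge0 pi)).
apply: eq_integral => x _; rewrite /F/= /gamma_fun.
case: ifPn => x0; last by rewrite integral0 mule0.
transitivity (\int[leb]_t ((x `^ (s - 1) * expR (- x))%:E * (expR (- (x * t ^+ 2)))%:E))%E.
  apply: eq_integral => t _; rewrite -EFinM -mulrA -expRD; congr (_ * expR _)%:E.
  by ring.
have e0 t : setT t -> (0 <= (expR (- (x * t ^+ 2)))%:E)%E.
  by move=> _; rewrite lee_fin expR_ge0.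
have me : measurable_fun setT (fun t => (expR (- (x * t ^+ 2)))%:E).
  have m1 : measurable_fun setT (fun t : R => - (x * t ^+ 2)).
    by apply: measurable_funN; apply: measurable_funM => //; exact: measurable_funX.
  by apply/measurable_EFinP; exact: (measurableT_comp (@measurable_expR R) m1).
have c0 : 0 <= x `^ (s - 1) * expR (- x) by rewrite mulr_ge0 ?powR_ge0 ?expR_ge0.
rewrite (ge0_integralZl_EFin leb measurableT e0 me c0).
rewrite (integral_gauss_scale x0) -2!EFinM; congr EFin.
rewrite -sk (@powRD _ x (s - 1) (- 2^-1)); last by rewrite (gt_eqF x0) implybT.
move: (x `^ (s - 1)) (x `^ (- 2^-1)) (expR _) (Num.sqrt _) => A B C D.
ring.
Qed.

End GammaJ.

Section GammaValues.
Context (R : realType).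
Implicit Types (s a x t : R) (n k : nat).
Local Notation leb := (@lebesgue_on R).

Lemma egammaE s :
  (egamma s = \int[@lebesgue_measure R]_(x in `]0%R, +oo[)
    (x `^ (s - 1) * expR (- x))%:E)%E.
Proof.
rewrite /egamma ge0_lebesgue_onE//; last 2 first.
- by apply/measurable_EFinP; exact: measurable_gamma_fun.
- by move=> x _; rewrite lee_fin gamma_fun_ge0.
rewrite [RHS]integral_mkcond; apply: eq_integral => x _.
rewrite patchE /gamma_fun mem_setE in_itv/= andbT.
by case: ifP.
Qed.

Lemma GammaE s : Gamma s = fine (egamma s).
Proof. by rewrite /Gamma /Rintegral egammaE. Qed.

(** The bound exp x >= x^(n + 1) / (n + 1)! leaves a spare factor 1 / x. *)
Lemma cvg_expRN_exprn n : (x ^+ n * expR (- x)) @[x --> +oo%R] --> (0 : R).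
Proof.
apply: (@squeeze_cvgr _ _ _ _ (fun=> 0) (fun x => n.+1`!%:R / x)); last 2 first.
- exact: cvg_cst.
- rewrite -[X in _ --> X](mulr0 n.+1`!%:R); apply: cvgMr.
  apply/(@gtr0_cvgV0 _ _ _ _ id); last exact: cvg_id.
  exact: nbhs_pinfty_gt.
near=> x; have x0 : 0 < x by near: x; exact: nbhs_pinfty_gt.
rewrite mulr_ge0 ?expR_ge0 ?exprn_ge0 ?(ltW x0)//= ler_pdivlMr//.
rewrite mulrAC -exprSr expRN ler_pdivrMr ?expR_gt0// -ler_pdivrMl ?ltr0n ?fact_gt0//.
apply: le_trans (expR_ge1Dxn n (ltW x0)).
by rewrite mulrC lerDr.
Unshelve. all: by end_near.
Qed.

(* [x |-> - exp (-x) * sum_k (n! / k!) x^k] is a primitive of [x^n exp (-x)]. *)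
Fixpoint expR_tail n : {poly R} :=
  if n is m.+1 then 'X^(m.+1) + m.+1%:R *: expR_tail m else 1.

Lemma expR_tail_deriv n : expR_tail n = 'X^n + (expR_tail n)^`().
Proof.
elim: n => [|n IH]; first by rewrite /= -(polyC1 R) derivC addr0 expr0.
rewrite [expR_tail n.+1]/= derivD derivZ derivXn [in LHS]IH scalerDr /=.
by rewrite scaler_nat.
Qed.

Lemma expR_tail0 n : (expR_tail n).[0] = n`!%:R.
Proof.
elim: n => [|n IH]; first by rewrite /= hornerC.
by rewrite /= hornerD hornerXn expr0n hornerZ IH add0r -natrM factS.
Qed.

Lemma cvg_expR_tail n : ((expR_tail n).[x] * expR (- x)) @[x --> +oo%R] --> (0 : R).
Proof.
elim: n => [|n IH].
  under eq_fun do rewrite /= hornerC mul1r.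
  exact: cvgr_expR.
under eq_fun do rewrite /= hornerD hornerXn hornerZ mulrDl -mulrA.
have h2 : n.+1%:R * ((expR_tail n).[x] * expR (- x)) @[x --> +oo%R] --> (n.+1%:R * 0 : R).
  exact: cvgMr.
have := cvgD (cvg_expRN_exprn n.+1) h2.
by rewrite mulr0 addr0; apply.
Qed.

Lemma egamma_fact n : egamma (n.+1%:R : R) = n`!%:R%:E.
Proof.
rewrite egammaE.
transitivity (\int[@lebesgue_measure R]_(x in `[0%R, +oo[) (x ^+ n * expR (- x))%:E)%E.
  rewrite -integral_itv_obnd_cbnd; last first.
    apply/measurable_EFinP; apply: measurable_funTS; apply: measurable_funM.
      exact: measurable_funX.
    by apply: measurableT_comp => //; exact: measurable_funN.
  apply: eq_integral => x; rewrite inE/= in_itv/= andbT => x0.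
  by rewrite -natr1 addrK powR_mulrn// ltW.
pose F x : R := - ((expR_tail n).[x] * expR (- x)).
have dF x : is_derive x 1 F (x ^+ n * expR (- x)).
  have dE : is_derive x 1 (fun y : R => expR (- y)) (expR (- x) * -1).
    exact: is_derive1_comp.
  have dM := is_deriveN (is_deriveM (is_derive_poly (expR_tail n) x) dE).
  apply: is_derive_eq dM _.
  have := congr1 (fun p : {poly R} => p.[x]) (expR_tail_deriv n).
  rewrite hornerD hornerXn => E.
  by rewrite /GRing.scale/= {1}E; ring.
rewrite (@ge0_continuous_FTC2y _ _ F 0 0).
- by rewrite /F oppr0 expR0 mulr1 expR_tail0 -EFinB sub0r opprK.
- by move=> x x0; rewrite mulr_ge0 ?exprn_ge0 ?expR_ge0.
- apply: continuous_subspaceT => x; apply: cvgM; first exact: exprn_continuous.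
  by apply: continuous_comp; [exact: opp_continuous|exact: continuous_expR].
- by rewrite -oppr0; apply: cvgN; exact: cvg_expR_tail.
- by move=> x _; have [] := dF x.
- apply: cvg_at_right_filter.
  have := @derivable1_diffP _ _ F 0; case => /(_ _) H _.
  by apply: differentiable_continuous; apply/derivable1_diffP; have [] := dF 0.
- by move=> x _; rewrite derive1E; have [_ ->] := dF x.
Qed.

Lemma ejac1 : ejac R 1 = (pi : R)%:E.
Proof.
have m1 : measurable_fun setT (fun t : R => (rho t ^+ 2)%:E).
  by apply/measurable_EFinP; exact: measurable_rhoX.
have r0 t : 0 <= rho t ^+ 2 by apply: exprn_ge0; exact/ltW/rho_gt0.
rewrite /ejac ge0_lebesgue_onE//; last by move=> t _; rewrite lee_fin.
have cr : continuous (fun t : R => rho t ^+ 2).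
  move=> t; apply: (@continuous_comp _ _ _ (@rho R) (fun x => x ^+ 2)).
    exact: continuous_rho.
  exact: exprn_continuous.
rewrite ge0_symfun_integralT//; last by move=> t /=; rewrite /rho sqrrN.
rewrite (_ : [set x | _] = `[0, +oo[%classic); last first.
  by apply/seteqP; split => x/=; rewrite in_itv/= andbT.
rewrite (@ge0_continuous_FTC2y _ _ (@atan R) 0 (pi / 2)).
- by rewrite atan0 sube0 -EFinM mulrC divfK.
- by move=> x _.
- exact: continuous_subspaceT.
- exact: cvgy_atan.
- by move=> x _; exact: ex_derive.
- by apply: cvg_at_right_filter; exact: continuous_atan.
- by move=> x _; rewrite derive1_atan rho_sqr.
Qed.

Lemma egamma_ge0 s : (0 <= egamma s)%E.
Proof. by apply: integral_ge0 => x _; rewrite lee_fin gamma_fun_ge0. Qed.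

Lemma ejac_ge0 k : (0 <= ejac R k)%E.
Proof.
apply: integral_ge0 => x _; rewrite lee_fin; apply: exprn_ge0.
exact/ltW/rho_gt0.
Qed.

Lemma ejac_lty k : (0 < k)%N -> (ejac R k < +oo)%E.
Proof.
move=> k0; apply: (@le_lt_trans _ _ (ejac R 1)); last by rewrite ejac1 ltry.
apply: ge0_le_integral => //.
- by move=> t _; rewrite lee_fin; apply: exprn_ge0; exact/ltW/rho_gt0.
- by apply/measurable_EFinP; exact: measurable_rhoX.
- by apply/measurable_EFinP; exact: measurable_rhoX.
- move=> t _; rewrite lee_fin; apply: ler_wiXn2l => //.
  + exact/ltW/rho_gt0.
  + exact: rho_le1.
Qed.

Lemma sqrt_pi_gt0 : 0 < Num.sqrt (pi : R).
Proof. by rewrite sqrtr_gt0 pi_gt0. Qed.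

(** Induction through [ejac_egamma]: in a product with the finite number [ejac k], neither 0 nor +oo
    can give a positive finite value. It starts from Gamma(1) = 1 and [ejac R 1] = pi, which yield
    Gamma(1/2). *)
Lemma egamma_half k : (0 < k)%N -> (0 < egamma (k%:R / 2 : R) < +oo)%E.
Proof.
have sp := sqrt_pi_gt0.
have e1 : egamma (2%:R / 2 : R) = 1%E by rewrite divff// (egamma_fact 0).
elim: k => // -[_ _|k IH _].
  have := ejac_egamma R 1; rewrite e1 mule1 ejac1.
  move: (egamma_ge0 (1%:R / 2 : R)).
  case: (egamma _) => [r| |]//= _.
    rewrite -EFinM => -[E]; rewrite ltry andbT lte_fin.
    by rewrite -(pmulr_rgt0 _ sp) -E pi_gt0.
  by rewrite gt0_muley.
have /andP[g0 gy] := IH isT.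
have := ejac_egamma R k.+1.
move: (egamma_ge0 (k.+2%:R / 2)) (ejac_lty (ltn0Sn k)) (ejac_ge0 k.+1).
move: g0 gy; case: (egamma (k.+1%:R / 2)) => [g| |]//.
case: (ejac R k.+1) => [j| |]//; rewrite lte_fin => g0 _.
case: (egamma _) => [r| |]// r0 _ j0 /=.
  rewrite lee_fin in r0.
  rewrite -!EFinM => -[E]; rewrite ltry andbT lte_fin.
  rewrite lt_neqAle r0 andbT eq_sym; apply/negP => /eqP r1.
  move: E; rewrite r1 mulr0 => /esym/eqP.
  by rewrite mulf_eq0 !gt_eqF.
have [->|jn0] := eqVneq j 0.
  by rewrite mul0e -EFinM => -[/esym/eqP]; rewrite mulf_eq0 !gt_eqF.
by rewrite gt0_muley// lte_fin lt_neqAle eq_sym jn0.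
Qed.

Lemma egammaK k : (0 < k)%N -> egamma (k%:R / 2 : R) = (Gamma (k%:R / 2 : R))%:E.
Proof.
move=> /egamma_half/andP[g0 gy]; rewrite GammaE fineK// ge0_fin_numE//.
exact: ltW.
Qed.

Lemma Gamma_half_gt0 k : (0 < k)%N -> 0 < Gamma (k%:R / 2 : R).
Proof.
by move=> k0; have /andP[+ _] := egamma_half k0; rewrite egammaK.
Qed.

Lemma Gamma_fact n : Gamma (n.+1%:R : R) = n`!%:R.
Proof. by rewrite GammaE egamma_fact. Qed.

Lemma omega_gt0 k : 0 < omega R k.
Proof.
by rewrite divr_gt0 ?Gamma_half_gt0// mulr_gt0// powR_gt0// pi_gt0.
Qed.

(** The total mass of the density [rho t] ^ (k + 1), hence the inverse of the normalising constant
    of the law of a coordinate on S^k. *)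
Lemma ejac_omega k : (0 < k)%N -> ejac R k = (omega R k / omega R k.-1)%:E.
Proof.
case: k => // k _; have := ejac_egamma R k.+1.
rewrite !egammaK//.
have G1 := Gamma_half_gt0 (ltn0Sn k); have G2 := Gamma_half_gt0 (ltn0Sn k.+1).
move: (ejac_ge0 k.+1); case: (ejac R k.+1) => [j| |]// j0; last first.
  by rewrite gt0_mulye.
rewrite -!EFinM => -[E]; congr EFin; rewrite /omega [k.+1.-1]/=.
have p0 : 0 < pi :> R := pi_gt0 R.
have -> : pi `^ (k.+2%:R / 2) = pi `^ (k.+1%:R / 2) * Num.sqrt (pi : R).
  rewrite -(powR12_sqrt (ltW p0)) -powRD; last by rewrite (gt_eqF p0) implybT.
  by congr powR; rewrite -[in LHS]natr1; field.
have q0 : 0 < pi `^ (k.+1%:R / 2) :> R by rewrite powR_gt0.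
move: E G1 G2 q0; move: (Gamma _) (Gamma _) (_ `^ _) => G2 G1 q E G10 G20 q0.
have -> : j = Num.sqrt pi * G2 / G1 by rewrite -E mulfK// gt_eqF.
by field; rewrite !gt_eqF.
Qed.

End GammaValues.

(** * The law of a coordinate, and spherical caps *)

Lemma measurable_natb d (T : measurableType d) (R : realType) (b : T -> bool) :
  measurable_fun setT b -> measurable_fun setT (fun x => (b x)%:R : R).
Proof.
move=> mb; rewrite (_ : (fun x => _) = (fun x => if b x then 1 else 0)).
  exact: measurable_fun_ifT.
by apply/funext => x; case: (b x).
Qed.

Section FirstCoordinate.
Context (R : realType) (d : nat).
Hypothesis d0 : (0 < d)%N.
Local Notation lam := (lebesgue_power R d).
Local Notation lam1 := (lebesgue_power R d.+1).
Local Notation leb := (@lebesgue_on R).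
Local Notation S := (sphere R d).
Local Notation mu := (sphere_measure R d).
Local Notation sval := (@sphere_val R d).

Lemma enorm_cons (s : R) (w : d.-tuple R) :
  enorm (cons_pair (s, w)) = Num.sqrt (s ^+ 2 + enorm w ^+ 2).
Proof.
rewrite enorm_sqr /enorm big_ord_recl tnth0; congr (Num.sqrt (_ + _)).
by apply: eq_bigr => i _; rewrite tnthS expr2.
Qed.

Lemma enorm_tscale n (a : R) (w : n.-tuple R) : 0 <= a ->
  enorm (tscale a w) = a * enorm w.
Proof.
move=> a0; rewrite !enormE dotpZl dotpZr mulrA -expr2 sqrtrM ?sqr_ge0//.
by rewrite sqrtr_sqr ger0_norm.
Qed.

Lemma enorm_cons_scale (t : R) (w : d.-tuple R) :
  enorm (cons_pair (enorm w * t, w)) = enorm w / rho t.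
Proof.
rewrite enorm_cons exprMn /rho invrK.
have -> : enorm w ^+ 2 * t ^+ 2 + enorm w ^+ 2 = enorm w ^+ 2 * (1 + t ^+ 2) by ring.
by rewrite sqrtrM ?sqr_ge0// sqrtr_sqr ger0_norm// enorm_ge0.
Qed.

(** For [d] = 0 the origin is the only tuple and carries the whole mass; this is where [0 < d]
    enters. *)
Lemma lam_origin : lam [set w | enorm w = 0] = 0%E.
Proof.
case: d d0 => // n _; exact: lebesgue_power_origin.
Qed.

Lemma lam_origin_measurable : measurable [set w : d.-tuple R | enorm w = 0].
Proof. by case: d d0 => // n _; exact: measurable_origin. Qed.

(** A constant whose value is never computed: it is eliminated in [first_coord_law] by comparing
    total masses. *)
Definition radial : \bar R :=
  (\int[lam]_w (enorm w * (enorm w <= 1)%R%:R)%:E)%E.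

Lemma measurable_radial (r : R) :
  measurable_fun setT (fun w : d.-tuple R => enorm w * (enorm w <= r)%R%:R).
Proof.
apply: measurable_funM; first exact: measurable_enorm.
apply: measurable_natb.
by apply: measurable_fun_ler => //; exact: measurable_enorm.
Qed.

Lemma radial_scale (r : R) : 0 < r ->
  (\int[lam]_w (enorm w * (enorm w <= r)%R%:R)%:E = (r ^+ d.+1)%:E * radial)%E.
Proof.
move=> r0; pose f (w : d.-tuple R) : \bar R := (enorm w * (enorm w <= r)%R%:R)%:E.
have mf : measurable_fun setT f by apply/measurable_EFinP; exact: measurable_radial.
have f0 w : (0 <= f w)%E by rewrite lee_fin mulr_ge0 ?enorm_ge0.
have H := ge0_integral_tscale r0 mf f0.
have E : (\int[lam]_x f (tscale r x) = r%:E * radial)%E.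
  have m1 : measurable_fun setT (fun w : d.-tuple R => (enorm w * (enorm w <= 1)%R%:R)%:E).
    by apply/measurable_EFinP; exact: measurable_radial.
  rewrite /radial -(ge0_integralZl_EFin lam measurableT _ m1 (ltW r0)); last first.
    by move=> w _; rewrite lee_fin mulr_ge0 ?enorm_ge0.
  apply: eq_integral => w _; rewrite -EFinM /f enorm_tscale ?(ltW r0)//.
  by rewrite -[X in _ <= X]mulr1 ler_pM2l// -!mulrA.
rewrite exprSr EFinM -muleA -E H muleA -EFinM mulfV ?mul1e//.
by rewrite expf_neq0// gt_eqF.
Qed.

(* Slice the unit ball: on the line through (0, w) in the direction of the first
   axis, substitute s = |w| t. *)
Lemma first_coord_polar (h : R -> \bar R) :
  measurable_fun setT h -> (forall x, 0 <= h x)%E ->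
  (\int[mu]_x h (tnth (sval x) ord0) =
   (unit_ball_volume R d)^-1%:E *
     (radial * \int[leb]_t (h (t * rho t)%R * (rho t ^+ d.+1)%:E)))%E.
Proof.
move=> mh h0.
have mt0 : measurable_fun setT (fun x : S => tnth (sval x) ord0).
  exact: (measurableT_comp (@measurable_tnth _ _ d.+1 ord0) (@measurable_sphere_val R d)).
have mht := measurableT_comp mh mt0.
rewrite (ge0_integral_sphere mht (fun x => h0 _)); congr (_ * _)%E.
pose f (x : d.+1.-tuple R) : \bar R := ((enorm x <= 1)%R%:R)%:E.
have mfR : measurable_fun setT (fun x : d.+1.-tuple R => (enorm x <= 1)%R%:R : R).
  apply: measurable_natb.
  by apply: measurable_fun_ler => //; exact: measurable_enorm.
have mf : measurable_fun setT f by apply/measurable_EFinP.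
have f0 x : (0 <= f x)%E by rewrite lee_fin.
pose G x := (f x * h (tnth x ord0 / enorm x)%R)%E.
have mq : measurable_fun setT (fun x : d.+1.-tuple R => tnth x ord0 / enorm x).
  rewrite (_ : (fun x : d.+1.-tuple R => _) =
    (fun x => tnth x ord0) \* (fun x => enorm x `^ (-1))).
    apply: measurable_funM; first exact: measurable_tnth.
    by apply: (measurableT_comp (measurable_powR _)); exact: measurable_enorm.
  by apply/funext => x /=; rewrite powR_inv1// enorm_ge0.
have mG : measurable_fun setT G.
  by apply: emeasurable_funM => //; exact: (measurableT_comp mh mq).
have G0 x : (0 <= G x)%E by rewrite mule_ge0.
transitivity (\int[lam1]_x G x)%E.
  transitivity (\int[lam1]_x (f x * h (tnth (sval (sphere_proj x)) ord0)))%E.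
    rewrite integral_mkcond; apply: eq_integral => x _.
    rewrite patchE /f; have [x1|x1] := boolP (enorm x <= 1).
      by rewrite mem_set// mul1e.
    by rewrite memNset ?mul0e// => /=; exact/negP.
  apply: ge0_ae_eq_integral => //.
  - apply: emeasurable_funM => //.
    exact: (measurableT_comp mht (@measurable_sphere_proj R d)).
  - by move=> x _; apply: mule_ge0.
  - exists [set x | enorm x = 0]; split; first exact: measurable_origin.
      exact: lebesgue_power_origin.
    move=> x /= H; apply: contrapT => x0; apply: H => _.
    rewrite /G; congr (_ * h _)%E; rewrite sphere_projE; last exact/eqP.
    by rewrite tnth_mktuple mulrC.
rewrite /lebesgue_power (ge0_integral_power_measureSr _ mG G0).
(* After s = |w| t the point (s, w) has norm |w| / [rho t] and normalised first coordinate t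
   [rho t]. The ball becomes |w| <= [rho t], and the integral over w is then given by homogeneity,
   in [radial_scale]. *)
pose F (p : R * d.-tuple R) : \bar R :=
  (h (p.1 * rho p.1)%R * (enorm p.2 * (enorm p.2 <= rho p.1)%R%:R)%:E)%E.
have mrho : measurable_fun setT (@rho R).
  by apply: continuous_measurable_fun; exact: continuous_rho.
have mhr : measurable_fun setT (fun t : R => h (t * rho t)).
  by apply: measurableT_comp mh _; exact: measurable_funM.
have mF : measurable_fun setT F.
  apply: emeasurable_funM.
    exact: (measurableT_comp mhr measurable_fst).
  have me2 : measurable_fun setT (fun p : R * d.-tuple R => enorm p.2).
    exact: (measurableT_comp (@measurable_enorm R d) measurable_snd).
  apply/measurable_EFinP; apply: measurable_funM => //.
  apply: measurable_natb; apply: measurable_fun_ler => //.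
  exact: (measurableT_comp mrho measurable_fst).
have F0 p : (0 <= F p)%E.
  by apply: mule_ge0 => //; rewrite lee_fin mulr_ge0 ?enorm_ge0.
have mGc : measurable_fun setT (fun p : R * d.-tuple R => G (cons_pair p)).
  exact: (measurableT_comp mG (@measurable_cons_pair _ _ d)).
transitivity (\int[lam]_w \int[leb]_t F (t, w))%E.
  apply: ge0_ae_eq_integral => //.
  - exact: (@measurable_fun_fubini_tonelli_G _ _ _ _ _ leb _ mGc (fun p => G0 _)).
  - exact: (@measurable_fun_fubini_tonelli_G _ _ _ _ _ leb _ mF F0).
  - by move=> w _; exact: integral_ge0.
  - by move=> w _; exact: integral_ge0.
  exists [set w | enorm w = 0]; split; first exact: lam_origin_measurable.
    exact: lam_origin.
  move=> w /= H; apply: contrapT => /eqP w0; apply: H => _.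
  have {}w0 : 0 < enorm w by rewrite lt_neqAle eq_sym w0 enorm_ge0.
  have mGw : measurable_fun setT (fun s : R => G (cons_pair (s, w))).
    by apply: measurableT_comp mGc _; exact: measurable_fun_pair.
  have E := ge0_integral_affine 0 w0 mGw (fun s => G0 _).
  transitivity ((enorm w)%:E * \int[leb]_x G (cons_pair ((enorm w * x + 0)%R, w)))%E.
    by rewrite E muleA -EFinM mulfV ?mul1e// gt_eqF.
  have mGa : measurable_fun setT (fun x : R => G (cons_pair (enorm w * x + 0, w))).
    exact: (measurableT_comp mGw (measurable_affine _ _)).
  rewrite -(ge0_integralZl_EFin leb measurableT (fun x _ => G0 _) mGa (ltW w0)).
  apply: eq_integral => t _; rewrite /F /G /f /= addr0 enorm_cons_scale tnth0.
  have rt := rho_gt0 t.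
  have -> : enorm w * t / (enorm w / rho t) = t * rho t.
    by field; rewrite !gt_eqF.
  rewrite ler_pdivrMr// mul1r muleA -EFinM muleC; congr (_ * _)%E.
rewrite -(fubini_tonelli F mF F0).
transitivity (\int[leb]_t (radial * (h (t * rho t)%R * (rho t ^+ d.+1)%:E)))%E.
  apply: eq_integral => t _; rewrite /fubini_F /F /=.
  have mr : measurable_fun setT (fun w : d.-tuple R => (enorm w * (enorm w <= rho t)%R%:R)%:E).
    by apply/measurable_EFinP; exact: measurable_radial.
  rewrite (ge0_integralZl lam measurableT mr _ (h0 _)); last first.
    by move=> w _; rewrite lee_fin mulr_ge0 ?enorm_ge0.
  by rewrite (radial_scale (rho_gt0 t)) [RHS]muleC muleA.
have rad0 : (0 <= radial)%E.
  by apply: integral_ge0 => w _; rewrite lee_fin mulr_ge0 ?enorm_ge0.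
apply: (ge0_integralZl leb measurableT _ _ rad0).
  by apply: emeasurable_funM => //; apply/measurable_EFinP; exact: measurable_rhoX.
move=> t _; apply: mule_ge0 => //; rewrite lee_fin; apply: exprn_ge0.
exact/ltW/rho_gt0.
Qed.

(** [first_coord_polar] gives the law up to a constant; the case h = 1, where the left side is 1 and
    the integral on the right is [ejac R d], identifies it. *)
Theorem first_coord_law (h : R -> \bar R) :
  measurable_fun setT h -> (forall x, 0 <= h x)%E ->
  (\int[mu]_x h (tnth (sval x) ord0) =
   (omega R d.-1 / omega R d)%:E *
     \int[leb]_t (h (t * rho t)%R * (rho t ^+ d.+1)%:E))%E.
Proof.
move=> mh h0; rewrite first_coord_polar// muleA; congr (_ * _)%E.
have := @first_coord_polar (fun=> 1%E) (measurable_cst _) (fun=> lee01).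
have -> : (\int[mu]_x 1 = 1)%E.
  by rewrite integral_cst// mul1e; exact: (@probability_setT _ _ _ mu).
rewrite muleA.
have -> : (\int[leb]_t (1 * (rho t ^+ d.+1)%:E) = ejac R d)%E.
  by apply: eq_integral => t _; rewrite mul1e.
rewrite ejac_omega//; have o1 := omega_gt0 R d; have o2 := omega_gt0 R d.-1.
move: (_ * radial)%E => k E.
rewrite -[LHS]mule1 (_ : 1%E = (omega R d / omega R d.-1 * (omega R d.-1 / omega R d))%:E).
  by rewrite EFinM muleA -E mul1e.
by rewrite mulrA divfK ?gt_eqF// divff ?gt_eqF.
Qed.

End FirstCoordinate.

Lemma is_derive_inv (R : realType) (f : R -> R) (x df : R) : f x != 0 ->
  is_derive x 1 f df -> is_derive x 1 (fun y => (f y)^-1) (- (f x) ^- 2 * df).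
Proof.
move=> fx0 [dfx <-]; apply: DeriveDef; first exact: derivableV.
exact: deriveV.
Qed.

(** * The chord length as integration variable *)

Section Chord.
Context (R : realType).
Implicit Types (t a T : R) (k : nat).

Definition sg t : R := t * rho t.

(* the distance between points of the sphere with scalar product [sg t] *)
Definition chord t : R := Num.sqrt (2 - 2 * sg t).

Lemma rho_sg t : rho t ^+ 2 = 1 - sg t ^+ 2.
Proof.
have h := sqr1_gt0 t; rewrite /sg exprMn rho_sqr; field; exact: lt0r_neq0.
Qed.

Lemma sg_lt1 t : sg t < 1.
Proof.
rewrite ltNge; apply/negP => s1; have := exprn_gt0 2 (rho_gt0 t).
by rewrite rho_sg subr_gt0 ltNge; move/negP; apply; rewrite exprn_ege1.
Qed.

Lemma sgN t : sg (- t) = - sg t.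
Proof. by rewrite /sg /rho sqrrN mulNr. Qed.

Lemma sg_gtN1 t : -1 < sg t.
Proof. by rewrite ltrNl -sgN sg_lt1. Qed.

Lemma chord_sqr t : chord t ^+ 2 = 2 - 2 * sg t.
Proof.
by rewrite sqr_sqrtr// subr_ge0 -[leRHS]mulr1 ler_pM2l// ltW// sg_lt1.
Qed.

Lemma chord_gt0 t : 0 < chord t.
Proof.
by rewrite sqrtr_gt0 subr_gt0 -[ltRHS]mulr1 ltr_pM2l// sg_lt1.
Qed.

Lemma chord_le2 t : chord t <= 2.
Proof.
rewrite -(ler_pXn2r (ltn0Sn 1)) ?nnegrE//; last exact/ltW/chord_gt0.
rewrite chord_sqr.
by have := sg_gtN1 t; nra.
Qed.

(** With [sg t] = cos a this is sin a <= 2 sin (a / 2). *)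
Lemma rho_le_chord t : rho t <= chord t.
Proof.
rewrite -(ler_pXn2r (ltn0Sn 1)) ?nnegrE; [|exact/ltW/rho_gt0|exact/ltW/chord_gt0].
rewrite chord_sqr rho_sg -subr_ge0.
by have -> : 2 - 2 * sg t - (1 - sg t ^+ 2) = (sg t - 1) ^+ 2; [ring|exact: sqr_ge0].
Qed.

Lemma is_derive_rho t : is_derive t 1 (@rho R) (- (t * rho t ^+ 3)).
Proof.
have h := sqr1_gt0 t.
have dX := @is_deriveX _ _ id 2 t 1 _ (is_derive_id t 1).
have d1 : is_derive t 1 (fun x : R => 1 + x ^+ 2) (2 * t).
  apply: is_derive_eq (is_deriveD (is_derive_cst (1 : R) t 1) dX) _.
  by rewrite add0r /GRing.scale/= mulr1.
have d2 := @is_derive1_comp _ Num.sqrt (fun x : R => 1 + x ^+ 2) _ _ _ (is_derive1_sqrt h) d1.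
have s0 : 0 < Num.sqrt (1 + t ^+ 2) by rewrite sqrtr_gt0.
have d3 := @is_derive_inv _ (Num.sqrt \o (fun x : R => 1 + x ^+ 2)) t _ (lt0r_neq0 s0) d2.
apply: is_derive_eq d3 _.
rewrite /rho /=; move: s0; move: (Num.sqrt (1 + t ^+ 2)) => s s0.
rewrite /GRing.scale/=; field; exact: lt0r_neq0.
Qed.

Lemma is_derive_sg t : is_derive t 1 sg (rho t ^+ 3).
Proof.
have d1 := is_deriveM (is_derive_id t 1) (is_derive_rho t).
apply: is_derive_eq d1 _; rewrite /GRing.scale/= mulr1.
have : rho t ^+ 3 * (1 + t ^+ 2) = rho t.
  by rewrite exprSr rho_sqr mulrAC mulVf ?mul1r// lt0r_neq0// sqr1_gt0.
by move: (rho t) (rho t ^+ 3) => r r3 <-; ring.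
Qed.

Lemma is_derive_chord t : is_derive t 1 chord (- (rho t ^+ 3 / chord t)).
Proof.
have h : 0 < 2 - 2 * sg t by have := sg_lt1 t; lra.
have d1 : is_derive t 1 (fun x : R => 2 - 2 * sg x) (0 - 2 *: rho t ^+ 3).
  by apply: is_deriveB; apply: is_deriveZ; exact: is_derive_sg.
have d2 := @is_derive1_comp _ Num.sqrt (fun x : R => 2 - 2 * sg x) _ _ _ (is_derive1_sqrt h) d1.
apply: is_derive_eq d2 _; rewrite /GRing.scale/= sub0r -/(chord t).
field; exact: lt0r_neq0 (chord_gt0 t).
Qed.

(** From chord^2 = 2 - 2 sg and sg' = rho^3 one gets chord * chord' = - rho^3, so rho^3 times any
    power of the chord has an elementary primitive. *)
Definition chord_prim k t : R := - (chord t ^+ k.+2 / k.+2%:R).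

Lemma is_derive_chord_prim k t :
  is_derive t 1 (chord_prim k) (chord t ^+ k * rho t ^+ 3).
Proof.
have d1 := @is_deriveX _ _ chord k.+2 t 1 _ (is_derive_chord t).
have d2 := is_deriveN (is_deriveZ (k.+2%:R^-1) d1).
have -> : chord_prim k = - (k.+2%:R^-1 \*: (chord ^+ k.+2)).
  apply/funext => x; rewrite /chord_prim mulrC. by rewrite !fctE.
apply: is_derive_eq d2 _; rewrite /GRing.scale/= exprS.
field; rewrite lt0r_neq0 ?chord_gt0//=.
Qed.

Lemma continuous_chord : continuous chord.
Proof.
move=> t; apply: differentiable_continuous; apply/derivable1_diffP.
by have [] := is_derive_chord t.
Qed.

Lemma cvg_chord : chord t @[t --> +oo] --> (0 : R).
Proof.
apply: (@squeeze_cvgr _ _ _ _ (fun=> 0) (fun x => 2 / x)); last 2 first.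
- exact: cvg_cst.
- rewrite -[X in _ --> X](mulr0 2); apply: cvgMr.
  apply/(@gtr0_cvgV0 _ _ _ _ id); last exact: cvg_id.
  exact: nbhs_pinfty_gt.
near=> t; have t0 : 0 < t by near: t; exact: nbhs_pinfty_gt.
rewrite (ltW (chord_gt0 t))/= -(ler_pXn2r (ltn0Sn 1)) ?nnegrE; last 2 first.
  exact/ltW/chord_gt0.
  by rewrite divr_ge0// ltW.
have s0 : 0 <= sg t by rewrite mulr_ge0 ?ltW// rho_gt0.
have s1 := sg_lt1 t.
(* For 0 <= s <= 1, 1 - s <= 1 - s^2 = rho^2. *)
apply: (@le_trans _ _ (2 * rho t ^+ 2)); first by rewrite chord_sqr rho_sg; nra.
have t20 : 0 < t ^+ 2 by rewrite exprn_gt0.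
rewrite rho_sqr expr_div_n ler_pdivlMr// mulrAC ler_pdivrMr ?sqr1_gt0//.
nra.
Unshelve. all: by end_near.
Qed.

Lemma integral_chord k a :
  (\int[@lebesgue_measure R]_(t in `[a, +oo[) (chord t ^+ k * rho t ^+ 3)%:E =
   (chord a ^+ k.+2 / k.+2%:R)%:E)%E.
Proof.
rewrite (@ge0_continuous_FTC2y _ _ (chord_prim k) a 0).
- by rewrite sub0e /chord_prim EFinN oppeK.
- move=> t _; rewrite mulr_ge0 ?exprn_ge0//; [exact/ltW/chord_gt0|exact/ltW/rho_gt0].
- apply: continuous_subspaceT => t; apply: cvgM.
    by apply: (@continuous_comp _ _ _ chord (fun x => x ^+ k));
      [exact: continuous_chord|exact: exprn_continuous].
  by apply: (@continuous_comp _ _ _ (@rho R) (fun x => x ^+ 3));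
    [exact: continuous_rho|exact: exprn_continuous].
- rewrite -[X in _ --> X](_ : - (0 ^+ k.+2 / k.+2%:R) = 0); last first.
    by rewrite expr0n mul0r oppr0.
  apply: cvgN; apply: cvgMl.
  apply: (@continuous_cvg _ _ _ _ _ chord (fun x => x ^+ k.+2)).
    exact: exprn_continuous.
  exact: cvg_chord.
- by move=> t _; have [] := is_derive_chord_prim k t.
- apply: cvg_at_right_filter; apply: differentiable_continuous.
  by apply/derivable1_diffP; have [] := is_derive_chord_prim k a.
- by move=> t _; rewrite derive1E; have [_ ->] := is_derive_chord_prim k t.
Qed.

End Chord.

Section CapIntegral.
Context (R : realType).
Implicit Types (t a T : R) (k : nat).
Local Notation leb := (@lebesgue_on R).

Lemma sg_homo a t : t < a -> sg t < sg a.
Proof.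
move=> ta; have [|c] := @MVT _ (@sg R) (fun t => rho t ^+ 3) t a ta (fun x _ => is_derive_sg x).
  apply: derivable_within_continuous => x _.
  by have [] := is_derive_sg x.
move=> _ E; rewrite -subr_gt0 E mulr_gt0 ?subr_gt0// exprn_gt0//.
exact: rho_gt0.
Qed.

Lemma chord_anti a t : t < a -> chord a < chord t.
Proof.
move=> /sg_homo H; rewrite -(ltr_pXn2r (ltn0Sn 1)) ?nnegrE; last 2 first.
  exact/ltW/chord_gt0.
  exact/ltW/chord_gt0.
by rewrite !chord_sqr; lra.
Qed.

Lemma chord_surj T : 0 < T -> T < 2 -> exists a, chord a = T.
Proof.
(* [c] is the scalar product of two points at distance [T]; the witness inverts s = t / sqrt(1 +
   t^2). *)
move=> T0 T2; pose c := 1 - T ^+ 2 / 2.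
have c1 : 0 < 1 - c ^+ 2.
  have -> : 1 - c ^+ 2 = T ^+ 2 * ((2 - T) * (2 + T)) / 4 by rewrite /c; field.
  by rewrite divr_gt0// mulr_gt0 ?exprn_gt0// mulr_gt0; lra.
have s0 : 0 < Num.sqrt (1 - c ^+ 2) by rewrite sqrtr_gt0.
exists (c / Num.sqrt (1 - c ^+ 2)).
have sE : sg (c / Num.sqrt (1 - c ^+ 2)) = c.
  rewrite /sg /rho expr_div_n sqr_sqrtr ?(ltW c1)//.
  have -> : 1 + c ^+ 2 / (1 - c ^+ 2) = (1 - c ^+ 2)^-1 by field; exact: lt0r_neq0.
  by rewrite sqrtrV ?ltW// invrK divfK// lt0r_neq0.
rewrite /chord sE /c (_ : 2 - 2 * _ = T ^+ 2); last by field.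
by rewrite sqrtr_sqr ger0_norm// ltW.
Qed.

(* minus the derivative of chord^(k + 2) / (k + 2) *)
Definition chord_dens k t : R := chord t ^+ k * rho t ^+ 3.

Lemma chord_dens_ge0 k t : 0 <= chord_dens k t.
Proof.
by rewrite mulr_ge0 ?exprn_ge0//; [exact/ltW/chord_gt0|exact/ltW/rho_gt0].
Qed.

Lemma measurable_chord : measurable_fun setT (@chord R).
Proof. by apply: continuous_measurable_fun; exact: continuous_chord. Qed.

Lemma measurable_chord_dens k : measurable_fun setT (chord_dens k).
Proof.
apply: measurable_funM; last exact: measurable_rhoX.
by apply: measurable_funX; exact: measurable_chord.
Qed.

Lemma integral_chord_on k a :
  (\int[leb]_(t in `[a, +oo[) (chord_dens k t)%:E =
   (chord a ^+ k.+2 / k.+2%:R)%:E)%E.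
Proof.
rewrite ge0_lebesgue_onE//.
- exact: integral_chord.
- apply: measurable_funTS; apply/measurable_EFinP; exact: measurable_chord_dens.
- by move=> t _; rewrite lee_fin chord_dens_ge0.
Qed.

(** For 0 < T < 2 the cap is the half-line [a, +oo[ with [chord a] = T. The endpoints need care: for
    T = 0 the cap is empty, and T = 2 is not a value of [chord], so the full line is exhausted by
    the half-lines [-n, +oo[. *)
Lemma cap_int k T : 0 <= T <= 2 ->
  (\int[leb]_t (chord_dens k t * (chord t <= T)%R%:R)%:E <=
   (T ^+ k.+2 / k.+2%:R)%:E)%E.
Proof.
move=> /andP[T0 T2].
have mE : measurable_fun setT (fun t => (chord_dens k t * (chord t <= T)%R%:R)%:E).
  apply/measurable_EFinP; apply: measurable_funM; first exact: measurable_chord_dens.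
  by apply: measurable_natb; apply: measurable_fun_ler => //; exact: measurable_chord.
have mD D : measurable_fun D (fun t => (chord_dens k t)%:E).
  by apply: measurable_funTS; apply/measurable_EFinP; exact: measurable_chord_dens.
have [T00|Tn0] := eqVneq T 0.
  rewrite integral0_eq ?lee_fin ?divr_ge0 ?exprn_ge0// => t _.
  by rewrite T00 leNgt chord_gt0 mulr0.
have {}T0 : 0 < T by rewrite lt_neqAle eq_sym Tn0.
have [T22|Tn2] := eqVneq T 2; last first.
  have {}T2 : T < 2 by rewrite lt_neqAle Tn2.
  have [a aT] := chord_surj T0 T2.
  rewrite -aT -integral_chord_on [leRHS]integral_mkcond.
  apply: ge0_le_integral => //.
  - by move=> t _; rewrite lee_fin mulr_ge0 ?chord_dens_ge0.
  - by rewrite aT.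
  - apply/(measurable_restrictT _ (measurable_itv `[a, +oo[)). exact: mD.
  - move=> t _; rewrite patchE; have [ta|ta] := ltP t a.
      rewrite memNset/=; last by rewrite in_itv/= andbT leNgt ta.
      have -> : (chord t <= chord a) = false.
        by apply/negbTE; rewrite -ltNge; exact: chord_anti.
      by rewrite mulr0.
    rewrite mem_set/=; last by rewrite in_itv/= andbT.
    by rewrite lee_fin ler_piMr ?chord_dens_ge0// lern1 leq_b1.
subst T; pose F n := `[- n%:R, +oo[%classic : set R.
have FT : \bigcup_n F n = setT.
  apply/seteqP; split => // t _.
  have [n tn] : exists n, - t <= n%:R.
    by exists (Num.truncn `|t|).+1; apply/ltW/(le_lt_trans (ler_norm _)); rewrite normrN truncnS_gt.
  by exists n => //; rewrite /F/= in_itv/= andbT lerNl.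
have cvF := @ge0_nondecreasing_set_cvg_integral _ _ _ F (fun t => (chord_dens k t)%:E) leb.
have {cvF} cvF : (\int[leb]_(x in F i) (chord_dens k x)%:E)%E @[i --> \oo] -->
    (\int[leb]_x (chord_dens k x)%:E)%E.
  rewrite -FT; apply: cvF.
  - move=> m n mn; apply/subsetPset => t; rewrite /F/= !in_itv/= !andbT => h.
    by apply: le_trans h; rewrite lerN2 ler_nat.
  - by move=> i; exact: measurable_itv.
  - by move=> i; exact: mD.
  - by move=> i t _; rewrite lee_fin chord_dens_ge0.
apply: (@le_trans _ _ (\int[leb]_x (chord_dens k x)%:E)%E).
  apply: ge0_le_integral => //.
  - by move=> t _; rewrite lee_fin mulr_ge0 ?chord_dens_ge0.
  - by move=> t _; rewrite lee_fin ler_piMr ?chord_dens_ge0// lern1 leq_b1.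
rewrite -(cvg_lim _ cvF)//; apply: lime_le; first by apply/cvg_ex; exists (\int[leb]_x (chord_dens k x)%:E)%E.
apply: nearW => n; rewrite integral_chord_on lee_fin ler_pM2r ?invr_gt0 ?ltr0n//.
by apply: lerXn2r; rewrite ?nnegrE ?(ltW (chord_gt0 _))// chord_le2.
Qed.

End CapIntegral.

Section SphereCap.
Context (R : realType) (d : nat).
Hypothesis d0 : (0 < d)%N.
Local Notation leb := (@lebesgue_on R).
Local Notation S := (sphere R d).
Local Notation mu := (sphere_measure R d).
Local Notation sval := (@sphere_val R d).

Lemma dotp_pole (x : S) : dotp (sval x) (sval (pole R d)) = tnth (sval x) ord0.
Proof.
rewrite /dotp (bigD1 ord0)//= big1 ?addr0.
  by rewrite tnth_mktuple eqxx mulr1.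
by move=> i i0; rewrite tnth_mktuple (negbTE i0) mulr0.
Qed.

Lemma srefl_swap (x y : S) : srefl (tsub (sval x) (sval y)) x = y.
Proof.
by apply: sphere_val_inj; rewrite sval_srefl refl_swap// !sphere_dotp.
Qed.

Lemma measurable_sdotp (y : S) :
  measurable_fun setT (fun x : S => dotp (sval x) (sval y)).
Proof.
exact: (measurableT_comp (measurable_dotpl (sval y)) (@measurable_sphere_val R d)).
Qed.

(** The reflection exchanging [y] with the pole reduces the claim to the first coordinate. *)
Lemma zonal_law (h : R -> \bar R) (y : S) :
  measurable_fun setT h -> (forall x, 0 <= h x)%E ->
  (\int[mu]_x h (dotp (sval x) (sval y)) =
   (omega R d.-1 / omega R d)%:E *
     \int[leb]_t (h (sg t) * (rho t ^+ d.+1)%:E))%E.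
Proof.
move=> mh h0; rewrite -first_coord_law//.
set v := tsub (sval (pole R d)) (sval y).
have mhy := measurableT_comp mh (measurable_sdotp y).
rewrite -(ge0_integral_srefl v mhy (fun x => h0 _)); apply: eq_integral => x _ /=.
by rewrite -dotp_pole -(srefl_swap (pole R d) y) -/v !sval_srefl refl_dotp.
Qed.

Lemma edist_sphere (x y : S) :
  edist (sval x) (sval y) = Num.sqrt (2 - 2 * dotp (sval x) (sval y)).
Proof.
rewrite edistE enormE !dotpBl !dotpBr !sphere_dotp (dotpC (sval y)).
by congr Num.sqrt; ring.
Qed.

(** The last hypothesis compares the integrand, weighted by the density [rho t] ^ (d + 1) of the
    coordinate law, with a multiple of [chord_dens d], whose integral over the cap is controlled by
    [cap_int]; hence the exponent d + 2. *)
Lemma sphere_cap_bound (g : R -> R) (M T : R) (y : S) :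
  measurable_fun setT g -> (forall s, 0 <= g s) -> 0 <= M -> 0 <= T <= 2 ->
  (forall t, chord t <= T -> g (sg t) * rho t ^+ d.+1 <= M * chord_dens d t) ->
  (\int[mu]_x ((edist (sval x) (sval y) <= T)%R%:R * g (dotp (sval x) (sval y)))%:E <=
    (M * (omega R d.-1 / omega R d) * (T ^+ d.+2 / d.+2%:R))%:E)%E.
Proof.
move=> mg g0 M0 HT H.
pose h (s : R) : R := (Num.sqrt (2 - 2 * s) <= T)%R%:R * g s.
have mh : measurable_fun setT h.
  apply: measurable_funM => //; apply: measurable_natb; apply: measurable_fun_ler => //.
  apply: measurableT_comp; first by apply: continuous_measurable_fun; exact: sqrt_continuous.
  by apply: measurable_funB => //; exact: measurable_funM.
have h0 s : 0 <= h s by rewrite mulr_ge0.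
have mhE : measurable_fun setT (fun s => (h s)%:E) by apply/measurable_EFinP.
have := @zonal_law (fun s => (h s)%:E) y mhE (fun s => h0 s).
under eq_integral do rewrite /h -edist_sphere.
move=> ->.
have c0 : 0 <= omega R d.-1 / omega R d by rewrite divr_ge0// ltW// omega_gt0.
have -> : (M * (omega R d.-1 / omega R d) * (T ^+ d.+2 / d.+2%:R))%:E =
    ((omega R d.-1 / omega R d)%:E * (M%:E * (T ^+ d.+2 / d.+2%:R)%:E))%E.
  by rewrite -!EFinM; congr EFin; rewrite (mulrC M) -mulrA.
apply: lee_wpmul2l; first by rewrite lee_fin.
have mc : measurable_fun setT (fun t : R => (chord_dens d t * (chord t <= T)%R%:R)%:E).
  apply/measurable_EFinP; apply: measurable_funM; first exact: measurable_chord_dens.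
  by apply: measurable_natb; apply: measurable_fun_ler => //; exact: measurable_chord.
have cd0 t : [set: R] t -> (0 <= (chord_dens d t * (chord t <= T)%R%:R)%:E)%E.
  by move=> _; rewrite lee_fin mulr_ge0 ?chord_dens_ge0.
apply: (@le_trans _ _ (M%:E * \int[leb]_t (chord_dens d t * (chord t <= T)%R%:R)%:E)%E);
  last by apply: lee_wpmul2l; [rewrite lee_fin|exact: cap_int].
rewrite -(ge0_integralZl_EFin leb measurableT cd0 mc M0).
apply: ge0_le_integral => //.
- by move=> t _; rewrite -EFinM lee_fin mulr_ge0// exprn_ge0// ltW// rho_gt0.
- apply: emeasurable_funM; last by apply/measurable_EFinP; exact: measurable_rhoX.
  apply: (measurableT_comp mhE).
  by apply: continuous_measurable_fun => t; apply: cvgM; [exact: cvg_id|exact: continuous_rho].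
- by apply/measurable_EFinP; apply: measurable_funM => //; exact/measurable_EFinP.
- move=> t _; rewrite -!EFinM lee_fin /h -/(chord t).
  have [cT|cT] := boolP (chord t <= T); last by rewrite !(mul0r, mulr0).
  by rewrite mul1r mulr1 H.
Qed.

End SphereCap.

(** * Polynomial functions on the sphere *)

Section PolynomialFunctions.
Context (R : realType) (d : nat).
Local Notation S := (sphere R d).
Local Notation sval := (@sphere_val R d).
Implicit Types (L a b : nat) (f g : S -> R) (e : 'I_d.+1 -> nat).

Definition monom e (x : S) : R := \prod_i tnth (sval x) i ^+ e i.

(** Passage from formal polynomials to finite combinations of monomial functions, the form in which
    products, reflections and bounds are handled. *)
Lemma Pi_sum_monom L f : Pi L f -> exists (s : seq (multinom d.+1)) (c : multinom d.+1 -> R),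
  (forall m, m \in s -> (\sum_i (m : multinom d.+1) i <= L)%N) /\
  forall x, f x = \sum_(m <- s) c m * monom (fun i => m i) x.
Proof.
move=> [p /allP pL fE]; exists (msupp p), (fun m => mcoeff m p); split.
  by move=> m /pL; rewrite mdegE.
by move=> x; rewrite fE mevalE.
Qed.

Lemma eq_Pi L f g : f =1 g -> Pi L f -> Pi L g.
Proof. by move=> /funext ->. Qed.

Lemma Pi_zero L : Pi L (fun _ : S => 0).
Proof. by exists 0; rewrite ?msupp0// => x; rewrite meval0. Qed.

Lemma PiD L f g : Pi L f -> Pi L g -> Pi L (fun x => f x + g x).
Proof.
move=> [p /allP pL fE] [q /allP qL gE]; exists (p + q).
  apply/allP => m /msuppD_le; rewrite mem_cat => /orP[/pL|/qL]//.
by move=> x; rewrite mevalD fE gE.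
Qed.

Lemma PiZ L (c : R) f : Pi L f -> Pi L (fun x => c * f x).
Proof.
move=> [p /allP pL fE]; exists (c *: p).
  by apply/allP => m /msuppZ_le /pL.
by move=> x; rewrite mevalZ fE.
Qed.

Lemma Pi_sum L (I : Type) (s : seq I) (P : pred I) (F : I -> S -> R) :
  (forall i, P i -> Pi L (F i)) -> Pi L (fun x => \sum_(i <- s | P i) F i x).
Proof.
move=> H; elim: s => [|i s IH].
  by apply: eq_Pi (Pi_zero L) => x; rewrite big_nil.
have [Pi_|nPi] := boolP (P i); last first.
  by apply: eq_Pi IH => x; rewrite big_cons (negbTE nPi).
by apply: eq_Pi (PiD (H i Pi_) IH) => x; rewrite big_cons Pi_.
Qed.

Lemma Pi_sum_seq L (I : eqType) (s : seq I) (F : I -> S -> R) :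
  (forall i, i \in s -> Pi L (F i)) -> Pi L (fun x => \sum_(i <- s) F i x).
Proof.
move=> H; apply: (@eq_Pi L (fun x => \sum_(i <- s | i \in s) F i x)).
  by move=> x; rewrite -big_seq.
exact: Pi_sum.
Qed.

Lemma Pi_monom L e : (\sum_i e i <= L)%N -> Pi L (monom e).
Proof.
move=> eL; pose m : multinom d.+1 := Multinom [tuple e i | i < d.+1].
have mE i : m i = e i by rewrite /m multinomE tnth_mktuple.
exists (mpolyX R m).
  by rewrite msuppX /= andbT mdegE; under eq_bigr do rewrite mE.
by move=> x; rewrite mevalX; apply: eq_bigr => i _; rewrite mE.
Qed.

Lemma leq_Pi a b f : (a <= b)%N -> Pi a f -> Pi b f.
Proof.
move=> ab [p /allP pa fE]; exists p => //; apply/allP => m /pa /leq_trans; exact.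
Qed.

Lemma Pi_cst L (c : R) : Pi L (fun _ : S => c).
Proof.
have := PiZ c (@Pi_monom L (fun=> 0%N) _); rewrite big1// => /(_ isT).
by apply: eq_Pi => x; rewrite /monom big1 ?mulr1.
Qed.

Lemma Pi_coord i : Pi 1 (fun x => tnth (sval x) i).
Proof.
have := @Pi_monom 1 (fun j => (j == i : nat)) _.
rewrite (bigD1 i)//= eqxx big1; last by move=> j /negbTE ->.
move=> /(_ isT); apply: eq_Pi => x; rewrite /monom (bigD1 i)//= eqxx big1 ?mulr1//.
by move=> j /negbTE ->.
Qed.

Lemma PiM a b f g : Pi a f -> Pi b g -> Pi (a + b) (fun x => f x * g x).
Proof.
move=> /Pi_sum_monom[s [c [sa fE]]] /Pi_sum_monom[s' [c' [sb gE]]].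
apply: (@eq_Pi _ (fun x => \sum_(m <- s) \sum_(m' <- s')
  (c m * c' m') * monom (fun i => m i + m' i)%N x)).
  move=> x; rewrite fE gE mulr_suml; apply: eq_bigr => m _.
  rewrite mulr_sumr; apply: eq_bigr => m' _; rewrite mulrACA; congr (_ * _).
  by rewrite /monom -big_split/=; apply: eq_bigr => i _; rewrite exprD.
apply: Pi_sum_seq => m ms; apply: Pi_sum_seq => m' ms'; apply: PiZ.
by apply: Pi_monom; rewrite big_split/= leq_add ?sa ?sb.
Qed.

Lemma PiX a f k : Pi a f -> Pi (a * k) (fun x => f x ^+ k).
Proof.
move=> fa; elim: k => [|k IH].
  by rewrite muln0; apply: eq_Pi (Pi_cst 0 1) => x; rewrite expr0.
rewrite mulnS; apply: eq_Pi (PiM fa IH) => x; rewrite exprS//.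
Qed.

Lemma Pi_prod (I : Type) (s : seq I) (e : I -> nat) (F : I -> S -> R) :
  (forall i, Pi (e i) (F i)) ->
  Pi (\sum_(i <- s) e i) (fun x => \prod_(i <- s) F i x).
Proof.
move=> H; elim: s => [|i s IH].
  by rewrite big_nil; apply: eq_Pi (Pi_cst 0 1) => x; rewrite big_nil.
by rewrite big_cons; apply: eq_Pi (PiM (H i) IH) => x; rewrite big_cons.
Qed.

Lemma Pi_dotp v : Pi 1 (fun x => dotp (sval x) v).
Proof.
apply: Pi_sum => i _; apply: eq_Pi (PiZ (tnth v i) (Pi_coord i)) => x.
exact: mulrC.
Qed.

Lemma Pi_srefl L v f : Pi L f -> Pi L (fun x => f (srefl v x)).
Proof.
move=> /Pi_sum_monom[s [c [sL fE]]].
apply: (@eq_Pi _ (fun x => \sum_(m <- s) c m * monom (fun i => m i) (srefl v x))).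
  by move=> x; rewrite fE.
apply: Pi_sum_seq => m ms; apply: PiZ.
apply: (leq_Pi (sL m ms)); rewrite /monom.
apply: Pi_prod => i.
suff H : Pi 1 (fun x => tnth (sval (srefl v x)) i) by have := PiX (m i) H; rewrite mul1n.
apply: (@eq_Pi _ (fun x => tnth (sval x) i + - (2 / dotp v v * tnth v i) * dotp (sval x) v)).
  by move=> x; rewrite sval_srefl !tnth_mktuple; ring.
by apply: PiD; [exact: Pi_coord|apply: PiZ; exact: Pi_dotp].
Qed.

Lemma Pi_zonal L (p : {poly R}) (y : S) : (size p <= L.+1)%N ->
  Pi L (fun x => p.[dotp (sval x) (sval y)]).
Proof.
move=> pL; apply: (@eq_Pi _ (fun x =>
  \sum_(i < size p) p`_i * dotp (sval x) (sval y) ^+ i)).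
  by move=> x; rewrite horner_coef.
apply: Pi_sum => i _; apply: PiZ; apply: (@leq_Pi (1 * i)).
  by rewrite mul1n -ltnS (leq_trans _ pL).
by apply: PiX; exact: Pi_dotp.
Qed.

Lemma measurable_coord (i : 'I_d.+1) : measurable_fun setT (fun x : S => tnth (sval x) i).
Proof.
exact: (measurableT_comp (@measurable_tnth _ _ d.+1 i) (@measurable_sphere_val R d)).
Qed.

Lemma measurable_monom e : measurable_fun setT (monom e).
Proof.
by apply: measurable_prod => i _; apply: measurable_funX; exact: measurable_coord.
Qed.

Lemma Pi_measurable L f : Pi L f -> measurable_fun setT f.
Proof.
move=> /Pi_sum_monom[s [c [_ /funext ->]]].
by apply: measurable_sum => m; apply: measurable_funM => //; exact: measurable_monom.
Qed.

Lemma coord_le1 (x : S) i : `|tnth (sval x) i| <= 1.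
Proof.
rewrite -(expr_le1 (ltn0Sn 1))// -normrX ger0_norm ?sqr_ge0//.
rewrite -(sphere_dotp x) /dotp (bigD1 i)//= -expr2 lerDl.
by apply: sumr_ge0 => j _; rewrite -expr2 sqr_ge0.
Qed.

Lemma monom_le1 e (x : S) : `|monom e x| <= 1.
Proof.
rewrite /monom normr_prod prodr_ile1// => i _.
by rewrite normr_ge0 normrX exprn_ile1// coord_le1.
Qed.

Lemma Pi_bounded L f : Pi L f -> exists M, forall x, `|f x| <= M.
Proof.
move=> /Pi_sum_monom[s [c [_ fE]]]; exists (\sum_(m <- s) `|c m|) => x.
rewrite fE; apply: le_trans (ler_norm_sum _ _ _) _; apply: ler_sum => m _.
by rewrite normrM ler_piMr// monom_le1.
Qed.

End PolynomialFunctions.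

(** * Bounded measurable functions and their integrals *)

Section BoundedMeasurable.
Context dT (T : measurableType dT) (R : realType).
Implicit Types f g : T -> R.

(** Unlike integrability, this condition is stable under products and sections, and it implies
    integrability for every finite measure. *)
Definition bmf f := measurable_fun setT f /\ exists M, forall x, `|f x| <= M.

Lemma bmf_cst (c : R) : bmf (fun=> c).
Proof. by split=> //; exists `|c|. Qed.

Lemma bmfD f g : bmf f -> bmf g -> bmf (fun x => f x + g x).
Proof.
move=> [mf [M fM]] [mg [N gN]]; split; first exact: measurable_funD.
by exists (M + N) => x; rewrite (le_trans (ler_normD _ _))// lerD.
Qed.

Lemma bmfM f g : bmf f -> bmf g -> bmf (fun x => f x * g x).
Proof.
move=> [mf [M fM]] [mg [N gN]]; split; first exact: measurable_funM.
by exists (M * N) => x; rewrite normrM ler_pM.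
Qed.

Lemma bmfN f : bmf f -> bmf (fun x => - f x).
Proof.
move=> [mf [M fM]]; split; first exact: measurable_funN.
by exists M => x; rewrite normrN.
Qed.

Lemma bmfB f g : bmf f -> bmf g -> bmf (fun x => f x - g x).
Proof. by move=> bf bg; exact: (bmfD bf (bmfN bg)). Qed.

Lemma bmfZ (c : R) f : bmf f -> bmf (fun x => c * f x).
Proof. exact: (bmfM (bmf_cst c)). Qed.

Lemma eq_bmf f g : f =1 g -> bmf f -> bmf g.
Proof. by move=> /funext ->. Qed.

Lemma bmf_sum (I : Type) (s : seq I) (P : pred I) (F : I -> T -> R) :
  (forall i, P i -> bmf (F i)) -> bmf (fun x => \sum_(i <- s | P i) F i x).
Proof.
move=> H; elim: s => [|i s IH].
  by apply: eq_bmf (bmf_cst 0) => x; rewrite big_nil.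
have [Pi_|nPi] := boolP (P i); last first.
  by apply: eq_bmf IH => x; rewrite big_cons (negbTE nPi).
by apply: eq_bmf (bmfD (H i Pi_) IH) => x; rewrite big_cons Pi_.
Qed.

Lemma bmf_prod (I : Type) (s : seq I) (P : pred I) (F : I -> T -> R) :
  (forall i, P i -> bmf (F i)) -> bmf (fun x => \prod_(i <- s | P i) F i x).
Proof.
move=> H; elim: s => [|i s IH].
  by apply: eq_bmf (bmf_cst 1) => x; rewrite big_nil.
have [Pi_|nPi] := boolP (P i); last first.
  by apply: eq_bmf IH => x; rewrite big_cons (negbTE nPi).
by apply: eq_bmf (bmfM (H i Pi_) IH) => x; rewrite big_cons Pi_.
Qed.

Lemma bmf_natb (b : T -> bool) : measurable_fun setT b -> bmf (fun x => (b x)%:R).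
Proof.
move=> mb; split; first exact: measurable_natb.
by exists 1 => x; case: (b x); rewrite ?normr1 ?normr0.
Qed.

End BoundedMeasurable.

Lemma bmf_comp dT (T : measurableType dT) dU (U : measurableType dU) (R : realType)
    (f : T -> R) (h : U -> T) :
  measurable_fun setT h -> bmf f -> bmf (fun x => f (h x)).
Proof.
move=> mh [mf [M fM]]; split; first exact: measurableT_comp mf mh.
by exists M.
Qed.

Section BoundedIntegral.
Context dT (T : measurableType dT) (R : realType).
Variable mu : {measure set T -> \bar R}.
Hypothesis mufin : (mu setT < +oo)%E.
Implicit Types f g : T -> R.

Lemma bmf_integrable f : bmf f -> mu.-integrable setT (EFin \o f).
Proof.
move=> [mf [M fM]]; apply: measurable_bounded_integrable => //.
exists M; split; first exact: num_real.
by move=> N MN x _; apply: le_trans (fM x) (ltW MN).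
Qed.

Lemma bmf_RintegralD f g : bmf f -> bmf g ->
  \int[mu]_x (f x + g x) = \int[mu]_x f x + \int[mu]_x g x.
Proof. by move=> bf bg; rewrite RintegralD//; exact: bmf_integrable. Qed.

Lemma bmf_RintegralZ (c : R) f : bmf f ->
  \int[mu]_x (c * f x) = c * \int[mu]_x f x.
Proof. by move=> bf; rewrite RintegralZl//; exact: bmf_integrable. Qed.

Lemma bmf_RintegralB f g : bmf f -> bmf g ->
  \int[mu]_x (f x - g x) = \int[mu]_x f x - \int[mu]_x g x.
Proof. move=> bf bg; apply: RintegralB => //; exact: bmf_integrable. Qed.

Lemma bmf_Rintegral_sum (I : Type) (s : seq I) (P : pred I) (F : I -> T -> R) :
  (forall i, P i -> bmf (F i)) ->
  \int[mu]_x (\sum_(i <- s | P i) F i x) = \sum_(i <- s | P i) \int[mu]_x F i x.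
Proof.
move=> H; elim: s => [|i s IH].
  under eq_Rintegral do rewrite big_nil.
  by rewrite big_nil Rintegral_cst// mul0r.
rewrite big_cons; under eq_Rintegral do rewrite big_cons.
by case: ifPn => // Pi_; rewrite bmf_RintegralD ?IH//; [exact: H|exact: bmf_sum].
Qed.

Lemma bmf_RintegralE f : bmf f -> (\int[mu]_x (f x)%:E = (\int[mu]_x f x)%:E)%E.
Proof. by move=> bf; rewrite /Rintegral fineK//; exact/integrable_fin_num/bmf_integrable. Qed.

Lemma bmf_le_Rintegral f g : bmf f -> bmf g -> (forall x, f x <= g x) ->
  \int[mu]_x f x <= \int[mu]_x g x.
Proof.
move=> bf bg fg; apply: (le_Rintegral measurableT).
- exact: bmf_integrable.
- exact: bmf_integrable.
- by move=> x _; exact: fg.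
Qed.

End BoundedIntegral.

(** * The reproducing kernel is zonal *)

Section ReproducingKernel.
Context (R : realType) (d L : nat).
Local Notation S := (sphere R d).
Local Notation mu := (sphere_measure R d).
Local Notation sval := (@sphere_val R d).
Implicit Types (f g : S -> R) (K : S -> S -> R).

Lemma sphere_measure_fin : (mu setT < +oo)%E.
Proof.
apply: (@le_lt_trans _ _ 1%E); last by rewrite ltry.
have -> : mu setT = 1%E by exact: (@probability_setT _ _ _ mu).
by [].
Qed.

Lemma Pi_bmf n f : Pi n f -> bmf f.
Proof. by move=> fP; split; [exact: Pi_measurable fP|exact: Pi_bounded fP]. Qed.

(** Both values equal the integral of K1(x, z) K2(x, y) in x. Taking K1 = K2 gives symmetry, and the
    two together give uniqueness of the kernel. *)
Lemma kernel_swap K1 K2 : reproducing_kernel L K1 -> reproducing_kernel L K2 ->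
  forall y z, K1 y z = K2 z y.
Proof.
move=> [P1 r1] [P2 r2] y z.
rewrite (r2 (K1 ^~ z) y (P1 z)) (r1 (K2 ^~ y) z (P2 y)).
by apply: eq_Rintegral => x _; rewrite mulrC.
Qed.

Lemma kernel_sym K : reproducing_kernel L K -> forall y z, K y z = K z y.
Proof. by move=> rK; exact: kernel_swap. Qed.

Lemma Rintegral_srefl v f : bmf f ->
  \int[mu]_x f (srefl v x) = \int[mu]_x f x.
Proof.
move=> bf; rewrite /Rintegral; congr fine.
have mr := @measurable_srefl R d v.
have mf : measurable_fun setT (EFin \o f) by apply/measurable_EFinP; case: bf.
have ifr : mu.-integrable (srefl v @^-1` setT) ((EFin \o f) \o srefl v).
  by rewrite preimage_setT; apply: (bmf_integrable sphere_measure_fin); exact: bmf_comp.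
have := integral_pushforward mr mf ifr measurableT.
rewrite preimage_setT => <-; apply: eq_measure_integral => A mA _.
have := @ge0_integral_srefl R d v (fun x => (\1_A x)%:E).
rewrite [X in _ -> _ -> _ = X](integral_indic _ measurableT mA) setIT => <-; last 2 first.
- by apply/measurable_EFinP; exact: measurable_indic.
- by move=> x; rewrite lee_fin.
have mrA : measurable (srefl v @^-1` A) by rewrite -[X in measurable X]setTI; exact: mr.
by rewrite (integral_indic _ measurableT mrA) setIT.
Qed.

Lemma kernel_srefl K v : reproducing_kernel L K ->
  forall x y, K (srefl v x) (srefl v y) = K x y.
Proof.
move=> rK x y; have [PK rep] := rK; rewrite [RHS](kernel_sym rK).
apply: (@kernel_swap (fun x y => K (srefl v x) (srefl v y)) K) => //.
split=> [z|f z fP]; first exact: (Pi_srefl v (PK (srefl v z))).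
have := rep _ (srefl v z) (Pi_srefl v fP); rewrite sreflK => ->.
rewrite -[RHS](Rintegral_srefl v); last first.
  apply: bmfM; [exact: Pi_bmf fP|].
  exact: (Pi_bmf (Pi_srefl v (PK (srefl v z)))).
by apply: eq_Rintegral => w _; rewrite sreflK.
Qed.

(* 0 <= \int (s f - K y)^2 = - 2 s f y + K y y for all s *)
Lemma Pi_definite K f : reproducing_kernel L K -> Pi L f -> \int[mu]_x (f x * f x) = 0 ->
  f =1 fun=> 0.
Proof.
move=> [PK rep] Pf f0 y.
have bf := Pi_bmf Pf; have bK := Pi_bmf (PK y).
have H s : 0 <= K y y - 2 * s * f y.
  have -> : K y y - 2 * s * f y = \int[mu]_x (s * f x - K x y) ^+ 2.
    transitivity (\int[mu]_x (K x y * K x y - ((2 * s) * (f x * K x y)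
        - s ^+ 2 * (f x * f x)))).
      rewrite (bmf_RintegralB sphere_measure_fin); [|exact: bmfM|]; last first.
        by apply: bmfB; apply: bmfZ; exact: bmfM.
      rewrite (bmf_RintegralB sphere_measure_fin); [|by apply: bmfZ; exact: bmfM..].
      rewrite !(bmf_RintegralZ sphere_measure_fin); [|exact: bmfM..].
      by rewrite f0 mulr0 subr0 -(rep _ y Pf) -(rep _ y (PK y)).
    by apply: eq_Rintegral => x _; ring.
  by apply: Rintegral_ge0 => x _; exact: sqr_ge0.
have K0 := H 0; rewrite mulr0 mul0r subr0 in K0.
(* For this s the bound reads 0 <= - K y y - 2, contradicting K y y >= 0. *)
have := H ((K y y + 1) / f y); have [//|fy] := eqVneq (f y) 0.
by rewrite -mulrA divfK//; lra.
Qed.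

End ReproducingKernel.

Section Zonal.
Context (R : realType) (d L : nat).
Local Notation S := (sphere R d.+1).
Local Notation sval := (@sphere_val R d.+1).

(** The sphere has dimension [d.+1] so that a second coordinate exists. *)
Let i1 : 'I_d.+2 := lift ord0 ord0.

Definition plane_tuple (s u : R) : d.+2.-tuple R :=
  [tuple if i == ord0 then s else if i == i1 then u else 0 | i < d.+2].

Lemma plane_dotp s u : dotp (plane_tuple s u) (plane_tuple s u) = s ^+ 2 + u ^+ 2.
Proof.
rewrite /dotp big_ord_recl big_ord_recl big1 ?addr0 => [|i _].
  by rewrite !tnth_mktuple.
by rewrite !tnth_mktuple/= mulr0.
Qed.

Lemma plane_subproof s u : s ^+ 2 + u ^+ 2 = 1 -> enorm (plane_tuple s u) == 1.
Proof. by move=> su; rewrite enormE plane_dotp su sqrtr1. Qed.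

Definition plane_pt s u (su : s ^+ 2 + u ^+ 2 = 1) : S :=
  exist (fun x : d.+2.-tuple R => enorm x == 1) _ (plane_subproof su).

Lemma plane_monom (m : 'I_d.+2 -> nat) s u (su : s ^+ 2 + u ^+ 2 = 1) :
  monom m (plane_pt su) =
  s ^+ m ord0 * u ^+ m i1 * [forall i : 'I_d, m (lift ord0 (lift ord0 i)) == 0%N]%:R.
Proof.
rewrite /monom big_ord_recl big_ord_recl !tnth_mktuple/= mulrA; congr (_ * _).
case: forallP => H.
  by rewrite big1// => i _; rewrite (eqP (H i)) expr0.
have /existsP[i mi] : [exists i : 'I_d, m (lift ord0 (lift ord0 i)) != 0%N].
  by rewrite -negb_forall; apply/forallP.
rewrite (bigD1 i)//= tnth_mktuple/= expr0n (negbTE mi) mul0r//.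
Qed.

(* The reflections fixing the pole bring every point to the plane of the first
   two coordinates; there only even powers of the second one survive, and
   u ^ 2 = 1 - s ^ 2 eliminates them. *)
Lemma zonal_function (f : S -> R) : Pi L f ->
  (forall v, dotp (sval (pole R d.+1)) v = 0 -> forall x, f (srefl v x) = f x) ->
  exists2 k : {poly R}, (size k <= L.+1)%N &
    forall x, f x = k.[tnth (sval x) ord0].
Proof.
move=> /Pi_sum_monom[s [c [sL fE]]] finv.
pose B (m : multinom d.+2) := [forall i : 'I_d, m (lift ord0 (lift ord0 i)) == 0%N].
exists (\sum_(m <- s | B m && ~~ odd (m i1))
    c m *: ('X^(m ord0) * (1 - 'X^2) ^+ (m i1)./2)).
  apply: (leq_trans (size_sum _ _ _)); apply/bigmax_leqP_seq => m ms /andP[_ om].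
  apply: (leq_trans (size_scale_leq _ _)); apply: (leq_trans (size_polyMleq _ _)).
  rewrite size_polyXn.
  have h1 : (size ((1 - 'X^2 : {poly R}) ^+ (m i1)./2) <= (m i1).+1)%N.
    apply: (leq_trans (size_poly_exp_leq _ _)); rewrite ltnS.
    rewrite -[leqRHS](even_halfK om) -mul2n leq_mul2r; apply/orP; right.
    rewrite -subn1 leq_subLR; apply: (leq_trans (size_polyD _ _)).
    by rewrite size_poly1 size_polyN size_polyXn.
  apply: (@leq_trans (m ord0 + m i1).+1%N).
    by rewrite addSn /= -addnS leq_add2l.
  rewrite ltnS (leq_trans _ (sL m ms))// big_ord_recl big_ord_recl addnA.
  exact: leq_addr.
move=> x; set t := tnth (sval x) ord0.
have t1 : 0 <= 1 - t ^+ 2.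
  rewrite subr_ge0 -(sphere_dotp x) /dotp (bigD1 ord0)//= -expr2 lerDl.
  by apply: sumr_ge0 => j _; rewrite -expr2 sqr_ge0.
pose u := Num.sqrt (1 - t ^+ 2).
have up : t ^+ 2 + u ^+ 2 = 1 by rewrite sqr_sqrtr// addrC subrK.
have um : t ^+ 2 + (- u) ^+ 2 = 1 by rewrite sqrrN.
(* [x] and the point of the plane share their first coordinate, so the reflection exchanging them
   has its normal orthogonal to the pole and leaves [f] invariant. *)
have fp w (tw : t ^+ 2 + w ^+ 2 = 1) : f x = f (plane_pt tw).
  rewrite -(srefl_swap x (plane_pt tw)) finv// dotpBr !(dotpC (sval (pole _ _))).
  by rewrite !dotp_pole -/t tnth_mktuple subrr.
(* The mean over the second coordinates u and -u cancels the odd powers of u. *)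
have -> : f x = (f (plane_pt up) + f (plane_pt um)) / 2.
  by rewrite -!fp; field.
rewrite !fE -big_split/= horner_sum [RHS]big_mkcond mulr_suml; apply: eq_bigr => m _.
rewrite !plane_monom -/(B m) !hornerE ?hornerXn exprNn -signr_odd.
have uE : ~~ odd (m i1) -> u ^+ m i1 = (1 - t ^+ 2) ^+ (m i1)./2.
  by move=> om; rewrite -{1}(even_halfK om) -mul2n exprM sqr_sqrtr.
case: (B m); last by rewrite /= !mulr0 addr0 mul0r.
case: (boolP (odd _)) uE => [om _|om ->]//=; first by rewrite expr1; field.
by rewrite expr0; field.
Qed.

End Zonal.

(** * The Jacobi equation *)

Lemma poly_eq0_inj (R : idomainType) (f : nat -> R) (p : {poly R}) :
  injective f -> (forall n, p.[f n] = 0) -> p = 0.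
Proof.
move=> finj pf; apply/eqP; apply: contraT => p0.
have := @max_poly_roots R p [seq f i | i <- iota 0 (size p)] p0.
rewrite size_map size_iota ltnn => H; suff : false by []; apply: H.
  by apply/allP => _ /mapP[i _ ->]; apply/eqP.
by rewrite map_inj_uniq ?iota_uniq.
Qed.

(** * Moments of a coordinate on the sphere *)

Section Moments.
Context (R : realType) (d : nat).
Local Notation S := (sphere R d).
Local Notation mu := (sphere_measure R d).
Local Notation sval := (@sphere_val R d).
Local Notation mufin := (sphere_measure_fin R d).
Implicit Types p q : {poly R}.

Definition zonal_int p : R := \int[mu]_x p.[tnth (sval x) ord0].

Lemma bmf_zonal p : bmf (fun x : S => p.[tnth (sval x) ord0]).
Proof.
have := Pi_bmf (@Pi_zonal R d (size p) p (pole R d) (leqnSn _)).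
by apply: eq_bmf => x; rewrite dotp_pole.
Qed.

Lemma zonal_intD p q : zonal_int (p + q) = zonal_int p + zonal_int q.
Proof.
rewrite /zonal_int -(bmf_RintegralD mufin); [|exact: bmf_zonal..].
by apply: eq_Rintegral => x _; rewrite hornerD.
Qed.

Lemma zonal_intZ (c : R) p : zonal_int (c *: p) = c * zonal_int p.
Proof.
rewrite /zonal_int -(bmf_RintegralZ mufin); last exact: bmf_zonal.
by apply: eq_Rintegral => x _; rewrite hornerZ.
Qed.

Lemma zonal_intB p q : zonal_int (p - q) = zonal_int p - zonal_int q.
Proof. by rewrite -scaleN1r zonal_intD zonal_intZ mulN1r. Qed.

Lemma zonal_int0 : zonal_int 0 = 0.
Proof. by rewrite -(scale0r 0) zonal_intZ mul0r. Qed.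

Lemma zonal_int_le p q : (forall s, -1 <= s <= 1 -> p.[s] <= q.[s]) ->
  zonal_int p <= zonal_int q.
Proof.
move=> pq; apply: (bmf_le_Rintegral mufin); [exact: bmf_zonal..|] => x.
by apply: pq; rewrite -ler_norml coord_le1.
Qed.

Lemma zonal_int_dotp p (y : S) :
  \int[mu]_x p.[dotp (sval x) (sval y)] = zonal_int p.
Proof.
set v := tsub (sval (pole R d)) (sval y).
have b : bmf (fun x : S => p.[dotp (sval x) (sval y)]).
  exact: (Pi_bmf (Pi_zonal y (leqnSn (size p)))).
rewrite -(Rintegral_srefl v b); apply: eq_Rintegral => x _.
by rewrite -dotp_pole -(srefl_swap (pole R d) y) -/v !sval_srefl refl_dotp.
Qed.

Lemma zonal_int_dotpX j (w : d.+1.-tuple R) : enorm w != 0 ->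
  \int[mu]_x (dotp (sval x) w ^+ j) = enorm w ^+ j * zonal_int 'X^j.
Proof.
move=> w0; rewrite -(zonal_int_dotp _ (sphere_proj w)) -(bmf_RintegralZ mufin).
  apply: eq_Rintegral => x _; rewrite hornerXn sphere_projE// dotpZr -exprMn.
  by rewrite mulrA mulfV// mul1r.
exact: (Pi_bmf (Pi_zonal _ (leqnSn (size _)))).
Qed.

Lemma zonal_int_odd i : zonal_int 'X^(i.*2.+1) = 0.
Proof.
pose e0 := sval (pole R d).
have b : bmf (fun x : S => ('X^(i.*2.+1) : {poly R}).[tnth (sval x) ord0]).
  exact: bmf_zonal.
have := Rintegral_srefl e0 b; rewrite -/(zonal_int _) => E.
suff : - zonal_int 'X^(i.*2.+1) = zonal_int 'X^(i.*2.+1) by lra.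
rewrite -{2}E -mulN1r /zonal_int -(bmf_RintegralZ mufin)//.
apply: eq_Rintegral => x _; rewrite !hornerXn -!dotp_pole sval_srefl.
have -> : dotp (refl e0 (sval x)) (sval (pole R d)) = - dotp (sval x) (sval (pole R d)).
  by rewrite /refl dotpBl dotpZl /e0 sphere_dotp; field.
by rewrite exprNn -signr_odd /= odd_double/= expr1.
Qed.

Lemma coef_1X2 i : ((1 + 'X^2 : {poly R}) ^+ i)`_2 = i%:R.
Proof.
elim: i => [|i IH]; first by rewrite expr0 coefC.
rewrite exprSr mulrDr mulr1 coefD IH coefMXn /= subnn -horner_coef0 horner_exp.
by rewrite !hornerE expr0n addr0 expr1n natr1.
Qed.

(* the coefficients of e ^ 2 in
   \int (x_0 + e x_k)^(2 i) = (1 + e ^ 2)^i \int x_0 ^ (2 i) *)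
Lemma mixed_moment i (k : 'I_d) :
  'C(i.*2, 2)%:R * \int[mu]_x (tnth (sval x) ord0 ^+ (i.*2 - 2) *
     tnth (sval x) (lift ord0 k) ^+ 2) = i%:R * zonal_int 'X^(i.*2).
Proof.
pose M a : R := \int[mu]_x (tnth (sval x) ord0 ^+ (i.*2 - a) *
     tnth (sval x) (lift ord0 k) ^+ a).
have bM a : bmf (fun x : S => tnth (sval x) ord0 ^+ (i.*2 - a) *
     tnth (sval x) (lift ord0 k) ^+ a).
  have c0 := PiX (i.*2 - a) (@Pi_coord R d ord0).
  exact: (Pi_bmf (PiM c0 (PiX a (@Pi_coord R d (lift ord0 k))))).
pose P : {poly R} := \poly_(a < i.*2.+1) ('C(i.*2, a)%:R * M a).
have PE : P = zonal_int 'X^(i.*2) *: (1 + 'X^2) ^+ i.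
  apply/eqP; rewrite -subr_eq0; apply/eqP.
  (* An identity between polynomials in e: it suffices to check it at e = n for all natural n, with
     w = e_0 + n e_k, where |w|^2 = 1 + n^2. *)
  apply: (@poly_eq0_inj _ (fun n => n%:R)) => [m n /eqP|n].
    by rewrite eqr_nat => /eqP.
  set e : R := n%:R.
  pose w : d.+1.-tuple R := [tuple (j == ord0)%:R + e * (j == lift ord0 k)%:R | j < d.+1].
  have wx (x : d.+1.-tuple R) : dotp x w = tnth x ord0 + e * tnth x (lift ord0 k).
    rewrite /dotp (bigD1 ord0)//= (bigD1 (lift ord0 k))//= big1 ?addr0.
      by rewrite !tnth_mktuple/= ?eqxx/=; ring.
    move=> j /andP[/negbTE j0 /negbTE jk].
    by rewrite tnth_mktuple j0 jk mulr0 addr0 mulr0.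
  have w2 : enorm w ^+ 2 = 1 + e ^+ 2.
    by rewrite enorm_sqr wx !tnth_mktuple /= !eqxx /= ; ring.
  have w0 : enorm w != 0.
    by rewrite -sqrf_eq0 w2 gt_eqF// sqr1_gt0.
  have E : \int[mu]_x (dotp (sval x) w ^+ i.*2) =
      (1 + e ^+ 2) ^+ i * zonal_int 'X^(i.*2).
    by rewrite (zonal_int_dotpX _ w0) -w2 -exprM mul2n.
  rewrite hornerD hornerN hornerZ horner_exp !hornerE -/e [X in _ - X]mulrC -E.
  apply/eqP; rewrite subr_eq0; apply/eqP; rewrite /P horner_poly.
  transitivity (\int[mu]_x \sum_(a < i.*2.+1) ('C(i.*2, a)%:R * e ^+ a) *
      (tnth (sval x) ord0 ^+ (i.*2 - a) * tnth (sval x) (lift ord0 k) ^+ a)).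
    rewrite (bmf_Rintegral_sum mufin); last by move=> a _; exact: bmfZ.
    by apply: eq_bigr => a _; rewrite (bmf_RintegralZ mufin)// mulrAC.
  apply: eq_Rintegral => x _; rewrite wx exprDn; apply: eq_bigr => a _.
  by rewrite exprMn -mulr_natl; ring.
have := congr1 (fun p : {poly R} => p`_2) PE.
rewrite coef_poly coefZ coef_1X2 [RHS]mulrC /M.
by case: (i) => [|j] H; [rewrite bin0n !mul0r|exact: H].
Qed.

(** By [mixed_moment] at i + 1, where C(2 i + 2, 2) = (i + 1)(2 i + 1), all the integrals of x_0^(2
    i) x_k^2 are equal and known; their sum over k >= 1 is evaluated by sum_k x_k^2 = 1 - x_0^2. *)
Lemma moment_rec i : (i.*2.+1)%:R * zonal_int 'X^(i.*2) =
  (i.*2.+1 + d)%:R * zonal_int 'X^(i.+1.*2).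
Proof.
pose M (k : 'I_d) : R := \int[mu]_x (tnth (sval x) ord0 ^+ i.*2 *
     tnth (sval x) (lift ord0 k) ^+ 2).
have H k : i.*2.+1%:R * M k = zonal_int 'X^(i.+1.*2).
  have i0 : i.+1%:R != 0 :> R by rewrite pnatr_eq0.
  apply: (mulfI i0); rewrite -(mixed_moment i.+1 k) mulrA -natrM.
  congr (_%:R * _); last first.
    by apply: eq_Rintegral => x _; rewrite doubleS !subSS subn0.
  by rewrite bin2 [i.+1.*2.-1]/= -doubleMl doubleK.
have HS : \sum_k M k = zonal_int 'X^(i.*2) - zonal_int 'X^(i.+1.*2).
  rewrite /M -(bmf_Rintegral_sum mufin); last first.
    move=> k _; have c0 := PiX i.*2 (@Pi_coord R d ord0).
    exact: (Pi_bmf (PiM c0 (PiX 2 (@Pi_coord R d (lift ord0 k))))).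
  rewrite -zonal_intB; apply: eq_Rintegral => x _.
  rewrite -mulr_sumr hornerD hornerN !hornerXn doubleS -(addn2 i.*2) exprD.
  rewrite -[X in _ = X - _]mulr1 -mulrBr -(sphere_dotp x) /dotp big_ord_recl.
  rewrite -expr2 addrAC subrr add0r; congr (_ * _).
have := congr1 (fun z => i.*2.+1%:R * z) HS; rewrite /= mulr_sumr.
under eq_bigr do rewrite H.
rewrite sumr_const card_ord => E.
by rewrite natrD mulrDl [X in _ = _ + X]mulr_natl E; ring.
Qed.

(* The law of x_0 has density proportional to (1 - s^2)^(d / 2 - 1), so this is
   \int ((1 - s^2)^(d / 2) p)' ds = 0; it is proved here through moments. *)
Lemma zonal_int_div p :
  zonal_int ((1 - 'X^2) * p^`() - d%:R *: ('X * p)) = 0.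
Proof.
pose F p := zonal_int ((1 - 'X^2) * p^`() - d%:R *: ('X * p)).
have FX n : F 'X^n = 0.
  have -> : F 'X^n = n%:R * zonal_int 'X^(n.-1) - (n + d)%:R * zonal_int 'X^(n.+1).
    rewrite -!zonal_intZ -zonal_intB; congr zonal_int.
    rewrite derivXn natrD scalerDl opprD addrA; congr (_ - _ *: _); last first.
      by rewrite exprS.
    case: n => [|m]; first by rewrite !mulr0n mulr0 !scale0r subr0.
    rewrite [m.+1.-1]/= -scaler_nat -scalerAr -scalerBr; congr (_ *: _).
    by rewrite mulrBl mul1r -exprD.
  case: n => [|n]; first by rewrite (zonal_int_odd 0) mul0r mulr0 subr0.
  rewrite [n.+1.-1]/=; have := odd_double_half n; case: (odd n) => /= <-.
    by rewrite add1n -doubleS !zonal_int_odd !mulr0 subr0.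
  by rewrite add0n (moment_rec n./2) doubleS subrr.
rewrite -[p]coefK poly_def.
have FD q r : F (q + r) = F q + F r.
  by rewrite /F -zonal_intD derivD !mulrDr scalerDr; congr zonal_int; ring.
have FZ (c : R) q : F (c *: q) = c * F q.
  by rewrite /F -zonal_intZ derivZ; congr zonal_int; rewrite -!mul_polyC; ring.
rewrite -/(F _); elim/big_rec: _ => [|i x _ Fx].
  by rewrite /F deriv0 !mulr0 scaler0 subr0 zonal_int0.
by rewrite FD FZ FX mulr0 add0r.
Qed.

End Moments.

Lemma size_1subX (R : realType) : size (1 - 'X : {poly R}) = 2%N.
Proof. by rewrite -opprB size_polyN -(polyC1 R) size_XsubC. Qed.

Section KernelPolynomial.
Context (R : realType) (d L : nat) (K : sphere R d.+1 -> sphere R d.+1 -> R).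
Hypothesis rK : reproducing_kernel L K.
Local Notation S := (sphere R d.+1).
Local Notation mu := (sphere_measure R d.+1).
Local Notation sval := (@sphere_val R d.+1).
Local Notation mufin := (sphere_measure_fin R d.+1).
Local Notation zint := (@zonal_int R d.+1).
Local Notation D := (d.+1%:R : R).
Implicit Types p q : {poly R}.

Lemma kernel_zonal : exists2 k : {poly R}, (size k <= L.+1)%N &
  forall x y, K x y = k.[dotp (sval x) (sval y)].
Proof.
have [PK _] := rK; pose e0 := pole R d.+1.
have [|k kL kE] := zonal_function (PK e0).
  move=> v v0 x; rewrite -[RHS](kernel_srefl v rK); congr K.
  by apply: sphere_val_inj; rewrite sval_srefl refl_fix.
exists k => // x y; set v := tsub (sval y) (sval e0).
rewrite -(kernel_srefl v rK) srefl_swap kE -dotp_pole.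
rewrite -[in RHS](refl_dotp v (sval x)) -!sval_srefl.
by rewrite -/e0 /v srefl_swap.
Qed.

Variable k : {poly R}.
Hypothesis kL : (size k <= L.+1)%N.
Hypothesis kE : forall x y, K x y = k.[dotp (sval x) (sval y)].

(** The reproducing property at the pole, for zonal functions about the pole. *)
Lemma zint_kernel p : (size p <= L.+1)%N -> zint (p * k) = p.[1].
Proof.
move=> pL; have [_ rep] := rK; pose e0 := pole R d.+1.
have := rep _ e0 (Pi_zonal e0 pL); rewrite sphere_dotp => ->.
by apply: eq_Rintegral => x _; rewrite kE hornerM !dotp_pole.
Qed.

(** By [Pi_definite], [p] vanishes at the first coordinate of every point; the values 1 / (n + 1)
    are infinitely many such coordinates. *)
Lemma zint_definite p : (size p <= L.+1)%N -> zint (p ^+ 2) = 0 -> p = 0.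
Proof.
move=> pL p20.
have Pp : Pi L (fun x : S => p.[tnth (sval x) ord0]).
  by apply: eq_Pi (Pi_zonal (pole R d.+1) pL) => x; rewrite dotp_pole.
have p0 := Pi_definite rK Pp _.
have {}p0 (y : S) : p.[tnth (sval y) ord0] = 0.
  by apply: p0; rewrite -p20; apply: eq_Rintegral => x _; rewrite horner_exp expr2.
apply: (@poly_eq0_inj _ (fun n => n.+1%:R^-1)) => [m n /invr_inj/eqP|n].
  by rewrite eqr_nat => /eqP[].
set s : R := n.+1%:R^-1.
have s01 : 0 <= s <= 1 by rewrite invr_ge0 ler0n invf_le1 ?ler1n ?ltr0n.
have s2 : s ^+ 2 + Num.sqrt (1 - s ^+ 2) ^+ 2 = 1.
  by rewrite sqr_sqrtr ?subr_ge0 ?exprn_ile1//; [ring|lra|lra].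
by have := p0 (plane_pt d s2); rewrite tnth_mktuple.
Qed.

(** The Jacobi operator with parameters D / 2 and D / 2 - 1. The first exceeds the exponent D / 2 -
    1 of the coordinate law by one: this is the extra weight 1 - s under which the operator is
    symmetric. *)
Definition jacobi_op p : {poly R} :=
  (1 - 'X^2) * p^`()^`() - (1 + (D + 1)%:P * 'X) * p^`().

Lemma coef_jacobi_op p j : (jacobi_op p)`_j =
  (j.+2 * j.+1)%:R * p`_j.+2 - j.+1%:R * p`_j.+1 - (j * (j + d.+1))%:R * p`_j.
Proof.
rewrite /jacobi_op mulrBl mul1r mulrDl mul1r -mulrA !coefB coefD coefCM.
rewrite (mulrC 'X^2) (mulrC 'X) coefMXn coefMX !coef_deriv.
have nat_l (x : R) n : x *+ n = n%:R * x by rewrite mulr_natl.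
case: j => [|[|j]] /=; rewrite ?coef_deriv.
- by rewrite !(nat_l p`_ _); ring.
- by rewrite !(nat_l p`_ _) nat_l; ring.
rewrite subn2/= !(nat_l p`_ _) !(nat_l (_ * _)) !natrM !natrD -!natr1.
move: p`_j.+4 p`_j.+3 p`_j.+2 (j%:R) (d%:R) => a b c u v; ring.
Qed.

Lemma size_jacobi_op p n : (size p <= n)%N -> (size (jacobi_op p) <= n)%N.
Proof.
move=> pn; apply/leq_sizeP => j nj; rewrite coef_jacobi_op.
by rewrite !(leq_sizeP _ _ pn) ?mulr0 ?subr0// ?(leq_trans nj)// -addn2 leq_addr.
Qed.

(** The difference of the integrands is (1 - s^2) r' - D s r with r the Wronskian times 1 - s, and
    [zonal_int_div] integrates it to 0. *)
Lemma jacobi_op_sym p q :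
  zint ((1 - 'X) * (q * jacobi_op p)) = zint ((1 - 'X) * (p * jacobi_op q)).
Proof.
apply/eqP; rewrite -subr_eq0 -zonal_intB; apply/eqP.
pose r : {poly R} := (1 - 'X) * (q * p^`() - p * q^`()).
rewrite -(@zonal_int_div R d.+1 r); congr zonal_int.
rewrite /r /jacobi_op !(derivM, derivB, derivX, derivC) -mul_polyC polyCD.
ring.
Qed.

(** The eigenvalue cancels the leading term, so [E] has degree less than L. Against any q of degree
    less than L, the weight 1 - s and symmetry move the operator onto q; the kernel then evaluates a
    polynomial of degree at most L at s = 1, where 1 - s vanishes. Finally q = [E] is allowed. *)
Lemma jacobi_eq : jacobi_op k + (L * (L + d.+1))%:R *: k = 0.
Proof.
set E := _ + _.
have EL : (size E <= L)%N.
  have k0 n : (L < n)%N -> k`_n = 0 by move=> Ln; exact: (leq_sizeP _ _ kL).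
  apply/leq_sizeP => j Lj; rewrite coefD coefZ coef_jacobi_op.
  rewrite (k0 j.+1) ?ltnS// (k0 j.+2) ?ltnS ?leqW// !mulr0 subr0 sub0r.
  have [->|jL] := eqVneq j L; first by rewrite addNr.
  by rewrite (k0 j) ?mulr0 ?oppr0 ?addr0// ltn_neqAle eq_sym jL.
have q0 q : (size q <= L)%N -> zint ((1 - 'X) * (q * E)) = 0.
  move=> qL; rewrite /E mulrDr mulrDr zonal_intD jacobi_op_sym -zonal_intD.
  have -> : (1 - 'X) * (k * jacobi_op q) + (1 - 'X) * (q * ((L * (L + d.+1))%:R *: k)) =
     ((1 - 'X) * (jacobi_op q + (L * (L + d.+1))%:R *: q)) * k.
    by rewrite -!mul_polyC; ring.
  rewrite zint_kernel; first by rewrite !hornerE subrr mul0r.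
  apply: (leq_trans (size_polyMleq _ _)).
  have s2 : (size (jacobi_op q + (L * (L + d.+1))%:R *: q)%R <= L)%N.
    apply: (leq_trans (size_polyD _ _)); rewrite geq_max size_jacobi_op//=.
    exact: (leq_trans (size_scale_leq _ _)).
  by rewrite size_1subX -subn1 leq_subLR add1n addSn add1n !ltnS.
have := q0 E EL; rewrite -expr2 => E2.
have s1E : (size ((1 - 'X) * E)%R <= L.+1)%N.
  apply: (leq_trans (size_polyMleq _ _)).
  by rewrite size_1subX -subn1 leq_subLR add1n addSn add1n !ltnS.
have : (1 - 'X) * E = 0.
  (* [zint_definite] needs a square: on [-1, 1], ((1 - s) E)^2 <= 2 (1 - s) E^2, and the right side
     integrates to 0. *)
  apply: zint_definite => //; apply/eqP; rewrite eq_le; apply/andP; split.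
    rewrite -(mulr0 2) -E2 -zonal_intZ; apply: zonal_int_le => s s1.
    rewrite hornerZ horner_exp !hornerM ?horner_exp hornerD hornerN hornerX hornerC.
    have /andP[s1l s1r] := s1; rewrite -subr_ge0.
    set z := (X in 0 <= X); have -> : z = (1 - s) * (1 + s) * E.[s] ^+ 2 by rewrite /z; ring.
    by rewrite mulr_ge0 ?sqr_ge0// mulr_ge0; lra.
  by apply: Rintegral_ge0 => x _; rewrite horner_exp sqr_ge0.
move/eqP; rewrite mulf_eq0 => /orP[|/eqP//].
by rewrite -oppr_eq0 opprB -(polyC1 R) polyXsubC_eq0.
Qed.

End KernelPolynomial.

(** * The pointwise bound on the kernel *)

Section AlternatingSum.
Context (R : realFieldType).

Lemma alternating_sum (c : nat -> R) N :
  (forall j, 0 <= c j) -> (forall j, c j.+1 <= c j) ->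
  0 <= \sum_(j < N) (-1) ^+ j * c j <= c 0%N.
Proof.
elim: N c => [|N IH] c c0 cd; first by rewrite big_ord0 lexx c0.
rewrite big_ord_recl expr0 mul1r.
have -> : \sum_(i < N) (-1) ^+ bump 0 i * c (bump 0 i) =
    - \sum_(i < N) (-1) ^+ i * c i.+1.
  by rewrite -sumrN; apply: eq_bigr => i _; rewrite /bump/= add1n exprS mulN1r mulNr.
have /andP[H1 H2] := IH (fun j => c j.+1) (fun j => c0 j.+1) (fun j => cd j.+1).
by have := cd 0%N; lra.
Qed.

End AlternatingSum.

Section JacobiCoefficients.
Context (R : realType) (d L : nat).
Local Notation D := d.+1.

(** Up to sign, the ratio of consecutive coefficients of the hypergeometric function F(-L, L + D; D
    / 2 + 1; v). The subtraction [L - j] is truncated, so the ratio is 0 from j = L on and the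
    series terminates. *)
Definition jac_ratio j : R :=
  (2 * (L - j) * (L + j + D))%:R / (j.+1 * (2 * j + D + 2))%:R.

Fixpoint jac_coef j : R :=
  if j is i.+1 then jac_coef i * jac_ratio i else 1.

Lemma jac_ratio_ge0 j : 0 <= jac_ratio j.
Proof. by rewrite divr_ge0. Qed.

Lemma jac_coef_ge0 j : 0 <= jac_coef j.
Proof. by elim: j => //= j IH; rewrite mulr_ge0 ?jac_ratio_ge0. Qed.

Lemma jac_poly_coef (k : {poly R}) : (size k <= L.+1)%N ->
  jacobi_op d k + (L * (L + D))%:R *: k = 0 ->
  forall j, (k \Po (1 - 2%:P * 'X))`_j = k.[1] * ((-1) ^+ j * jac_coef j).
Proof.
move=> kL kE; set c : {poly R} := 1 - 2%:P * 'X; set y := k \Po c.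
have c' : c^`() = - 2%:P by rewrite /c !(derivM, derivB, derivX, derivC); ring.
have y1 : y^`() = (k^`() \Po c) * - 2%:P by rewrite /y deriv_comp c'.
have y2 : y^`()^`() = (k^`()^`() \Po c) * 4%:P.
  rewrite y1 derivM derivN derivC oppr0 mulr0 addr0 deriv_comp c' -mulrA; congr (_ * _).
  by rewrite mulrNN -polyCM; congr (_%:P); ring.
(* Twice the Jacobi equation at s = 1 - 2 v, which avoids the halves of D; comparing coefficients of
   v^j leaves a two-term recurrence. *)
have ode : 2%:P * ('X * (1 - 'X)) * y^`()^`() +
    ((D%:R + 2)%:P - (2 * (D%:R + 1))%:P * 'X) * y^`() + (2 * (L * (L + D))%:R)%:P * y = 0.
  have := congr1 (fun p => 2%:P * (p \Po c)) kE.
  rewrite comp_poly0 mulr0 => <-; rewrite /jacobi_op y2 y1 (expr2 'X).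
  rewrite !(comp_polyB, comp_polyD, comp_polyM, comp_polyC, comp_polyX, comp_polyZ) -/y.
  rewrite -mul_polyC.
  rewrite !(polyCM, polyCD, polyC_natr, polyC1) /c; ring.
have rec j : (j.+1%:R * (2 * j%:R + D%:R + 2)) * y`_j.+1 =
    - (2 * L%:R * (L%:R + D%:R) - 2 * j%:R * (j%:R + D%:R)) * y`_j.
  have := congr1 (fun p : {poly R} => p`_j) ode.
  have -> : 2%:P * ('X * (1 - 'X)) * y^`()^`() +
    ((D%:R + 2)%:P - (2 * (D%:R + 1))%:P * 'X) * y^`() + (2 * (L * (L + D))%:R)%:P * y =
    2%:P * (y^`()^`() * 'X - y^`()^`() * 'X^2) +
    (D%:R + 2)%:P * y^`() - (2 * (D%:R + 1))%:P * (y^`() * 'X) + (2 * (L * (L + D))%:R)%:P * y.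
    by ring.
  rewrite !(coefD, coefN, coefCM, coefMX, coefMXn, coef_deriv, coef0).
  have nat_l (x : R) n : x *+ n = n%:R * x by rewrite mulr_natl.
  case: j => [|[|j]] /=; rewrite ?subn2 /= ?coef_deriv.
  - rewrite !(nat_l y`_ _) => E; apply/eqP; rewrite -subr_eq0 -[X in _ == X]E.
    by apply/eqP; rewrite !natrM !natrD; ring.
  - rewrite !(nat_l y`_ _) !(nat_l (_ * _)) => E; apply/eqP; rewrite -subr_eq0 -[X in _ == X]E.
    by apply/eqP; rewrite !natrM !natrD; ring.
  rewrite !(nat_l y`_ _) !(nat_l (_ * _)) => E; apply/eqP; rewrite -subr_eq0 -[X in _ == X]E.
  apply/eqP; rewrite !natrM !natrD -(natr1 j.+2) -(natr1 j.+1) -(natr1 j).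
  ring.
have c1 : c.[0] = 1 by rewrite /c !hornerE ?mulr0 ?subr0.
have y0 : y`_0 = k.[1] by rewrite -horner_coef0 /y horner_comp c1.
have ys : (size y <= L.+1)%N.
  have sc : (size c <= 2)%N.
    apply: (leq_trans (size_polyD _ _)); rewrite geq_max size_poly1 size_polyN mul_polyC.
    by rewrite (leq_trans (size_scale_leq _ _))// size_polyX.
  apply: (leq_trans (size_comp_poly_leq _ _)); rewrite ltnS -[L]muln1.
  by apply: leq_mul; rewrite -subn1 leq_subLR add1n.
elim=> [|j IH]; first by rewrite y0 expr0 /= !mulr1.
(* From j = L on both sides vanish, the left by the degree of [y] and the right by the truncated
   subtraction. *)
have [jL|Lj] := leqP L j.
  have -> : y`_j.+1 = 0 by apply: (leq_sizeP _ _ ys).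
  have Lj0 : (L - j = 0)%N by apply/eqP; rewrite subn_eq0.
  by rewrite /= /jac_ratio Lj0 muln0 mul0n mul0r !mulr0.
have n0 : (j.+1 * (2 * j + D + 2))%:R != 0 :> R by rewrite pnatr_eq0 muln_eq0 addnC.
have nE : (j.+1 * (2 * j + D + 2))%:R = j.+1%:R * (2 * j%:R + D%:R + 2) :> R.
  by rewrite -(natrM _ 2) -!natrD -natrM.
apply: (mulfI n0); rewrite [X in X * _ = _]nE rec IH [jac_coef j.+1]/= /jac_ratio exprS.
set a := jac_coef j; set e := (-1) ^+ j; set n := (j.+1 * (2 * j + D + 2))%:R in n0 *.
have -> : (2 * (L - j) * (L + j + D))%:R =
    2 * L%:R * (L%:R + D%:R) - 2 * j%:R * (j%:R + D%:R) :> R.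
  rewrite !natrM (natrB _ (ltnW Lj)) !natrD; ring.
move: (2 * L%:R * (L%:R + D%:R) - _) n n0 => m n n0.
by field.
Qed.

Lemma jac_horner (k : {poly R}) (s : R) : (size k <= L.+1)%N ->
  jacobi_op d k + (L * (L + D))%:R *: k = 0 ->
  k.[s] = k.[1] * \sum_(j < L.+1) (-1) ^+ j * (jac_coef j * ((1 - s) / 2) ^+ j).
Proof.
move=> kL kE; have yE := jac_poly_coef kL kE.
set c : {poly R} := 1 - 2%:P * 'X in yE; set y := k \Po c in yE.
have sc : (size c <= 2)%N.
  apply: (leq_trans (size_polyD _ _)); rewrite geq_max size_poly1 size_polyN mul_polyC.
  by rewrite (leq_trans (size_scale_leq _ _))// size_polyX.
have ys : (size y <= L.+1)%N.
  apply: (leq_trans (size_comp_poly_leq _ _)); rewrite ltnS -[L]muln1.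
  by apply: leq_mul; rewrite -subn1 leq_subLR add1n.
have -> : k.[s] = y.[(1 - s) / 2].
  rewrite /y horner_comp; congr k.[_].
  by rewrite /c hornerD hornerN hornerM hornerX !hornerC; field.
rewrite (horner_coef_wide _ ys) mulr_sumr; apply: eq_bigr => j _.
by rewrite yE !mulrA.
Qed.

(** For 2 <= j < L the numerator is at most 2 L (2 L + D), and the denominator (j + 1)(2 j + D + 2)
    is smallest at j = 2, where it equals 3 (D + 6): this is the origin of D + 6 in the bound on the
    distance. *)
Lemma jac_ratio_bound j : (2 <= j)%N ->
  jac_ratio j <= 2 * L%:R * (2 * L%:R + D%:R) / (3 * (D%:R + 6)).
Proof.
move=> j2; have [Lj|jL] := leqP L j.
  have Lj0 : (L - j = 0)%N by apply/eqP; rewrite subn_eq0.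
  rewrite /jac_ratio Lj0 muln0 mul0n mul0r divr_ge0// ?mulr_ge0 ?addr_ge0//.
rewrite /jac_ratio ler_pM//.
  rewrite -!natrM -natrD -natrM ler_nat; nia.
rewrite lef_pV2 ?posrE ?ltr0n ?muln_gt0 ?addn_gt0// -?natrD -?natrM ?ler_nat ?ltr0n; nia.
Qed.

Lemma jac_terms_ge0 (v : R) j : 0 <= v -> 0 <= jac_coef j * v ^+ j.
Proof. by move=> v0; rewrite mulr_ge0 ?exprn_ge0// jac_coef_ge0. Qed.

Lemma jac_terms_decr (v : R) j : 0 <= v ->
  2 * L%:R * (2 * L%:R + D%:R) * v <= 3 * (D%:R + 6) -> (2 <= j)%N ->
  jac_coef j.+1 * v ^+ j.+1 <= jac_coef j * v ^+ j.
Proof.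
move=> v0 H j2; rewrite [jac_coef j.+1]/= exprSr mulrACA ler_piMr ?jac_terms_ge0//.
have h0 : 0 < 3 * (D%:R + 6) :> R by rewrite -natrD -natrM ltr0n.
apply: (@le_trans _ _ (2 * L%:R * (2 * L%:R + D%:R) / (3 * (D%:R + 6)) * v)).
  by rewrite ler_wpM2r// jac_ratio_bound.
by rewrite mulrAC ler_pdivrMr// mul1r.
Qed.

Lemma jac_tail_ge0 (v : R) m N : 0 <= v ->
  2 * L%:R * (2 * L%:R + D%:R) * v <= 3 * (D%:R + 6) -> (2 <= m)%N ->
  0 <= \sum_(j < N) (-1) ^+ j * (jac_coef (m + j) * v ^+ (m + j)).
Proof.
move=> v0 H m2.
pose c j := jac_coef (m + j) * v ^+ (m + j).
have c0 j : 0 <= c j by exact: jac_terms_ge0.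
have cd j : c j.+1 <= c j.
  by rewrite /c addnS; apply: jac_terms_decr => //; rewrite (leq_trans m2)// leq_addr.
by have /andP[] := alternating_sum N c0 cd.
Qed.

(** As [m] is even, the discarded tail starts with a plus sign; its terms decrease since [m] >= 2,
    so it is nonnegative. *)
Lemma jac_lower (v : R) m : 0 <= v ->
  2 * L%:R * (2 * L%:R + D%:R) * v <= 3 * (D%:R + 6) -> (2 <= m <= L.+1)%N -> ~~ odd m ->
  \sum_(j < m) (-1) ^+ j * (jac_coef j * v ^+ j) <=
  \sum_(j < L.+1) (-1) ^+ j * (jac_coef j * v ^+ j).
Proof.
move=> v0 H /andP[m2 mL] om; rewrite -!(big_mkord xpredT (fun j => (-1) ^+ j * (jac_coef j * v ^+ j))).
rewrite [leRHS](@big_cat_nat _ _ _ m)//= lerDl -{1}(add0n m) big_addn big_mkord.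
have := jac_tail_ge0 (L.+1 - m) v0 H m2.
under eq_bigr => j _.
  rewrite addnC -[(-1) ^+ j]mulr1 -[X in _ * X * _](_ : (-1) ^+ m = 1); last first.
    by rewrite -signr_odd (negbTE om).
  rewrite -exprD; over.
by [].
Qed.

End JacobiCoefficients.

Section PointwiseBound.
Context (R : realType) (d L : nat).
Local Notation D := d.+1.
Hypothesis L1 : (1 <= L)%N.
Hypothesis DL : (D, L) <> (1%N, 1%N).
Variable T : R.
Hypothesis T0 : 0 <= T.
Hypothesis hT : T <= (D%:R + 6) / ((2 * L%:R + D%:R) * L%:R).

Let L1R : 1 <= L%:R :> R. Proof. by rewrite ler1n. Qed.
Let D1R : 1 <= D%:R :> R. Proof. by rewrite ler1n. Qed.

Lemma radius_mul : T * ((2 * L%:R + D%:R) * L%:R) <= D%:R + 6.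
Proof.
by rewrite -ler_pdivlMr// mulr_gt0//; have := L1R; have := D1R; lra.
Qed.

(** D = L = 1 is the only case where (D + 6) / ((2 L + D) L) exceeds the diameter 2 of the
    sphere. *)
Lemma radius_le2 : T <= 2.
Proof.
apply: (le_trans hT).
have DLpos : 0 < (2 * L%:R + D%:R) * L%:R :> R.
  by rewrite mulr_gt0//; have := L1R; have := D1R; lra.
rewrite ler_pdivrMr//.
rewrite -natrM -!natrD -!natrM ler_nat.
have [L2|] := leqP 2 L; first by nia.
rewrite ltnS => Ll1; have L1' : L = 1%N by apply/eqP; rewrite eqn_leq Ll1.
case: d DL => [|d'] DL'; first by rewrite L1' in DL'.
by rewrite L1'; lia.
Qed.

(** The hypothesis on [T] yields both T L <= 6 and T (2 L + D) <= D + 6; the claim is half the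
    product of these. *)
Lemma radius_sqr : 2 * L%:R * (2 * L%:R + D%:R) * (T ^+ 2 / 4) <= 3 * (D%:R + 6).
Proof.
have h := radius_mul; have h1 := L1R; have h2 := D1R.
set l : R := L%:R in h h1 *; set u : R := D%:R in h h2 *.
have Tl : T * (2 * l + u) <= u + 6.
  apply: le_trans h; rewrite ler_wpM2l// ler_peMr//; lra.
have TT : T * l * (T * (2 * l + u)) <= 2 * l * (u + 6).
  apply: ler_pM => //; rewrite ?mulr_ge0//; try lra.
  by rewrite ler_wpM2r ?radius_le2//; lra.
have T3 : T * l <= 6.
  apply: (@le_trans _ _ (T * ((2 * l + u) * l) / (2 * l + u))).
    by rewrite mulrCA mulrAC mulfV ?mul1r// gt_eqF//; lra.
  by rewrite ler_pdivrMr; lra.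
have -> : 2 * l * (2 * l + u) * (T ^+ 2 / 4) = (T * l * (T * (2 * l + u))) / 2 by field.
have : T * l * (T * (2 * l + u)) <= 6 * (u + 6).
  by apply: ler_pM => //; rewrite ?mulr_ge0//; lra.
lra.
Qed.

Lemma jac_coef1 : jac_coef R d L 1 = 2 * L%:R * (L%:R + D%:R) / (D%:R + 2).
Proof.
rewrite /= mul1r /jac_ratio subn0 addn0 mul1n muln0 add0n.
by rewrite !natrM !natrD.
Qed.

Lemma jac_ge1B (v : R) : 0 <= v -> v <= T ^+ 2 / 4 ->
  1 - jac_coef R d L 1 * v <= \sum_(j < L.+1) (-1) ^+ j * (jac_coef R d L j * v ^+ j).
Proof.
move=> v0 vT; apply: le_trans (@jac_lower R d L v 2 v0 _ _ _) => //.
- rewrite !big_ord_recl big_ord0 /bump /= !expr0 !expr1 !mul1r addr0 mulN1r.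
  by rewrite lexx.
- apply: le_trans radius_sqr; rewrite ler_wpM2l// mulr_ge0//; have := L1R; have := D1R; lra.
Qed.

Lemma chord_v t : (1 - sg t) / 2 = chord t ^+ 2 / 4 :> R.
Proof. by rewrite chord_sqr; field. Qed.

Lemma rho_chord t : rho t ^+ 2 = chord t ^+ 2 * (1 - chord t ^+ 2 / 4) :> R.
Proof. by rewrite rho_sg chord_sqr; field. Qed.

(** Write k(s) = k(1) q and A = [jac_coef R d L 1]; the constant in the bound is A / 2. For D >= 2
    it comes from 1 - q^2 <= 2 (1 - q) <= 2 A v = (A / 2) chord^2. *)
Lemma kernel_pointwise (k : {poly R}) t : (size k <= L.+1)%N ->
  jacobi_op d k + (L * (L + D))%:R *: k = 0 -> chord t <= T ->
  (k.[1] ^+ 2 - k.[sg t] ^+ 2) * rho t ^+ D.+1 <=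
  k.[1] ^+ 2 * (L%:R * (L%:R + D%:R) / (D%:R + 2)) * chord_dens D t.
Proof.
move=> kL kE cT; rewrite (@jac_horner R d L k (sg t) kL kE) chord_v.
set v := chord t ^+ 2 / 4; set q := \sum_(j < _) _; set A := jac_coef R d L 1.
have c0 := chord_gt0 t; have r0 := rho_gt0 t.
have c0w := ltW c0; have r0w := ltW r0.
have v0 : 0 <= v by rewrite divr_ge0// exprn_ge0// ltW.
have vT : v <= T ^+ 2 / 4 by rewrite ler_pM2r// ?invr_gt0// lerXn2r// ?nnegrE// ltW.
have qA := jac_ge1B v0 vT; rewrite -/A -/q in qA.
have AE : L%:R * (L%:R + D%:R) / (D%:R + 2) = A / 2.
  by rewrite /A jac_coef1; field; have := D1R; rewrite gt_eqF//; lra.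
rewrite AE exprMn -{1}(mulr1 (k.[1] ^+ 2)) -mulrBr -[leLHS]mulrA -[leRHS]mulrA.
rewrite ler_wpM2l ?sqr_ge0//.
have A0 : 0 <= A by exact: jac_coef_ge0.
(* In dimension D >= 2, [rho <= chord] absorbs the weight. On the circle the
   square of the lower bound on [q] is kept, to gain a factor sqrt(1 - v). *)
have [d0|d0] := posnP d; last first.
  have q2 : 1 - q ^+ 2 <= A / 2 * chord t ^+ 2.
    have -> : A / 2 * chord t ^+ 2 = 2 * (A * v) by rewrite /v; field.
    by have := sqr_ge0 (1 - q); rewrite sqrrB !expr1n; lra.
  apply: (@le_trans _ _ (A / 2 * chord t ^+ 2 * rho t ^+ D.+1)).
    by rewrite ler_wpM2r// exprn_ge0// ltW.
  rewrite -mulrA ler_wpM2l ?divr_ge0// /chord_dens.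
  case: (d) d0 => // d' _.
  have -> : rho t ^+ d'.+3 = rho t ^+ d' * rho t ^+ 3 by rewrite -exprD addn3.
  have -> : chord t ^+ d'.+2 = chord t ^+ 2 * chord t ^+ d' by rewrite -exprD.
  rewrite -[leRHS]mulrA ler_wpM2l ?exprn_ge0// ler_wpM2r ?exprn_ge0//.
  by rewrite lerXn2r ?nnegrE// rho_le_chord.
(* On the circle the excluded case leaves L >= 2. Hence A = 2 L (L + 1) / 3 >= 4, and 2 L + 1 >= 5
   gives T L <= 7/5, T (L + 1) <= 21/10 and A v <= 49/100, so that 1 - A v <= q may be squared. *)
have L2 : (2 <= L)%N.
  by case: L L1 DL => [|[|l]] //; rewrite d0.
have L2R : 2 <= L%:R :> R by rewrite (ler_nat _ 2).
have D1 : D%:R = 1 :> R by rewrite d0.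
have h := radius_mul; rewrite D1 in h.
have AE1 : A = 2 * L%:R * (L%:R + 1) / 3.
  by rewrite /A jac_coef1 D1; congr (_ / _); ring.
move: L2R h AE1; set l : R := L%:R => L2R h AE1.
have A4 : 4 <= A by rewrite AE1 ler_pdivlMr//; nra.
have Tl : T * l <= 7 / 5.
  have : T * l * 5 <= T * ((2 * l + 1) * l).
    have -> : T * ((2 * l + 1) * l) = T * l * (2 * l + 1) by ring.
    by rewrite ler_wpM2l ?mulr_ge0//; lra.
  lra.
have Tl1 : T * (l + 1) <= 21 / 10.
  have : T * 2 <= T * l by rewrite ler_wpM2l.
  lra.
have A1 : A * v <= 1.
  apply: (@le_trans _ _ (A * (T ^+ 2 / 4))); first by rewrite ler_wpM2l.
  have -> : A * (T ^+ 2 / 4) = (T * l) * (T * (l + 1)) / 6 by rewrite AE1; field.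
  have : (T * l) * (T * (l + 1)) <= 7 / 5 * (21 / 10).
    by apply: ler_pM => //; rewrite mulr_ge0//; lra.
  lra.
have qp : 0 <= 1 - A * v by lra.
have q2 : 1 - q ^+ 2 <= 2 * (A * v) - (A * v) ^+ 2.
  have : (1 - A * v) ^+ 2 <= q ^+ 2 by rewrite lerXn2r ?nnegrE// (le_trans qp).
  by rewrite sqrrB expr1n; lra.
have v1 : v <= 1.
  by apply: (le_trans vT); have := radius_le2; have := T0; nra.
rewrite /chord_dens d0 expr1.
have -> : A / 2 * (chord t * rho t ^+ 3) = (A / 2 * (chord t * rho t)) * rho t ^+ 2 by ring.
rewrite ler_wpM2r ?sqr_ge0//; apply: (le_trans q2).
(* chord * rho = 4 v sqrt(1 - v), and (1 - v) (2 + v) / 2 is a polynomial minorant of sqrt(1 - v) on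
   [0, 1] with the same first-order expansion at 0. *)
have s1 : 2 * v * ((1 - v) * (2 + v)) <= chord t * rho t.
  rewrite -(ler_pXn2r (ltn0Sn 1)) ?nnegrE ?mulr_ge0 ?(ltW c0) ?(ltW r0)//; try lra.
  rewrite [X in _ <= X]exprMn rho_chord -/v.
  have -> : chord t ^+ 2 = 4 * v by rewrite /v; field.
  have -> : (2 * v * ((1 - v) * (2 + v))) ^+ 2 =
     4 * v ^+ 2 * (1 - v) * ((1 - v) * (2 + v) ^+ 2) by ring.
  have -> : 4 * v * (4 * v * (1 - v)) = 4 * v ^+ 2 * (1 - v) * 4 by ring.
  rewrite ler_wpM2l//; first by rewrite !mulr_ge0 ?sqr_ge0//; lra.
  have -> : (1 - v) * (2 + v) ^+ 2 = 4 - (3 * v ^+ 2 + v ^+ 3) by ring.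
  by rewrite lerBlDr lerDl addr_ge0 ?mulr_ge0 ?exprn_ge0.
apply: (@le_trans _ _ (A / 2 * (2 * v * ((1 - v) * (2 + v))))); last first.
  by rewrite ler_wpM2l// divr_ge0.
(* The loss of order A v^2 from the minorant is covered by the retained square (A v)^2, since A >= 4
   > 1 + v. *)
rewrite -subr_ge0.
have -> : A / 2 * (2 * v * ((1 - v) * (2 + v))) - (2 * (A * v) - (A * v) ^+ 2) =
  A * v * (v * (A - 1 - v)) by field.
by rewrite !mulr_ge0//; lra.
Qed.

End PointwiseBound.

(** * Two-point integrals of determinants *)

Section BoundedFubini.
Context d1 d2 (T1 : measurableType d1) (T2 : measurableType d2) (R : realType).
Variables (m1 : {sigma_finite_measure set T1 -> \bar R})
          (m2 : {sigma_finite_measure set T2 -> \bar R}).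
Hypotheses (fin1 : (m1 setT < +oo)%E) (fin2 : (m2 setT < +oo)%E).
Implicit Type f : T1 * T2 -> R.

Lemma product_measure_fin : ((m1 \x m2)%E setT < +oo)%E.
Proof.
rewrite -setXTT product_measure1E// lte_mul_pinfty// ge0_fin_numE//.
Qed.

Lemma bmf_sectionl f x : bmf f -> bmf (fun y => f (x, y)).
Proof. by move=> bf; apply: (bmf_comp _ bf); exact: measurable_fun_pair. Qed.

Lemma bmf_sectionr f y : bmf f -> bmf (fun x => f (x, y)).
Proof. by move=> bf; apply: (bmf_comp _ bf); exact: measurable_fun_pair. Qed.

Lemma Rintegral_bound (M : R) (g : T2 -> R) : bmf g -> (forall y, `|g y| <= M) ->
  `|\int[m2]_y g y| <= M * fine (m2 setT).
Proof.
move=> bg gM; rewrite -(@Rintegral_cst _ _ _ m2)//.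
apply: le_trans (le_normr_Rintegral measurableT (bmf_integrable fin2 bg)) _.
apply: (bmf_le_Rintegral fin2) => //.
  have [mg [N gN]] := bg; split; last by exists N => x; rewrite normr_id.
  exact: measurableT_comp.
exact: bmf_cst.
Qed.

Lemma bmf_partial f : bmf f -> bmf (fun x => \int[m2]_y f (x, y)).
Proof.
move=> bf; have [mf [M fM]] := bf; split.
  have := measurable_fubini_F (bmf_integrable product_measure_fin bf).
  rewrite /fubini_F; under [X in measurable_fun _ X]eq_fun.
    by move=> x; rewrite (bmf_RintegralE fin2 (bmf_sectionl x bf)); over.
  by move/measurable_EFinP.
exists (M * fine (m2 setT)) => x; apply: Rintegral_bound; first exact: bmf_sectionl.
by move=> y; exact: fM.
Qed.

Lemma bmf_fubini1 f : bmf f ->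
  \int[(m1 \x m2)%E]_z f z = \int[m1]_x \int[m2]_y f (x, y).
Proof.
move=> bf; have If := bmf_integrable product_measure_fin bf.
rewrite {1}/Rintegral -integral12_prod_meas1// /Rintegral; congr fine.
apply: eq_integral => x _; rewrite /fubini_F.
by rewrite (bmf_RintegralE fin2 (bmf_sectionl x bf)).
Qed.

End BoundedFubini.

Lemma bmf_swap d1 d2 (T1 : measurableType d1) (T2 : measurableType d2) (R : realType)
    (m1 : {sigma_finite_measure set T1 -> \bar R})
    (m2 : {sigma_finite_measure set T2 -> \bar R}) (f : T1 * T2 -> R) :
  (m1 setT < +oo)%E -> (m2 setT < +oo)%E -> bmf f ->
  \int[m1]_x \int[m2]_y f (x, y) = \int[m2]_y \int[m1]_x f (x, y).
Proof.
move=> fin1 fin2 bf; have If := bmf_integrable (product_measure_fin fin1 fin2) bf.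
have := Fubini If; rewrite /Rintegral => E; congr fine.
transitivity (\int[m1]_x \int[m2]_y (f (x, y))%:E)%E.
  apply: eq_integral => x _.
  by rewrite -(bmf_RintegralE fin2 (bmf_sectionl x bf)).
rewrite E; apply: eq_integral => y _.
by rewrite (bmf_RintegralE fin1 (bmf_sectionr y bf)).
Qed.

Section PowerIntegral.
Context dT (T : measurableType dT) (R : realType).
Variable mu : {sigma_finite_measure set T -> \bar R}.
Hypothesis fin : (mu setT < +oo)%E.

Lemma power_measure_fin n : (power_measure mu n setT < +oo)%E.
Proof.
have -> : [set: n.-tuple T] = box setT by apply/seteqP; split.
rewrite power_measure_box//; elim: n => [|n IH]; first by rewrite expe0 ltry.
by rewrite expeS lte_mul_pinfty// ge0_fin_numE.
Qed.

Lemma bmf_tnth n (f : T -> R) (i : 'I_n) : bmf f -> bmf (fun w : n.-tuple T => f (tnth w i)).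
Proof. by apply: bmf_comp; exact: measurable_tnth. Qed.

Lemma Rintegral_power0 (f : 0.-tuple T -> R) :
  \int[power_measure mu 0]_w f w = f [tuple].
Proof.
rewrite /Rintegral.
have -> : (fun w : 0.-tuple T => (f w)%:E) = cst (f [tuple])%:E.
  by apply/funext => w; congr (f _)%:E; exact: tuple0.
by rewrite integral_dirac// diracT mul1e.
Qed.

Lemma bmf_cons n (f : n.+1.-tuple T -> R) : bmf f ->
  bmf (fun p : T * n.-tuple T => f (cons_pair p)).
Proof. by apply: bmf_comp; exact: measurable_cons_pair. Qed.

Lemma Rintegral_powerS n (f : n.+1.-tuple T -> R) : bmf f ->
  \int[power_measure mu n.+1]_w f w =
  \int[mu]_x \int[power_measure mu n]_w f (cons_pair (x, w)).
Proof.
move=> bf; have bc := bmf_cons bf.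
rewrite -(bmf_fubini1 fin (power_measure_fin n) bc) /Rintegral; congr fine.
have mc := @measurable_cons_pair _ T n.
have mf : measurable_fun setT (EFin \o f) by apply/measurable_EFinP; case: bf.
have If : (mu \x power_measure mu n)%E.-integrable (@cons_pair _ T n @^-1` setT)
    ((EFin \o f) \o @cons_pair _ T n).
  by rewrite preimage_setT; apply: (bmf_integrable (product_measure_fin fin (power_measure_fin n)) bc).
have := integral_pushforward mc mf If measurableT.
by rewrite preimage_setT.
Qed.

Lemma prod_cons n (g : 'I_n.+1 -> T -> R) x (w : n.-tuple T) :
  \prod_k g k (tnth (cons_pair (x, w)) k) =
  g ord0 x * \prod_k g (lift ord0 k) (tnth w k).
Proof.
rewrite big_ord_recl tnth0; congr (_ * _); apply: eq_bigr => k _.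
by rewrite tnthS.
Qed.

Lemma bmf_prod_tnth n (g : 'I_n -> T -> R) : (forall k, bmf (g k)) ->
  bmf (fun w : n.-tuple T => \prod_k g k (tnth w k)).
Proof. by move=> bg; apply: bmf_prod => k _; exact: bmf_tnth. Qed.

Lemma Rintegral_power_prod n (g : 'I_n -> T -> R) : (forall k, bmf (g k)) ->
  \int[power_measure mu n]_w \prod_k g k (tnth w k) = \prod_k \int[mu]_x g k x.
Proof.
elim: n g => [|n IH] g bg.
  by rewrite Rintegral_power0 !big_ord0.
rewrite (Rintegral_powerS (bmf_prod_tnth bg)) big_ord_recl.
under eq_Rintegral => x _.
  under eq_Rintegral => w _ do rewrite prod_cons.
  rewrite (bmf_RintegralZ (power_measure_fin n)); last first.
    exact: (bmf_prod_tnth (fun k => bg (lift ord0 k))).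
  rewrite (IH _ (fun k => bg (lift ord0 k))).
  rewrite mulrC; over.
by rewrite (bmf_RintegralZ fin)// mulrC.
Qed.

Lemma Rintegral_power_prod1 n (g : 'I_n -> T -> R) (V : T -> R) (j : 'I_n) :
  (forall k, bmf (g k)) -> bmf V ->
  \int[power_measure mu n]_w (V (tnth w j) * \prod_k g k (tnth w k)) =
  (\prod_(k | k != j) \int[mu]_x g k x) * \int[mu]_y (V y * g j y).
Proof.
move=> bg bV; pose g' k x := if k == j then V x * g k x else g k x.
have bg' k : bmf (g' k) by rewrite /g'; case: eqP => // _; exact: bmfM.
transitivity (\int[power_measure mu n]_w \prod_k g' k (tnth w k)).
  apply: eq_Rintegral => w _; rewrite [in RHS](bigD1 j)//= [in LHS](bigD1 j)//=.
  rewrite /g' eqxx mulrA; congr (_ * _).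
  by apply: eq_bigr => k /negbTE ->.
rewrite Rintegral_power_prod// (bigD1 j)//= mulrC; congr (_ * _).
  by apply: eq_bigr => k kj; apply: eq_Rintegral => x _; rewrite /g' (negbTE kj).
by apply: eq_Rintegral => x _; rewrite /g' eqxx.
Qed.

(** Induction on [n], integrating out the first coordinate. Either it is an ordinary factor, or it
    is coordinate i; then [W (x, _)] weights the single coordinate j and [Rintegral_power_prod1]
    applies. *)
Lemma Rintegral_power_prod2 n (g : 'I_n -> T -> R) (W : T * T -> R) (i j : 'I_n) :
  (forall k, bmf (g k)) -> bmf W -> (i < j)%N ->
  \int[power_measure mu n]_w (W (tnth w i, tnth w j) * \prod_k g k (tnth w k)) =
  (\prod_(k | (k != i) && (k != j)) \int[mu]_x g k x) *
  \int[mu]_x \int[mu]_y (W (x, y) * (g i x * g j y)).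
Proof.
elim: n g i j => [|n IH] g i j bg bW; first by case: i.
have bWt (n' : nat) (a b : 'I_n') : bmf (fun w : n'.-tuple T => W (tnth w a, tnth w b)).
  by apply: bmf_comp bW; apply: measurable_fun_pair; exact: measurable_tnth.
have bt (n' : nat) (g' : 'I_n' -> T -> R) : (forall k, bmf (g' k)) ->
    bmf (fun w : n'.-tuple T => \prod_k g' k (tnth w k)) by exact: bmf_prod_tnth.
have [j' ->|->] := unliftP ord0 j; last by rewrite ltn0.
have bgl k : bmf (g (lift ord0 k)) by exact: bg.
have [i' ->|->] := unliftP ord0 i => ij.
  rewrite Rintegral_powerS; last by apply: bmfM; [exact: bWt|exact: (bt _ _ bg)].
  under eq_Rintegral => x _.
    under eq_Rintegral => w _ do rewrite prod_cons !tnthS mulrCA.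
    rewrite (bmf_RintegralZ (power_measure_fin n)); last first.
      by apply: bmfM; [exact: bWt|exact: (bt _ _ bgl)].
    rewrite (IH (fun k => g (lift ord0 k)))// mulrC; over.
  rewrite (bmf_RintegralZ fin)// [in RHS]big_mkcond big_ord_recl /= mulrC mulrA; congr (_ * _ * _).
  rewrite [in LHS]big_mkcond; apply: eq_bigr => k _.
  by rewrite !(inj_eq (@lift_inj _ ord0)).
rewrite Rintegral_powerS; last by apply: bmfM; [exact: bWt|exact: (bt _ _ bg)].
have bWx x : bmf (fun y => W (x, y)).
  by apply: bmf_comp bW; exact: measurable_fun_pair.
under eq_Rintegral => x _.
  under eq_Rintegral => w _ do rewrite prod_cons tnth0 tnthS mulrCA.
  rewrite (bmf_RintegralZ (power_measure_fin n)); last first.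
    by apply: bmfM; [exact: (bmf_tnth j' (bWx x))|exact: (bt _ _ bgl)].
  rewrite (Rintegral_power_prod1 j' bgl (bWx x)) mulrCA; over.
have bWg : bmf (fun p : T * T => W p * (g ord0 p.1 * g (lift ord0 j') p.2)).
  apply: bmfM => //; apply: bmfM.
    exact: (bmf_comp measurable_fst (bg ord0)).
  exact: (bmf_comp measurable_snd (bg (lift ord0 j'))).
rewrite (bmf_RintegralZ fin); last first.
  apply: eq_bmf (bmf_partial fin fin bWg) => x /=.
  under eq_Rintegral => y _ do rewrite mulrCA.
  by rewrite (bmf_RintegralZ fin)//; exact: bmfM.
congr (_ * _).
  by rewrite [in RHS]big_mkcond big_ord_recl eqxx /= mul1r [in LHS]big_mkcond; apply: eq_bigr => k _.
apply: eq_Rintegral => x _; rewrite -(bmf_RintegralZ fin); last exact: bmfM.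
by apply: eq_Rintegral => y _; rewrite mulrCA.
Qed.

End PowerIntegral.

(** * Expansion of the determinant against a weight on two coordinates *)

Section TwoPoint.
Context dT (T : measurableType dT) (R : realType).
Variable mu : {sigma_finite_measure set T -> \bar R}.
Hypothesis fin : (mu setT < +oo)%E.
Variables (n : nat) (b b' : 'I_n -> T -> R).
Hypotheses (bb : forall a, bmf (b a)) (bb' : forall a, bmf (b' a)).
Hypothesis biorth : forall a c, \int[mu]_x (b a x * b' c x) = (a == c)%:R.
Variable W : T * T -> R.
Hypothesis bW : bmf W.
Hypothesis symW : forall x y, W (x, y) = W (y, x).

Definition pair_kernel (x y : T) : R := \sum_a b a x * b' a y.

(** The identity term minus the transposition term when two coordinates carry the indices a and c;
    summing over a and c produces K x x K y y - K x y K y x under the integral. *)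
Definition pair_int (a c : 'I_n) : R :=
  \int[mu]_x \int[mu]_y (W (x, y) *
    (b a x * b c y * (b' a x * b' c y - b' c x * b' a y))).

Lemma perm_fix2 (i j : 'I_n) (p : {perm 'I_n}) : i != j ->
  (forall k, k != i -> k != j -> p k = k) -> p = 1%g \/ p = tperm i j.
Proof.
move=> ij fixp.
have pi : p i = i \/ p i = j.
  have [->|pi1] := eqVneq (p i) i; first by left.
  have [->|pi2] := eqVneq (p i) j; first by right.
  by have := fixp _ pi1 pi2 => /perm_inj E; rewrite E eqxx in pi1.
have pj : p j = i \/ p j = j.
  have [->|pi1] := eqVneq (p j) i; first by left.
  have [->|pi2] := eqVneq (p j) j; first by right.
  by have := fixp _ pi1 pi2 => /perm_inj E; rewrite E eqxx in pi2.
case: pi => pi; [left|right]; apply/permP => k.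
  rewrite perm1; have [->//|ki] := eqVneq k i; have [->|kj] := eqVneq k j.
    by case: pj => // pj; move: ij; rewrite -(inj_eq (@perm_inj _ p)) pi pj eqxx.
  exact: fixp.
have [->|ki] := eqVneq k i; first by rewrite tpermL.
have [->|kj] := eqVneq k j.
  rewrite tpermR; case: pj => // pj.
  by move: ij; rewrite -(inj_eq (@perm_inj _ p)) pi pj eqxx.
by rewrite tpermD 1?eq_sym// fixp.
Qed.

(** The matrix factors as [B *m B'^T], so its determinant is a product of two permutation sums.
    Writing the second permutation as [p] followed by [s] leaves only the sign of [p]. *)
Lemma det_pair_kernel (w : n.-tuple T) :
  \det (\matrix_(i, j) pair_kernel (tnth w i) (tnth w j)) =
  \sum_(s : {perm 'I_n}) \sum_(p : {perm 'I_n}) (-1) ^+ p *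
    \prod_k (b (s k) (tnth w k) * b' (s (p k)) (tnth w k)).
Proof.
pose B := \matrix_(i, a) b a (tnth w i).
pose B' := \matrix_(i, a) b' a (tnth w i).
have -> : \matrix_(i, j) pair_kernel (tnth w i) (tnth w j) = B *m B'^T.
  by apply/matrixP => i j; rewrite !mxE; apply: eq_bigr => a _; rewrite !mxE.
rewrite det_mulmx det_tr /determinant mulr_suml; apply: eq_bigr => s _.
rewrite (reindex_inj (mulIg s)) mulr_sumr; apply: eq_bigr => p _.
rewrite odd_permM signr_addb mulrACA [X in X * _](_ : _ = (-1) ^+ p); last first.
  by rewrite mulrCA -signr_addb addbb mulr1.
congr (_ * _); rewrite -big_split; apply: eq_bigr => k _ /=.
by rewrite !mxE permM.
Qed.

(* Biorthogonality kills all permutations but the identity and the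
   transposition of i and j. *)
Lemma two_point_pair (i j : 'I_n) : (i < j)%N ->
  \int[power_measure mu n]_w (W (tnth w i, tnth w j) *
    \det (\matrix_(k, l) pair_kernel (tnth w k) (tnth w l))) =
  \sum_(s : {perm 'I_n}) pair_int (s i) (s j).
Proof.
move=> ij; have ijn : i != j by rewrite -val_eqE ltn_eqF.
pose g (s p : {perm 'I_n}) k x := b (s k) x * b' (s (p k)) x.
have bg s p k : bmf (g s p k) by exact: bmfM.
have bWt : bmf (fun w : n.-tuple T => W (tnth w i, tnth w j)).
  by apply: bmf_comp bW; apply: measurable_fun_pair; exact: measurable_tnth.
have bP s p : bmf (fun w : n.-tuple T => W (tnth w i, tnth w j) * \prod_k g s p k (tnth w k)).
  by apply: bmfM => //; exact: bmf_prod_tnth.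
transitivity (\int[power_measure mu n]_w \sum_(s : {perm 'I_n}) \sum_(p : {perm 'I_n})
    (-1) ^+ p * (W (tnth w i, tnth w j) * \prod_k g s p k (tnth w k))).
  apply: eq_Rintegral => w _; rewrite det_pair_kernel mulr_sumr; apply: eq_bigr => s _.
  by rewrite mulr_sumr; apply: eq_bigr => p _; rewrite mulrCA.
rewrite (bmf_Rintegral_sum (power_measure_fin fin n)); last first.
  by move=> s _; apply: bmf_sum => p _; exact: bmfZ.
apply: eq_bigr => s _.
rewrite (bmf_Rintegral_sum (power_measure_fin fin n)); last by move=> p _; exact: bmfZ.
pose q (p : {perm 'I_n}) : R := \int[mu]_x \int[mu]_y (W (x, y) * (g s p i x * g s p j y)).
have pE (p : {perm 'I_n}) : \int[power_measure mu n]_w ((-1) ^+ p * (W (tnth w i, tnth w j) *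
    \prod_k g s p k (tnth w k))) =
    (-1) ^+ p * ((\prod_(k | (k != i) && (k != j)) (k == p k)%:R) * q p).
  rewrite (bmf_RintegralZ (power_measure_fin fin n))// Rintegral_power_prod2//.
  congr (_ * (_ * _)); apply: eq_bigr => k _; rewrite biorth.
  by rewrite (inj_eq (@perm_inj _ s)).
under eq_bigr do rewrite pE.
have p1 : \prod_(k | (k != i) && (k != j)) ((k == (1%g : {perm 'I_n}) k)%:R : R) = 1.
  by rewrite big1// => k _; rewrite perm1 eqxx.
have pt : \prod_(k | (k != i) && (k != j)) ((k == tperm i j k)%:R : R) = 1.
  by rewrite big1// => k /andP[ki kj]; rewrite tpermD 1?eq_sym// eqxx.
have t1 : tperm i j != 1%g.
  apply/eqP => /permP/(_ i); rewrite tpermL perm1 => /eqP.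
  by rewrite eq_sym (negbTE ijn).
rewrite (bigD1 1%g isT)/= (bigD1 (tperm i j) t1)/= p1 pt big1 ?addr0; last first.
  move=> p /andP[pn1 pnt].
  suff [k kij pk] : exists2 k, (k != i) && (k != j) & k != p k.
    by rewrite (bigD1 k)//= (negbTE pk) mul0r mul0r mulr0.
  have [/existsP[k /andP[kij pk]]|] := boolP [exists k, ((k != i) && (k != j)) && (k != p k)].
    by exists k.
  rewrite negb_exists => /forallP H; exfalso.
  have [|pE1|pE1] := @perm_fix2 i j p ijn.
  - by move=> k ki kj; apply/esym/eqP; have := H k; rewrite ki kj /= negbK.
  - by rewrite pE1 eqxx in pn1.
  - by rewrite pE1 eqxx in pnt.
rewrite odd_perm1 odd_tperm ijn expr0 expr1 !mul1r mulN1r.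
have bq (p : {perm 'I_n}) : bmf (fun z : T * T => W z * (g s p i z.1 * g s p j z.2)).
  apply: bmfM => //; apply: bmfM.
    exact: (bmf_comp measurable_fst (bg s p i)).
  exact: (bmf_comp measurable_snd (bg s p j)).
rewrite /q -(bmf_RintegralB fin); last 2 first.
- exact: (bmf_partial fin fin (bq 1%g)).
- exact: (bmf_partial fin fin (bq (tperm i j))).
apply: eq_Rintegral => x _; rewrite -(bmf_RintegralB fin); last 2 first.
- exact: (bmf_sectionl x (bq 1%g)).
- exact: (bmf_sectionl x (bq (tperm i j))).
apply: eq_Rintegral => y _; rewrite /g !perm1 tpermL tpermR; ring.
Qed.

Lemma bmf_pair_int a c : bmf (fun z : T * T => W z *
    (b a z.1 * b c z.2 * (b' a z.1 * b' c z.2 - b' c z.1 * b' a z.2))).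
Proof.
have b1 e : bmf (fun z : T * T => b e z.1) by exact: (bmf_comp measurable_fst).
have b2 e : bmf (fun z : T * T => b e z.2) by exact: (bmf_comp measurable_snd).
have b1' e : bmf (fun z : T * T => b' e z.1) by exact: (bmf_comp measurable_fst).
have b2' e : bmf (fun z : T * T => b' e z.2) by exact: (bmf_comp measurable_snd).
apply: bmfM => //; apply: bmfM; first exact: bmfM.
by apply: bmfB; exact: bmfM.
Qed.

Lemma pair_intC a c : pair_int a c = pair_int c a.
Proof.
rewrite /pair_int (bmf_swap fin fin (bmf_pair_int a c)) /=.
apply: eq_Rintegral => y _; apply: eq_Rintegral => x _.
by rewrite symW; ring.
Qed.

Lemma pair_int0 a : pair_int a a = 0.
Proof.
rewrite /pair_int; under eq_Rintegral => x _.
  under eq_Rintegral => y _ do rewrite subrr !mulr0.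
  rewrite Rintegral_cst// mul0r; over.
by rewrite Rintegral_cst// mul0r.
Qed.

(** The two-point terms are symmetric in i, j and vanish for i = j, so the sum over i < j is half of
    the sum over all pairs. In the latter each permutation merely relabels the indices, whence the
    factor n!. *)
Theorem two_point_sum :
  \sum_(i < n) \sum_(j < n | (i < j)%N) \int[power_measure mu n]_w (W (tnth w i, tnth w j) *
    \det (\matrix_(k, l) pair_kernel (tnth w k) (tnth w l))) =
  n`!%:R / 2 * \int[mu]_x \int[mu]_y (W (x, y) *
    (pair_kernel x x * pair_kernel y y - pair_kernel x y * pair_kernel y x)).
Proof.
pose H (i j : 'I_n) := \sum_(s : {perm 'I_n}) pair_int (s i) (s j).
transitivity (\sum_(i < n) \sum_(j < n | (i < j)%N) H i j).
  by apply: eq_bigr => i _; apply: eq_bigr => j ij; exact: two_point_pair.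
have HC i j : H i j = H j i by apply: eq_bigr => s _; exact: pair_intC.
have H0 i : H i i = 0 by rewrite /H big1// => s _; exact: pair_int0.
have double : \sum_i \sum_j H i j = 2 * \sum_(i < n) \sum_(j < n | (i < j)%N) H i j.
  have E (i : 'I_n) : \sum_j H i j = \sum_(j < n | (i < j)%N) H i j + \sum_(j < n | (j < i)%N) H i j.
    rewrite (bigID (fun j : 'I_n => (i < j)%N))/=; congr (_ + _).
    rewrite (bigD1 i) ?ltnn//= H0 add0r; apply: eq_bigl => j.
    by rewrite -leqNgt ltn_neqAle andbC.
  rewrite (eq_bigr _ (fun i _ => E i)) big_split /=.
  have -> : \sum_(i < n) \sum_(j < n | (j < i)%N) H i j = \sum_(i < n) \sum_(j < n | (i < j)%N) H i j.
    under eq_bigr => i _ do rewrite big_mkcond.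
    under [RHS]eq_bigr => i _ do rewrite big_mkcond.
    rewrite exchange_big /=; apply: eq_bigr => j _; apply: eq_bigr => i _.
    by case: ifP => _; [exact (HC _ _)|exact: erefl].
  by rewrite mulr_natl mulr2n.
have total : \sum_i \sum_j H i j = n`!%:R * \sum_a \sum_c pair_int a c.
  rewrite /H; under eq_bigr do rewrite exchange_big.
  rewrite exchange_big /=.
  transitivity (\sum_(s : {perm 'I_n}) \sum_a \sum_c pair_int a c).
    apply: eq_bigr => s _; rewrite [RHS](reindex_inj (@perm_inj _ s)).
    by apply: eq_bigr => i _; rewrite [RHS](reindex_inj (@perm_inj _ s)).
  rewrite sumr_const -[LHS]mulr_natl; congr (_%:R * _).
  by rewrite -card_Sn; apply: eq_card => s.
have -> : \sum_(i < n) \sum_(j < n | (i < j)%N) H i j = n`!%:R / 2 * \sum_a \sum_c pair_int a c.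
  by rewrite mulrAC -total double; field.
congr (_ * _).
have bp a c := bmf_pair_int a c.
transitivity (\sum_a \int[mu]_x \int[mu]_y \sum_c (W (x, y) *
    (b a x * b c y * (b' a x * b' c y - b' c x * b' a y)))).
  apply: eq_bigr => a _; rewrite -(bmf_Rintegral_sum fin); last first.
    by move=> c _; exact: (bmf_partial fin fin (bp a c)).
  apply: eq_Rintegral => x _; rewrite -(bmf_Rintegral_sum fin)// => c _.
  exact: (bmf_sectionl x (bp a c)).
have bs a : bmf (fun z : T * T => \sum_c (W z *
    (b a z.1 * b c z.2 * (b' a z.1 * b' c z.2 - b' c z.1 * b' a z.2)))).
  by apply: bmf_sum => c _; exact: bp.
rewrite -(bmf_Rintegral_sum fin); last first.
  by move=> a _; exact: (bmf_partial fin fin (bs a)).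
apply: eq_Rintegral => x _; rewrite -(bmf_Rintegral_sum fin); last first.
  by move=> a _; exact: (bmf_sectionl x (bs a)).
apply: eq_Rintegral => y _.
rewrite /pair_kernel [X in _ * (X - _)]mulr_suml [X in _ * (_ - X)]mulr_suml -sumrB mulr_sumr.
apply: eq_bigr => a _; rewrite -mulr_sumr; congr (_ * _).
rewrite !mulr_sumr -sumrB; apply: eq_bigr => c _; ring.
Qed.

End TwoPoint.

(** * The dimension of the space of polynomial functions *)

Section HasDim.
Context (R : realType) (T : Type).
Implicit Types V : set (T -> R).

Lemma has_dim_family V (I : finType) (b : I -> T -> R) :
  (forall i, V (b i)) ->
  (forall f, V f -> exists c : I -> R, forall x, f x = \sum_i c i * b i x) ->
  (forall c : I -> R, (forall x, \sum_i c i * b i x = 0) -> c =1 fun=> 0) ->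
  has_dim V #|I|.
Proof.
move=> Vb span free; exists (fun i => b (enum_val i)) => [i|f /span[c fE]].
  exact: Vb.
have reE (e : I -> R) x : \sum_i e i * b i x = \sum_(i < #|I|) e (enum_val i) * b (enum_val i) x.
  exact: (reindex enum_val (onW_bij _ (enum_val_bij I))).
exists (\row_i c (enum_val i)); split.
  by move=> x; rewrite fE reE; apply: eq_bigr => i _; rewrite mxE.
move=> c' c'E; apply/rowP => i; rewrite mxE.
have /free/(_ (enum_val i)) : forall x, \sum_i (c i - c' 0 (enum_rank i)) * b i x = 0.
  move=> x; under eq_bigr do rewrite mulrBl; rewrite sumrB -fE c'E reE.
  by under [X in _ - X]eq_bigr do rewrite enum_valK; rewrite subrr.
by rewrite enum_valK => /eqP; rewrite subr_eq0 => /eqP.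
Qed.

(** Express each family in the other: uniqueness of coordinates makes the product of the two
    coefficient matrices the identity of size [n], which bounds [n] by the inner size [m]. *)
Lemma has_dim_le V n m : has_dim V n -> has_dim V m -> (n <= m)%N.
Proof.
move=> [b Vb bV] [b' Vb' b'V].
have /choice[A AE] : forall i, exists c : 'rV[R]_m, forall x, b i x = \sum_j c 0 j * b' j x.
  by move=> i; have [c [cE _]] := b'V _ (Vb i); exists c.
have /choice[B BE] : forall j, exists c : 'rV[R]_n, forall x, b' j x = \sum_i c 0 i * b i x.
  by move=> j; have [c [cE _]] := bV _ (Vb' j); exists c.
apply: (@mulmx1_min _ _ _ (\matrix_(i, j) A i 0 j) (\matrix_(j, i) B j 0 i)).
apply/row_matrixP => i.
have [c [_ cU]] := bV _ (Vb i); rewrite -(cU (row i 1%:M)); last first.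
  move=> x; rewrite (bigD1 i)//= !mxE eqxx mul1r big1 ?addr0// => k ki.
  by rewrite !mxE eq_sym (negbTE ki) mul0r.
apply/esym/cU => x; rewrite AE.
under eq_bigr do rewrite BE mulr_sumr.
rewrite exchange_big; apply: eq_bigr => k _; rewrite !mxE mulr_suml.
by apply: eq_bigr => j _; rewrite !mxE mulrA.
Qed.

Lemma has_dim_inj V n m : has_dim V n -> has_dim V m -> n = m.
Proof. by move=> Vn Vm; apply/anti_leq; rewrite !(@has_dim_le V). Qed.

End HasDim.

(** Uniqueness of digits in base N; it keeps distinct monomials distinct under the Kronecker
    substitution of [sphere_basis_free]. *)
Lemma sum_expn_inj N d (e e' : 'I_d -> nat) :
  (forall i, e i < N)%N -> (forall i, e' i < N)%N ->
  (\sum_i e i * N ^ i = \sum_i e' i * N ^ i)%N -> e =1 e'.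
Proof.
elim: d e e' => [|d IH] e e' eN e'N; first by move=> _ [].
rewrite !big_ord_recl !expn0 !muln1.
have E (f : 'I_d.+1 -> nat) : (\sum_(i < d) f (lift ord0 i) * N ^ (lift ord0 i) =
   (\sum_(i < d) f (lift ord0 i) * N ^ i) * N)%N.
  by rewrite big_distrl; apply: eq_bigr => i _ /=; rewrite -mulnA -expnSr.
rewrite !E => H.
have N0 : (0 < N)%N by apply: leq_ltn_trans (eN ord0).
have e0 : e ord0 = e' ord0.
  by have := congr1 (modn ^~ N) H; rewrite /= !(addnC (_ ord0)) !modnMDl !modn_small.
have eS : e \o lift ord0 =1 e' \o lift ord0.
  apply: IH => [i|i|]; rewrite /= ?eN ?e'N//.
  by move: H; rewrite e0 => /addnI/eqP; rewrite eqn_pmul2r// => /eqP.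
by move=> i; case: (unliftP ord0 i) => [j|] ->; [exact: eS|].
Qed.

(** Exponents of the monomials of degree at most L in d variables, in the encoding counted by
    [card_partial_ord_partitions]. *)
Definition bounded_exponent d L :=
  {t : d.-tuple 'I_L.+1 | (\sum_(i <- t) i <= L)%N}.

Lemma card_bounded_exponent d L : #|{: bounded_exponent d L}| = 'C(d + L, d).
Proof. by rewrite card_sig -card_partial_ord_partitions cardsE. Qed.

Section Basis.
Context (R : realType) (d : nat).
Local Notation S := (sphere R d).
Local Notation sval := (@sphere_val R d).

Definition tail_monom (e : 'I_d -> nat) (x : S) : R :=
  \prod_i tnth (sval x) (lift ord0 i) ^+ e i.

Definition expo L (t : bounded_exponent d L) (i : 'I_d) : nat := tnth (val t) i.

Lemma expo_lt L (t : bounded_exponent d L) i : (expo t i < L.+1)%N.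
Proof. exact: ltn_ord. Qed.

Lemma expo_sum L (t : bounded_exponent d L) : (\sum_i expo t i <= L)%N.
Proof. by have := valP t; rewrite big_tuple. Qed.

Lemma expo_inj L (t t' : bounded_exponent d L) : expo t =1 expo t' -> t = t'.
Proof. by move=> E; apply/val_inj/eq_from_tnth => i; apply/val_inj/E. Qed.

Lemma expoP L (e : 'I_d -> nat) : (\sum_i e i <= L)%N ->
  exists t : bounded_exponent d L, expo t =1 e.
Proof.
move=> eL; have ei i : (e i < L.+1)%N.
  by rewrite ltnS; apply: leq_trans eL; rewrite (bigD1 i)//= leq_addr.
pose t := [tuple Ordinal (ei i) | i < d].
have tL : (\sum_(i <- t) i <= L)%N.
  by rewrite big_tuple; under eq_bigr do rewrite tnth_mktuple.
by exists (exist _ t tL) => i; rewrite /expo /= tnth_mktuple.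
Qed.

Lemma monom_tail (e : 'I_d.+1 -> nat) x :
  monom e x = tnth (sval x) ord0 ^+ e ord0 * tail_monom (e \o lift ord0) x.
Proof. by rewrite /monom big_ord_recl. Qed.

(** Normal forms modulo the equation of the sphere, which eliminates x_0^2: monomials in x_1, ...,
    x_d of degree at most L + 1, and x_0 times those of degree at most L. *)
Definition sphere_basis L
    (a : bounded_exponent d L.+1 + bounded_exponent d L) (x : S) : R :=
  match a with
  | inl t => tail_monom (expo t) x
  | inr t => tnth (sval x) ord0 * tail_monom (expo t) x
  end.

Lemma Pi_sphere_basis L (a : bounded_exponent d L.+1 + bounded_exponent d L) :
  Pi L.+1 (sphere_basis a).
Proof.
have H (k : nat) (e : 'I_d -> nat) : (k + \sum_i e i <= L.+1)%N ->
    Pi L.+1 (fun x : S => tnth (sval x) ord0 ^+ k * tail_monom e x).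
  move=> ke; pose e' i := if unlift ord0 i is Some j then e j else k.
  have : (\sum_i e' i <= L.+1)%N.
    rewrite big_ord_recl /e' unlift_none; under eq_bigr do rewrite liftK.
    exact: ke.
  move/(@Pi_monom R d); apply: eq_Pi => x.
  rewrite monom_tail /e' unlift_none; congr (_ * _).
  by apply: eq_bigr => i _; rewrite /= liftK.
case: a => t /=.
  apply: eq_Pi (H 0%N (expo t) _); first by move=> x; rewrite mul1r.
  by rewrite add0n expo_sum.
apply: eq_Pi (H 1%N (expo t) _); first by [].
by rewrite add1n ltnS expo_sum.
Qed.

Definition in_span L (f : S -> R) := exists c, forall x,
  f x = \sum_a c a * @sphere_basis L a x.

Lemma eq_in_span L f g : f =1 g -> in_span L f -> in_span L g.
Proof. by move=> /funext ->. Qed.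

Lemma in_span_sum L (I : eqType) (s : seq I) (c : I -> R) (F : I -> S -> R) :
  (forall i, i \in s -> in_span L (F i)) ->
  in_span L (fun x => \sum_(i <- s) c i * F i x).
Proof.
elim: s => [|i s IH] H.
  by exists (fun=> 0) => x; rewrite big_nil big1// => a _; rewrite mul0r.
have [e eE] := H i (mem_head _ _).
have [|e' e'E] := IH; first by move=> j js; apply: H; rewrite inE js orbT.
exists (fun a => c i * e a + e' a) => x; rewrite big_cons e'E eE mulr_sumr -big_split.
by apply: eq_bigr => a _ /=; rewrite mulrDl mulrA.
Qed.

Lemma sphere_coord0_sqr (x : S) :
  tnth (sval x) ord0 ^+ 2 = 1 - \sum_i tnth (sval x) (lift ord0 i) ^+ 2.
Proof.
have := sphere_dotp x; rewrite /dotp big_ord_recl => <-.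
by rewrite -expr2 -[X in _ - X]/(\sum_i _ * _) addrK.
Qed.

(* x_0 ^ 2 = 1 - |x'| ^ 2 on the sphere *)
Lemma in_span_monom L k (e : 'I_d -> nat) : (k + \sum_i e i <= L.+1)%N ->
  in_span L (fun x => tnth (sval x) ord0 ^+ k * tail_monom e x).
Proof.
elim/ltn_ind: k e => -[|[|k]] IH e ke.
- have [t tE] := expoP ke; exists (fun a => (a == inl t)%:R) => x.
  rewrite (bigD1 (inl t))//= eqxx big1 ?addr0 ?mul1r; last first.
    by move=> a /negbTE ->; rewrite mul0r.
  by rewrite /tail_monom; under [RHS]eq_bigr do rewrite tE.
- have [t tE] := expoP (ke : (\sum_i e i <= L)%N).
  exists (fun a => (a == inr t)%:R) => x.
  rewrite (bigD1 (inr t))//= eqxx big1 ?addr0 ?mul1r; last first.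
    by move=> a /negbTE ->; rewrite mul0r.
  by rewrite /tail_monom; under [in RHS]eq_bigr do rewrite tE.
pose e' (i : option 'I_d) (j : 'I_d) := (e j + (i == Some j) * 2)%N.
pose c (i : option 'I_d) : R := if i is Some _ then -1 else 1.
apply: (@eq_in_span _ (fun x => \sum_(i < d.+1) c (unlift ord0 i) *
    (tnth (sval x) ord0 ^+ k * tail_monom (e' (unlift ord0 i)) x))); last first.
  apply: in_span_sum => i0 _; apply: IH => //; move: (unlift ord0 i0) => {i0} i.
  rewrite /e' big_split /= addnA.
  have : (\sum_(j < d) (i == Some j) * 2 <= 2)%N.
    case: i => [i|]; last by rewrite big1.
    rewrite (bigD1 i)//= eqxx mul1n big1// => j ji.
    by rewrite (inj_eq Some_inj) eq_sym (negbTE ji).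
  move=> le2; apply: leq_trans (leq_add (leqnn _) le2) _.
  by rewrite addn2 -!addSn.
move=> x; rewrite big_ord_recl unlift_none mul1r.
under eq_bigr do rewrite liftK.
have -> : tail_monom (e' None) x = tail_monom e x.
  by apply: eq_bigr => j _; rewrite /e' addn0.
have E i : tail_monom (e' (Some i)) x = tnth (sval x) (lift ord0 i) ^+ 2 * tail_monom e x.
  rewrite /tail_monom; under eq_bigr do rewrite exprD.
  rewrite big_split /= mulrC; congr (_ * _).
  rewrite (bigD1 i)//= eqxx big1 ?mulr1// => j ji.
  by rewrite (inj_eq Some_inj) eq_sym (negbTE ji) mul0n.
under eq_bigr do rewrite E /= mulN1r mulrCA.
rewrite sumrN -mulr_suml.
rewrite -[k.+2]addn2 exprD sphere_coord0_sqr; ring.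
Qed.

Lemma Pi_in_span L f : Pi L.+1 f -> in_span L f.
Proof.
move=> /Pi_sum_monom[s [c [sL fE]]].
apply: (@eq_in_span _ (fun x => \sum_(m <- s) c m * monom (fun i => m i) x)).
  by move=> x; rewrite fE.
apply: in_span_sum => m ms; apply: (@eq_in_span _ (fun x => _ * _)).
  by move=> x; rewrite monom_tail.
by apply: in_span_monom; have := sL m ms; rewrite big_ord_recl.
Qed.

Lemma lift_point_subproof (s : bool) (y : 'I_d -> R) :
  \sum_i y i ^+ 2 <= 1 ->
  enorm [tuple (if unlift ord0 i is Some j then y j else
    (-1) ^+ s * Num.sqrt (1 - \sum_i y i ^+ 2)) | i < d.+1] == 1.
Proof.
move=> y1; rewrite /enorm big_ord_recl tnth_mktuple unlift_none.
under [X in _ + X]eq_bigr do rewrite tnth_mktuple liftK.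
by rewrite exprMn sqr_sqrtr ?subr_ge0// sqrr_sign mul1r subrK sqrtr1.
Qed.

(* The points (+/- sqrt(1 - |y|^2), y) separate the two parities in x_0; the
   Kronecker substitution y_i = u^(N^i) then turns each part into a polynomial
   in u with distinct exponents. *)
Lemma sphere_basis_free L (c : _ -> R) :
  (forall x, \sum_a c a * @sphere_basis L a x = 0) -> c =1 fun=> 0.
Proof.
move=> c0; pose N := L.+2.
pose E M (t : bounded_exponent d M) := (\sum_i expo t i * N ^ i)%N.
have Einj M : (M <= L.+1)%N -> injective (@E M).
  move=> ML t t' tt'; apply/expo_inj/(sum_expn_inj _ _ tt') => i;
    by apply: leq_trans (expo_lt _ i) _.
pose p M (e : bounded_exponent d M -> R) := \sum_t e t *: 'X^(E M t) : {poly R}.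
have p0 M (e : bounded_exponent d M -> R) : (M <= L.+1)%N -> p M e = 0 -> e =1 fun=> 0.
  move=> ML pe t; have := congr1 (fun q : {poly R} => q`_(E M t)) pe.
  rewrite /p coef0 coef_sum (bigD1 t)//= coefZ coefXn eqxx mulr1 big1 ?addr0//.
  move=> t' tt'; rewrite coefZ coefXn eq_sym (inj_eq (Einj _ ML)) (negbTE tt') mulr0 //.
(* Small enough for the points to exist, since y_i^2 <= u and d u < 1; injectivity supplies
   infinitely many values of u. *)
pose u (n : nat) : R := (d.+1 + n)%:R^-1.
have u_inj : injective u.
  by move=> n m /invr_inj/eqP; rewrite eqr_nat eqn_add2l => /eqP.
have u0 n : 0 < u n by rewrite invr_gt0 ltr0n.
have u1 n : u n <= 1 by rewrite invf_le1 ?ltr0n// ler1n.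
have du n : d%:R * u n < 1 by rewrite ltr_pdivrMr ?ltr0n// mul1r ltr_nat; lia.
pose y n (i : 'I_d) := u n ^+ (N ^ i).
have yu n i : y n i ^+ 2 <= u n.
  rewrite /y -exprM -[leRHS]expr1; apply: ler_wiXn2l => //; first exact: ltW.
  by rewrite muln_gt0 expn_gt0.
have y1 n : \sum_i y n i ^+ 2 < 1.
  apply: le_lt_trans (du n); rewrite -[d in leRHS]card_ord mulr_natl -sumr_const.
  by apply: ler_sum => i _.
pose pt s n : S := exist (fun x : d.+1.-tuple R => enorm x == 1) _
  (lift_point_subproof s (ltW (y1 n))).
have ptm M (t : bounded_exponent d M) s n : tail_monom (expo t) (pt s n) = u n ^+ E M t.
  rewrite /E (big_morph _ (exprD _) (expr0 _)).
  apply: eq_bigr => i _; rewrite /= tnth_mktuple liftK /y -exprM; congr (_ ^+ _).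
  exact: mulnC.
pose cl t := c (inl t); pose cr t := c (inr t).
pose q n := Num.sqrt (1 - \sum_i y n i ^+ 2).
have q0 n : q n != 0 by rewrite gt_eqF// sqrtr_gt0 subr_gt0.
have H (s : bool) n : (p _ cl).[u n] + (-1) ^+ s * q n * (p _ cr).[u n] = 0.
  rewrite -[RHS](c0 (pt s n)) big_sumType /=; congr (_ + _).
    rewrite /p horner_sum; apply: eq_bigr => t _.
    by rewrite hornerZ hornerXn ptm.
  rewrite /p horner_sum mulr_sumr; apply: eq_bigr => t _.
  by rewrite hornerZ hornerXn ptm /= tnth_mktuple unlift_none mulrCA.
have Hl : p _ cl = 0.
  apply: (poly_eq0_inj u_inj) => n; have := H true n; have := H false n.
  by rewrite expr0 expr1; lra.
have Hr : p _ cr = 0.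
  apply: (poly_eq0_inj u_inj) => n; have := H false n; rewrite Hl horner0 add0r.
  by rewrite expr0 mul1r => /eqP; rewrite mulf_eq0 (negbTE (q0 n)) => /eqP.
by case=> t; [apply: (p0 _ cl)|apply: (p0 _ cr)].
Qed.

Theorem has_dim_Pi L : (0 < L)%N ->
  has_dim (@Pi R d L) ('C(d + L, d) + 'C(d + L.-1, d)).
Proof.
case: L => // L _; rewrite -!card_bounded_exponent -card_sum.
apply: (has_dim_family (@Pi_sphere_basis L)) => [f|]; first exact: Pi_in_span.
exact: sphere_basis_free.
Qed.

(** The explicit basis shows that the [xget] defining [dim_Pi] does select a dimension. *)
Lemma has_dim_dim_Pi L : (0 < L)%N -> has_dim (@Pi R d L) (dim_Pi R d L).
Proof.
move=> /has_dim_Pi; exact: (@xgetI _ 0%N [set n | has_dim (@Pi R d L) n]).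
Qed.

Lemma dim_PiE L : (0 < L)%N ->
  dim_Pi R d L = ('C(d + L, d) + 'C(d + L.-1, d))%N.
Proof. by move=> L0; exact: has_dim_inj (has_dim_dim_Pi L0) (has_dim_Pi L0). Qed.

End Basis.

(** * The expected number of close pairs *)

Section KernelBasis.
Context (R : realType) (d L n : nat) (K : sphere R d -> sphere R d -> R).
Hypothesis rK : reproducing_kernel L K.
Hypothesis dimn : has_dim (@Pi R d L) n.
Local Notation S := (sphere R d).
Local Notation mu := (sphere_measure R d).
Local Notation mufin := (sphere_measure_fin R d).

(** Take any basis b. Its Gram matrix G is invertible: a vector in the kernel of G gives a function
    of zero L^2 norm, which is 0 by [Pi_definite]. The reproducing property of b at y says b(y) = G
    c(y), with c(y) the coordinates of K(., y); so G^-1 b is at once the dual basis and the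
    coefficient vector of the kernel. *)
Lemma kernel_biorthogonal : exists b b' : 'I_n -> S -> R,
  [/\ forall a, bmf (b a), forall a, bmf (b' a),
      forall a c, \int[mu]_x (b a x * b' c x) = (a == c)%:R &
      forall x y, K x y = \sum_a b a x * b' a y].
Proof.
have [PK rep] := rK; have [b Pb bU] := dimn.
have bb a : bmf (b a) by exact: Pi_bmf (Pb a).
have /choice[c cE] : forall y, exists c : 'rV[R]_n, forall x, K x y = \sum_a c 0 a * b a x.
  by move=> y; have [c [cE _]] := bU _ (PK y); exists c.
pose G : 'M[R]_n := \matrix_(i, j) \int[mu]_x (b i x * b j x).
have GC i j : \int[mu]_x (b i x * b j x) = \int[mu]_x (b j x * b i x).
  by apply: eq_Rintegral => x _; exact: mulrC.
have int_sum (g : S -> R) (u : 'I_n -> R) : bmf g ->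
    \int[mu]_x (g x * \sum_a u a * b a x) = \sum_a u a * \int[mu]_x (g x * b a x).
  move=> bg; transitivity (\int[mu]_x \sum_a u a * (g x * b a x)).
    by apply: eq_Rintegral => x _; rewrite mulr_sumr; apply: eq_bigr => a _; exact: mulrCA.
  rewrite (bmf_Rintegral_sum mufin); last by move=> a _; apply: bmfZ; exact: bmfM.
  by apply: eq_bigr => a _; rewrite (bmf_RintegralZ mufin)//; exact: bmfM.
have Gc i y : b i y = \sum_a G i a * c y 0 a.
  rewrite (rep _ y (Pb i)); transitivity (\int[mu]_x (b i x * \sum_a c y 0 a * b a x)).
    by apply: eq_Rintegral => x _; rewrite cE.
  by rewrite int_sum//; apply: eq_bigr => a _; rewrite mxE mulrC.
have Gu : G \in unitmx.
  rewrite -row_free_unit -kermx_eq0; apply/eqP/row_matrixP => k; rewrite row0.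
  set u := row k _; have uG : u *m G = 0 by apply/sub_kermxP; exact: row_sub.
  clearbody u.
  pose f x := \sum_a u 0 a * b a x.
  have Pf : Pi L f by apply: Pi_sum => a _; exact: PiZ.
  have f0 : f =1 fun=> 0.
    apply: (Pi_definite rK Pf); rewrite int_sum; last exact: Pi_bmf Pf.
    rewrite big1// => a _.
    suff -> : \int[mu]_x ((\sum_a0 u 0 a0 * b a0 x) * b a x) = (u *m G) 0 a.
      by rewrite uG mxE mulr0.
    transitivity (\int[mu]_x (b a x * \sum_a0 u 0 a0 * b a0 x)).
      by apply: eq_Rintegral => x _; exact: mulrC.
    by rewrite int_sum// [RHS]mxE; apply: eq_bigr => i _; rewrite [G _ _]mxE GC.
  have [v [_ vU]] := bU _ Pf; rewrite -(vU u)// -(vU 0)// => x.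
  by rewrite f0 big1// => a _; rewrite mxE mul0r.
pose b' a y := \sum_i (invmx G) a i * b i y.
have b'E a y : b' a y = c y 0 a.
  transitivity ((invmx G *m (G *m (c y)^T)) a 0); last by rewrite mulKmx// !mxE.
  rewrite [RHS]mxE; apply: eq_bigr => i _; rewrite Gc mxE; congr (_ * _).
  by apply: eq_bigr => j _; rewrite [RHS]mulrC mulrC [(c y)^T _ _]mxE.
exists b, b'; split => // [a|a e|x y].
- by apply: bmf_sum => i _; exact: bmfZ.
- rewrite /b' int_sum//.
  transitivity ((invmx G *m G) e a); last by rewrite mulVmx// mxE eq_sym.
  by rewrite mxE; apply: eq_bigr => i _; rewrite mxE GC.
- by rewrite cE; apply: eq_bigr => a _; rewrite b'E mulrC.
Qed.

Lemma Rintegral_kernel_diag : \int[mu]_x K x x = n%:R.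
Proof.
have [b [b' [bb bb' biorth KE]]] := kernel_biorthogonal.
transitivity (\int[mu]_x \sum_a b a x * b' a x).
  by apply: eq_Rintegral => x _; rewrite KE.
rewrite (bmf_Rintegral_sum mufin); last by move=> a _; exact: bmfM.
under eq_bigr do rewrite biorth eqxx.
by rewrite sumr_const card_ord.
Qed.

End KernelBasis.

Section ClosePairs.
Context (R : realType) (d n : nat) (t : R).
Local Notation S := (sphere R d).
Local Notation sval := (@sphere_val R d).

Definition close (z : S * S) : bool := edist (sval z.1) (sval z.2) <= t.

Lemma measurable_close : measurable_fun setT close.
Proof.
apply: measurable_fun_ler => //.
pose q (z : S * S) := \sum_i (tnth (sval z.1) i - tnth (sval z.2) i) ^+ 2.
have mq : measurable_fun setT q.
  apply: measurable_sum => i; apply: measurable_funX; apply: measurable_funB.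
    apply: (measurableT_comp (measurable_tnth i)).
    exact: (measurableT_comp (@measurable_sphere_val R d) measurable_fst).
  apply: (measurableT_comp (measurable_tnth i)).
  exact: (measurableT_comp (@measurable_sphere_val R d) measurable_snd).
apply: (measurableT_comp _ mq); apply: continuous_measurable_fun.
exact: sqrt_continuous.
Qed.

Lemma bmf_close : bmf (fun z => (close z)%:R : R).
Proof. exact: (bmf_natb _ measurable_close). Qed.

Lemma closeC x y : close (x, y) = close (y, x).
Proof.
by rewrite /close /edist; congr (Num.sqrt _ <= _); apply: eq_bigr => i _ /=; ring.
Qed.

Definition close_at (i j : 'I_n) : set (n.-tuple S) :=
  [set w | close (tnth w i, tnth w j)].

Lemma measurable_close_at i j : measurable (close_at i j).
Proof.
rewrite -[X in measurable X]setTI.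
have -> : close_at i j = (fun w => close (tnth w i, tnth w j)) @^-1` [set true] by [].
have : measurable_fun setT (fun w : n.-tuple S => close (tnth w i, tnth w j)).
  apply: (measurableT_comp measurable_close).
  by apply: measurable_fun_pair; exact: measurable_tnth.
exact.
Qed.

Lemma expectation_close_pairs dO (Omega : measurableType dO)
    (P : probability Omega R) (X : {RV P >-> n.-tuple S}) :
  ('E_P[fun w => (close_pairs t (X w))%:R] =
   \sum_(i < n) \sum_(j < n | (i < j)%N) distribution P X (close_at i j))%E.
Proof.
have mA (p : 'I_n * 'I_n) : measurable (X @^-1` close_at p.1 p.2).
  exact: measurable_funPTI (measurable_close_at p.1 p.2).
rewrite unlock.
transitivity (\int[P]_w \sum_(p <- [seq p : 'I_n * 'I_n <- index_enum _ | (p.1 < p.2)%N])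
   (\1_(X @^-1` close_at p.1 p.2) w : R)%:E)%E.
  apply: eq_integral => w _; rewrite sumEFin; congr EFin.
  rewrite /close_pairs -sum1_card natr_sum big_filter big_mkcond [RHS]big_mkcond.
  apply: eq_bigr => p _; rewrite indicE; case: ifPn => [|pA].
    by rewrite inE /= => /andP[-> cl]; rewrite mem_set.
  case: ifPn => // p12; rewrite memNset// => cl.
  by case/negP: pA; rewrite inE /= p12; exact: cl.
rewrite ge0_integral_sum//; last first.
- by move=> p; apply/measurable_EFinP; exact: measurable_indic.
under eq_bigr do rewrite integral_indic// setIT.
by rewrite big_filter pair_big_dep.
Qed.

End ClosePairs.

Section HarmonicExpectation.
Context (R : realType) (d L n : nat) (K : sphere R d -> sphere R d -> R) (t : R).
Hypothesis rK : reproducing_kernel L K.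
Hypothesis dimn : has_dim (@Pi R d L) n.
Local Notation S := (sphere R d).
Local Notation mu := (sphere_measure R d).
Local Notation mufin := (sphere_measure_fin R d).
Local Notation pm := (power_measure (sphere_measure R d) n).

Lemma harmonic_two_point :
  (\sum_(i < n) \sum_(j < n | (i < j)%N) \int[pm]_(w in close_at t i j)
    (\det (\matrix_(k, l) K (tnth w k) (tnth w l)) / n`!%:R)%:E)%E =
  (2^-1 * \int[mu]_x \int[mu]_y ((close t (x, y))%:R * (K x x * K y y - K x y ^+ 2)))%:E.
Proof.
have [b [b' [bb bb' biorth KE]]] := kernel_biorthogonal rK dimn.
have bW := @bmf_close R d t.
have KpE : K = pair_kernel b b'.
  by apply/funext => x; apply/funext => y; rewrite KE.
pose D (w : n.-tuple S) := \det (\matrix_(k, l) K (tnth w k) (tnth w l)).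
have bD : bmf D.
  apply: bmf_sum => s _; apply: bmfZ; apply: bmf_prod => k _.
  have : bmf (fun w : n.-tuple S => \sum_a b a (tnth w k) * b' a (tnth w (s k))).
    by apply: bmf_sum => a _; apply: bmfM; exact: bmf_tnth.
  by apply: eq_bmf => w; rewrite mxE KE.
have pmfin := power_measure_fin mufin n.
have bt (i j : 'I_n) : bmf (fun w : n.-tuple S => (close t (tnth w i, tnth w j))%:R : R).
  by apply: bmf_comp bW; apply: measurable_fun_pair; exact: measurable_tnth.
have E (i j : 'I_n) : (\int[pm]_(w in close_at t i j) (D w / n`!%:R)%:E =
    ((n`!%:R)^-1 * \int[pm]_w ((close t (tnth w i, tnth w j))%:R * D w))%:E)%E.
  rewrite -(bmf_RintegralZ pmfin); last exact: bmfM.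
  rewrite -(bmf_RintegralE pmfin); last by apply: bmfZ; exact: bmfM.
  rewrite [LHS]integral_mkcond; apply: eq_integral => w _; rewrite patchE.
  case: ifPn => wA.
    by move: wA; rewrite inE /close_at /= => ->; rewrite mul1r mulrC.
  have /negbTE -> : ~~ close t (tnth w i, tnth w j).
    by apply: contra wA => cl; rewrite inE.
  by rewrite mul0r mulr0.
under eq_bigr => i _ do under eq_bigr => j _ do rewrite E.
under eq_bigr => i _ do rewrite sumEFin -mulr_sumr.
rewrite sumEFin -mulr_sumr; congr EFin.
have sW (x y : S) : (close t (x, y))%:R = (close t (y, x))%:R :> R by rewrite closeC.
have := two_point_sum mufin bb bb' biorth bW sW.
rewrite -KpE => ->.
have n0 : n`!%:R != 0 :> R by rewrite pnatr_eq0 -lt0n fact_gt0.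
rewrite mulrA; congr (_ * _); first by field.
apply: eq_Rintegral => x _; apply: eq_Rintegral => y _.
by rewrite (kernel_sym rK y x) expr2.
Qed.

End HarmonicExpectation.

Section ExpectationBound.
Context (R : realType) (d L : nat).
Local Notation D := d.+1.
Hypothesis L1 : (1 <= L)%N.
Hypothesis DL : (D, L) <> (1%N, 1%N).
Variable t : R.
Hypothesis t0 : 0 <= t.
Hypothesis ht : t <= (D%:R + 6) / ((2 * L%:R + D%:R) * L%:R).
Local Notation S := (sphere R D).
Local Notation mu := (sphere_measure R D).
Local Notation mufin := (sphere_measure_fin R D).
Local Notation sval := (@sphere_val R D).
Variable K : S -> S -> R.
Hypothesis rK : reproducing_kernel L K.

Let n := dim_Pi R D L.
Let dimn : has_dim (@Pi R D L) n := has_dim_dim_Pi R D L1.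

Let muT : mu setT = 1%E.
Proof. exact: (@probability_setT _ _ _ mu). Qed.

Lemma kernel_diag x : K x x = n%:R.
Proof.
have [k _ kE] := kernel_zonal rK.
have kd y : K y y = k.[1] by rewrite kE sphere_dotp.
rewrite kd -(Rintegral_kernel_diag rK dimn).
transitivity (\int[mu]_y k.[1]); last by apply: eq_Rintegral => y _.
rewrite Rintegral_cst//; rewrite -[LHS]mulr1; congr (_ * _).
by rewrite -[LHS]/(fine 1%E) -muT.
Qed.

Lemma pair_integral_bound :
  \int[mu]_x \int[mu]_y ((close t (x, y))%:R * (K x x * K y y - K x y ^+ 2)) <=
  n%:R ^+ 2 * (L%:R * (L%:R + D%:R) / (D%:R + 2)) * (omega R d / omega R D)
    * (t ^+ D.+2 / D.+2%:R).
Proof.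
have [k kL kE] := kernel_zonal rK; have [PK _] := rK.
have k1 : k.[1] = n%:R by rewrite -(kernel_diag (pole R D)) kE sphere_dotp.
set M := n%:R ^+ 2 * _; set B := M * _ * _.
(* [sphere_cap_bound] requires a function nonnegative on the whole line, which n^2 - k^2 need not be
   outside [-1, 1]; hence the positive part. *)
pose g s := Num.max 0 (n%:R ^+ 2 - k.[s] ^+ 2).
have M0 : 0 <= M.
  by rewrite mulr_ge0 ?sqr_ge0// divr_ge0 ?mulr_ge0 ?addr_ge0// ler0n.
have t2 : t <= 2 := radius_le2 L1 DL t0 ht.
have mg : measurable_fun setT g.
  apply: measurable_maxr => //; apply: measurable_funB => //.
  apply: measurable_funX; apply: continuous_measurable_fun.
  exact: continuous_horner.
have gM s : chord s <= t -> g (sg s) * rho s ^+ D.+1 <= M * chord_dens D s.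
  move=> st; have := kernel_pointwise L1 DL t0 ht kL (jacobi_eq rK kL kE) st.
  rewrite k1 => H; rewrite /g /Num.max; case: ifP => // _.
  by rewrite mul0r mulr_ge0// /chord_dens mulr_ge0// exprn_ge0// ltW// ?chord_gt0 ?rho_gt0.
have bg y : bmf (fun x : S => (close t (x, y))%:R * g (dotp (sval x) (sval y))).
  apply: bmfM; first exact: (bmf_sectionr y (@bmf_close R D t)).
  have [mK [C KC]] := Pi_bmf (PK y).
  split; first exact: (measurableT_comp mg (measurable_sdotp y)).
  exists (n%:R ^+ 2 + C ^+ 2) => x; rewrite /g -kE.
  have K2 : K x y ^+ 2 <= C ^+ 2.
    by rewrite -real_normK ?num_real// lerXn2r// ?nnegrE ?(le_trans _ (KC x)).
  have n2 : 0 <= n%:R ^+ 2 :> R by exact: sqr_ge0.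
  have Kge : 0 <= K x y ^+ 2 by exact: sqr_ge0.
  rewrite /Num.max; case: ifP => _; last by rewrite normr0; lra.
  by rewrite ler_norml; apply/andP; split; lra.
have cap y : \int[mu]_x ((close t (x, y))%:R * g (dotp (sval x) (sval y))) <= B.
  rewrite -lee_fin -(bmf_RintegralE mufin (bg y)).
  apply: (sphere_cap_bound (isT : (0 < D)%N) y mg) => // [s|].
    by rewrite /g le_max lexx.
  by rewrite t0.
have bF : bmf (fun z : S * S => (close t z)%:R * (n%:R ^+ 2 - K z.1 z.2 ^+ 2)).
  apply: bmfM; first exact: bmf_close.
  apply: bmfB; first exact: bmf_cst.
  have [b [b' [bb bb' _ KE]]] := kernel_biorthogonal rK dimn.
  have bK : bmf (fun z : S * S => K z.1 z.2).
    have : bmf (fun z : S * S => \sum_a b a z.1 * b' a z.2).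
      apply: bmf_sum => a _; apply: bmfM.
        exact: (bmf_comp measurable_fst (bb a)).
      exact: (bmf_comp measurable_snd (bb' a)).
    by apply: eq_bmf => z; rewrite KE.
  by apply: eq_bmf (bmfM bK bK) => z.
rewrite [leLHS](_ : _ = \int[mu]_x \int[mu]_y ((close t (x, y))%:R * (n%:R ^+ 2 - K x y ^+ 2))); last first.
  apply: eq_Rintegral => x _; apply: eq_Rintegral => y _.
  by rewrite !kernel_diag expr2.
rewrite (bmf_swap mufin mufin bF) /=.
have -> : B = \int[mu]_y B.
  by rewrite Rintegral_cst// -[LHS]mulr1 -[X in _ * X]/(fine 1%E) -muT.
apply: (bmf_le_Rintegral mufin); [|exact: bmf_cst|].
  have bF' : bmf (fun z : S * S => (close t (z.2, z.1))%:R * (n%:R ^+ 2 - K z.2 z.1 ^+ 2)).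
    apply: (bmf_comp _ bF (h := fun z : S * S => (z.2, z.1))).
    by apply: measurable_fun_pair.
  exact: (bmf_partial mufin mufin bF').
move=> y; apply: le_trans (cap y).
apply: (bmf_le_Rintegral mufin) (bg y) _; first exact: (bmf_sectionr y bF).
by move=> x /=; rewrite ler_wpM2l// /g -kE le_max lexx orbT.
Qed.

Lemma expectation_bound dO (Omega : measurableType dO) (P : probability Omega R)
    (X : {RV P >-> n.-tuple S}) :
  (forall A, measurable A -> distribution P X A =
    (\int[power_measure mu n]_(x in A)
      ((\det (\matrix_(i, j) K (tnth x i) (tnth x j)) / n`!%:R)%:E))%E) ->
  ('E_P[fun w => (close_pairs t (X w))%:R] <= (bound_coef R D L * t ^+ (D + 2))%:E)%E.
Proof.
move=> hX; rewrite expectation_close_pairs.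
have -> : (\sum_(i < n) \sum_(j < n | (i < j)%N) distribution P X (close_at t i j))%E =
    (\sum_(i < n) \sum_(j < n | (i < j)%N) \int[power_measure mu n]_(w in close_at t i j)
    (\det (\matrix_(k, l) K (tnth w k) (tnth w l)) / n`!%:R)%:E)%E.
  apply: eq_bigr => i _; apply: eq_bigr => j _.
  exact: hX (measurable_close_at t i j).
rewrite (harmonic_two_point t rK dimn) lee_fin.
apply: le_trans (ler_wpM2l _ pair_integral_bound) _; first by rewrite invr_ge0.
rewrite le_eqVlt; apply/orP; left; apply/eqP.
rewrite /bound_coef -/n addn2 -[d in omega R d]/D.-1.
have o0 : omega R D != 0 by rewrite gt_eqF// omega_gt0.
have -> : D.+2%:R = D%:R + 2 :> R by rewrite -natrD addn2.
have D2 : D%:R + 2 != 0 :> R by rewrite gt_eqF// addr_gt0.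
move: (omega R D) o0 (omega R D.-1) (D%:R : R) D2 (t ^+ D.+2) => o o0 o' u u2 v.
by field; rewrite o0 u2.
Qed.

End ExpectationBound.

(** * Asymptotics *)

Section Asymptotics.
Context (R : realType) (d : nat).
Hypothesis d0 : (0 < d)%N.
Local Notation n L := (dim_Pi R d L).

Lemma dim_Pi_fact L : (0 < L)%N -> (n L * d`! = (d + L) ^_ d + (d + L.-1) ^_ d)%N.
Proof. by move=> L0; rewrite (dim_PiE R d L0) mulnDl !bin_ffact. Qed.

(** All factors of the two falling factorials lie between L and L + d; this bound and [dim_Pi_le]
    are the only asymptotic input. *)
Lemma dim_Pi_ge L : (0 < L)%N -> (2 * L ^ d <= n L * d`!)%N.
Proof.
move=> L0; rewrite dim_Pi_fact// mul2n -addnn.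
have H m : (d + L.-1 <= m)%N -> (L ^ d <= m ^_ d)%N.
  move=> mL; rewrite ffact_prod -[X in (L ^ X)%N]card_ord -prod_nat_const.
  by apply: leq_prod => i _; have := ltn_ord i; lia.
by rewrite leq_add// H// leq_add2l leq_pred.
Qed.

Lemma dim_Pi_le L : (0 < L)%N -> (n L * d`! <= 2 * (L + d) ^ d)%N.
Proof.
move=> L0; rewrite dim_Pi_fact// mul2n -addnn.
have H m : (m <= L + d)%N -> (m ^_ d <= (L + d) ^ d)%N.
  move=> mL; rewrite ffact_prod -[X in (_ <= _ ^ X)%N]card_ord -prod_nat_const.
  by apply: leq_prod => i _; exact: leq_trans (leq_subr _ _) mL.
by apply: leq_add; apply: H; lia.
Qed.

Lemma dim_Pi_gt0 L : (0 < L)%N -> (0 < n L)%N.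
Proof.
move=> L0; have := dim_Pi_ge L0; case: (n L) => //.
by rewrite mul0n leqn0 muln_eq0 expn_eq0 !eqn0Ngt L0.
Qed.

Local Notation e := (2 / d%:R : R).

Let dR : d%:R != 0 :> R. Proof. by rewrite pnatr_eq0 -lt0n. Qed.
Let e0 : 0 <= e. Proof. by rewrite divr_ge0. Qed.

Lemma powR_exp_root (x : R) : 0 <= x -> (x ^+ d) `^ e = x ^+ 2.
Proof.
by move=> x0; rewrite -powR_mulrn// -powRrM mulrCA mulfV// mulr1 powR_mulrn.
Qed.

Lemma powR_dim_Pi_ge L : (0 < L)%N ->
  2 `^ e * L%:R ^+ 2 <= d`!%:R `^ e * (n L)%:R `^ e.
Proof.
move=> L0; rewrite -powRM// -powR_exp_root// -powRM ?exprn_ge0//.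
apply: ge0_ler_powR; rewrite ?nnegrE ?mulr_ge0 ?exprn_ge0//.
by rewrite mulrC -natrX -!natrM ler_nat mulnC [leqRHS]mulnC; exact: dim_Pi_ge.
Qed.

Lemma powR_dim_Pi_le L : (0 < L)%N ->
  d`!%:R `^ e * (n L)%:R `^ e <= 2 `^ e * (L + d)%:R ^+ 2.
Proof.
move=> L0; rewrite -powRM// -powR_exp_root// -powRM ?exprn_ge0//.
apply: ge0_ler_powR; rewrite ?nnegrE ?mulr_ge0 ?exprn_ge0//.
by rewrite mulrC -natrX -!natrM ler_nat; exact: dim_Pi_le.
Qed.

(* L (L + d) n^(-2 / d) tends to (d! / 2)^(2 / d). *)
Lemma bound_coef_asymp :
  (fun L => bound_coef R d L - C_ R d * (n L)%:R `^ (2 + 2 / d%:R)) =o_\oo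
  (fun L => (n L)%:R `^ (2 + 2 / d%:R) : R).
Proof.
apply/eqoP => eps eps0.
pose A : R := omega R d.-1 / (2 * (d%:R + 2) ^+ 2 * omega R d).
pose F : R := d`!%:R `^ e; pose T : R := 2 `^ e.
have F0 : 0 < F by rewrite powR_gt0// ltr0n fact_gt0.
have T0 : 0 < T by rewrite powR_gt0.
have o0 : 0 < omega R d by exact: omega_gt0.
have o1 : 0 < omega R d.-1 by exact: omega_gt0.
have d2 : 0 < d%:R + 2 :> R by rewrite addr_gt0// ltr0n.
have A0 : 0 < A by exact: (divr_gt0 o1 (mulr_gt0 (mulr_gt0 (ltr0Sn R 1) (exprn_gt0 2 d2)) o0)).
have CE : C_ R d = A * (F / T).
  rewrite /C_ Gamma_fact powRD ?pnatr_eq0 ?implybT// powRr1// /A -/F -/T.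
  move: F T F0 T0 => F T F0 T0.
  by field; rewrite (gt_eqF o0) (gt_eqF T0) (gt_eqF d2).
near=> L.
have L0 : (0 < L)%N by near: L; exact: nbhs_infty_gt.
have LR : 0 < L%:R :> R by rewrite ltr0n.
have n0 : (n L)%:R != 0 :> R by rewrite pnatr_eq0 -lt0n dim_Pi_gt0.
have nE : (n L)%:R `^ (2 + e) = (n L)%:R ^+ 2 * (n L)%:R `^ e :> R.
  by rewrite powRD ?n0 ?implybT// powR_mulrn.
set N := (n L)%:R `^ e in nE.
have N0 : 0 <= N by exact: powR_ge0.
have N2 : 0 <= (n L)%:R ^+ 2 :> R by exact: sqr_ge0.
(* z = (d! / 2)^(2 / d) n^(2 / d). The bounds on the dimension place it in [L^2, (L + d)^2], which
   also contains L (L + d). *)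
pose z := F / T * N.
have zge : L%:R ^+ 2 <= z.
  by rewrite /z mulrAC ler_pdivlMr// mulrC; exact: powR_dim_Pi_ge.
have zle : z <= (L%:R + d%:R) ^+ 2.
  by rewrite /z mulrAC ler_pdivrMr// [leRHS]mulrC -natrD; exact: powR_dim_Pi_le.
have rE : bound_coef R d L - C_ R d * (n L)%:R `^ (2 + e) =
    A * (n L)%:R ^+ 2 * (L%:R * (L%:R + d%:R) - z).
  by rewrite nE CE /bound_coef /A /z; field; rewrite (gt_eqF o0) (gt_eqF T0) (gt_eqF d2).
(* The relative error is at most d / L: L (L + d) = L^2 (1 + d / L) <= z (1 + d / L), and z (1 - d /
   L) <= z L / (L + d) <= L (L + d). *)
have zb : `|L%:R * (L%:R + d%:R) - z| <= d%:R / L%:R * z.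
  have dR0 : 0 <= d%:R :> R by [].
  have H1 : L%:R * (L%:R + d%:R) <= z + d%:R / L%:R * z.
    have -> : z + d%:R / L%:R * z = z * ((L%:R + d%:R) / L%:R) by field; rewrite gt_eqF.
    rewrite mulrA ler_pdivlMr// mulrAC -expr2 ler_wpM2r// addr_ge0//.
  have H2 : z - d%:R / L%:R * z <= L%:R * (L%:R + d%:R).
    have Ld : 0 < L%:R + d%:R :> R by rewrite addr_gt0// ltr0n.
    apply: (@le_trans _ _ (z * (L%:R / (L%:R + d%:R)))).
      have -> : z - d%:R / L%:R * z = z * (1 - d%:R / L%:R) by ring.
      rewrite ler_wpM2l//; first exact: le_trans (sqr_ge0 _) zge.
      rewrite ler_pdivlMr// -(ler_pM2l LR).
      have -> : L%:R * ((1 - d%:R / L%:R) * (L%:R + d%:R)) = L%:R * L%:R - d%:R ^+ 2 :> R.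
        by field; rewrite gt_eqF.
      by rewrite lerBlDr lerDl sqr_ge0.
    by rewrite mulrA ler_pdivrMr// [leLHS]mulrC -mulrA -expr2 ler_pM2l.
  by rewrite ler_norml; apply/andP; split; lra.
have An0 : 0 <= A * (n L)%:R ^+ 2 by rewrite mulr_ge0// ltW.
have nN0 : 0 <= (n L)%:R ^+ 2 * N by exact: mulr_ge0.
rewrite rE nE normrM (ger0_norm An0) (ger0_norm nN0).
apply: le_trans (ler_wpM2l An0 zb) _.
rewrite [leLHS](_ : _ = (A * (F / T) * d%:R / L%:R) * ((n L)%:R ^+ 2 * N)); last first.
  by rewrite /z; field; rewrite !gt_eqF.
rewrite ler_wpM2r ?mulr_ge0// ler_pdivrMr// [leRHS]mulrC -ler_pdivrMr//.
by near: L; apply: filterS (nbhs_infty_gtr _) => L; exact: ltW.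
Unshelve. all: by end_near.
Qed.

End Asymptotics.

Theorem proposition4 (R : realType) (d : nat) (hd : (1 <= d)%N) :
  (forall (L : nat) (hL : (1 <= L)%N) (hdL : (d, L) <> (1%N, 1%N))
      (dO : measure_display) (Omega : measurableType dO)
      (P : probability Omega R)
      (X : {RV P >-> (dim_Pi R d L).-tuple (sphere R d)})
      (hX : harmonic_ensemble X)
      (t : R) (ht0 : 0 <= t)
      (ht : t <= (d%:R + 6) / ((2 * L%:R + d%:R) * L%:R)),
    ('E_P[fun w => (close_pairs t (X w))%:R] <=
       (bound_coef R d L * t ^+ (d + 2))%:E)%E)
  /\
  (exists2 r : nat -> R,
     r =o_\oo (fun L => (dim_Pi R d L)%:R `^ (2 + 2 / d%:R)) &
     forall (L : nat) (hL : (1 <= L)%N) (t : R) (ht0 : 0 <= t)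
       (ht : t <= (d%:R + 6) / ((2 * L%:R + d%:R) * L%:R)),
     bound_coef R d L * t ^+ (d + 2) =
       C_ R d * (dim_Pi R d L)%:R `^ (2 + 2 / d%:R) * t ^+ (d + 2)
       + r L * t ^+ (d + 2)).
Proof.
split; last first.
  (* The remainder is the difference itself; all the content is in its order of growth. *)
  exists (fun L => bound_coef R d L - C_ R d * (dim_Pi R d L)%:R `^ (2 + 2 / d%:R)).
    exact: bound_coef_asymp.
  by move=> L _ t _ _; rewrite -mulrDl addrC subrK.
case: d hd => // d' _ L hL hdL dO Omega P X [K rK hX] t ht0 ht.
exact: (expectation_bound hL hdL ht0 ht rK hX).
Qed.
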